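(* Let $K$ be a field of characteristic $0$ and $GL_n=GL_n(K)$. Let $G$ be a subgroup of $GL_n$ satisfying condition (i) (equivalently, condition (ii)) below: (i) for any $Y\in\mathcal{C}$, with associated symmetric algebra $S(W)$, the subspace $Y^G$ is finitely generated as an $S(W)^G$-module; (ii) for any finitely generated graded commutative $K$-algebra $R$ on which $GL_n$ acts rationally via graded $K$-algebra automorphisms, the subalgebra $R^G$ of $G$-invariants is a finitely generated $K$-algebra. Let $Z=\bigoplus_{d=0}^\infty Z_d$ be a graded representation of $GL_n$ for which $\mathrm{ch}_Z(q)$ is a nice rational function. Then the Hilbert series $H(Z^G,q)=\sum_{d=0}^\infty\dim_K(Z_d^G)q^d\in\mathbb{Z}[[q]]$ of the subspace of $G$-invariants in $Z$ is a rational function of the form \[ H(Z^G,q)=\frac{P(q)}{\prod_{j=1}^m(1-q^{d_j})} \] for some positive integers $m,d_1,\ldots,d_m$ and a polynomial $P\in\mathbb{Z}[q]$.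
   Context: Every representation $Z$ of $GL_n$ is a rational representation: a $K$-vector space with linear $GL_n$-action, spanned by finite dimensional $GL_n$-invariant subspaces, such that for each finite dimensional invariant subspace $U$ the map $GL_n\to GL(U)$ is a morphism of affine algebraic varieties. For a finite dimensional representation $\rho:GL_n\to GL(Z)$, the formal character $\mathrm{ch}_Z\in\mathbb{Z}[t_1^{\pm1},\ldots,t_n^{\pm1}]$ is the Laurent polynomial with $\mathrm{Tr}(\rho(\mathrm{diag}(z_1,\ldots,z_n)))=\mathrm{ch}_Z(z_1,\ldots,z_n)$ for all $z_1,\ldots,z_n\in K\setminus\{0\}$; it is symmetric in the $t_i$. Gradings are by $\mathbb{N}_0=\{0,1,2,\ldots\}$. A graded representation of $GL_n$ is a representation $Z=\bigoplus_{d=0}^\infty Z_d$ with each $Z_d$ finite dimensional and $GL_n$-invariant; its formal character is $\mathrm{ch}_Z(q)=\sum_{d=0}^\infty\mathrm{ch}_{Z_d}q^d\in\mathbb{Z}[t_1^{\pm1},\ldots,t_n^{\pm1}]^{S_n}[[q]]$. $Z^G$ denotes the subspace of $G$-fixed points. An element $f\in\mathbb{Z}[t_1^{\pm1},\ldots,t_n^{\pm1}][[q]]$ is a nice rational function if it is of the form $f=P(t_1,\ldots,t_n,q)/\prod_{(\alpha,k)}(1-t_1^{\alpha_1}\cdots t_n^{\alpha_n}q^k)$, where $P\in\mathbb{Z}[t_1^{\pm1},\ldots,t_n^{\pm1}][q]$ and the product ranges over a finite multiset of pairs $(\alpha,k)$ with $\alpha\in\mathbb{Z}^n$, $k\in\mathbb{N}_0$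 (meaning that the denominator is nonzero and $f$ times the denominator equals $P$). The class $\mathcal{C}$ consists of the graded representations $Y$ of $GL_n$ that also have the structure of a finitely generated graded module over the symmetric tensor algebra (polynomial algebra) $S(W)$ for some finite dimensional graded representation $W$ of $GL_n$ (with the grading on $S(W)$ induced by that of $W$), such that $g\cdot(fm)=(g\cdot f)(g\cdot m)$ for all $g\in GL_n$, $f\in S(W)$, $m\in Y$. Conditions (i) and (ii) on a subgroup $G\le GL_n$ are equivalent. *)

(* Defs.v *)
From HB Require Import structures.
From mathcomp Require Import all_boot all_order all_algebra.
From mathcomp Require Import mpoly.

Set Implicit Arguments.
Unset Strict Implicit.
Unset Printing Implicit Defensive.

Import GRing.Theory.
Local Open Scope ring_scope.
Local Notation "x %:F" := (tofrac x).


(* GL_n(K) is the set [unitmx] of the n x n matrices.  A family of maps indexed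
   by GL_n(K) is a function on all of 'M[K]_n whose values outside [unitmx] are
   irrelevant: no definition below constrains or uses them. *)

(* Subspaces of a possibly infinite-dimensional space are predicates V -> Prop;
   the library notions of freeness, span and dimension need a vectType. *)
Section LinearAlgebra.
Variables (K : fieldType) (V : lmodType K).

Definition free_family m (e : 'I_m -> V) : Prop :=
  forall c : 'I_m -> K, \sum_i c i *: e i = 0 -> forall i, c i = 0.

Definition in_span m (e : 'I_m -> V) (v : V) : Prop :=
  exists c : 'I_m -> K, v = \sum_i c i *: e i.

Definition is_subspace (U : V -> Prop) : Prop :=
  U 0 /\ forall (a : K) (u v : V), U u -> U v -> U (a *: u + v).

Definition is_basis (U : V -> Prop) m (e : 'I_m -> V) : Prop :=
  free_family e /\ forall v, U v <-> in_span e v.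

Definition has_dim (U : V -> Prop) (m : nat) : Prop :=
  exists e : 'I_m -> V, is_basis U e.

Definition finite_dim (U : V -> Prop) : Prop := exists m, has_dim U m.

(* Column j of A holds the coordinates of f (e j). *)
Definition is_matrix_of (f : V -> V) m (e : 'I_m -> V) (A : 'M[K]_m) : Prop :=
  forall j, f (e j) = \sum_i A i j *: e i.

Definition has_trace (U : V -> Prop) (f : V -> V) (x : K) : Prop :=
  exists m (e : 'I_m -> V) (A : 'M[K]_m),
    [/\ is_basis U e, is_matrix_of f e A & x = \tr A].

Record is_grading (Vd : nat -> V -> Prop) : Prop := IsGrading {
  grading_subspace : forall d, is_subspace (Vd d);
  grading_span : forall v, exists N (u : nat -> V),
    (forall d, Vd d (u d)) /\ v = \sum_(d < N) u d;
  grading_direct : forall N (u : nat -> V),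
    (forall d, Vd d (u d)) -> \sum_(d < N) u d = 0 ->
    forall d, (d < N)%N -> u d = 0
}.

End LinearAlgebra.

Section Representations.
Variables (K : fieldType) (n : nat).

Record is_subgroup (G : 'M[K]_n -> Prop) : Prop := IsSubgroup {
  subgroup_unit : forall g, G g -> g \in unitmx;
  subgroup_one : G 1%:M;
  subgroup_mul : forall g h, G g -> G h -> G (g *m h);
  subgroup_inv : forall g, G g -> G (invmx g)
}.

(* Elements of the coordinate ring K[x_ij, 1/det] of GL_n, as functions. *)
Definition regular_fun (f : 'M[K]_n -> K) : Prop :=
  exists (p : {mpoly K[n * n]}) (k : nat), forall g, g \in unitmx ->
    f g = p.@[fun i => mxvec g 0 i] / \det g ^+ k.

Section Rep.
Variable V : lmodType K.
Implicit Types (act : 'M[K]_n -> V -> V) (Vd : nat -> V -> Prop).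

Definition is_invariant act (U : V -> Prop) : Prop :=
  forall g v, g \in unitmx -> U v -> U (act g v).

Record is_rational_rep act : Prop := IsRationalRep {
  rep_linear : forall g, g \in unitmx -> linear (act g);
  rep_one : forall v, act 1%:M v = v;
  rep_mul : forall g h v, g \in unitmx -> h \in unitmx ->
    act (g *m h) v = act g (act h v);
  rep_spanned : forall v, exists k (u : 'I_k -> V), v = \sum_i u i /\
    forall i, exists U : V -> Prop,
      [/\ finite_dim U, is_invariant act U & U (u i)];
  rep_rational : forall m (e : 'I_m -> V) (A : 'M[K]_n -> 'M[K]_m),
    free_family e ->
    (forall g, g \in unitmx -> is_matrix_of (act g) e (A g)) ->
    forall i j, regular_fun (fun g => A g i j)
}.

Record is_graded_rep act Vd : Prop := IsGradedRep {
  graded_rep_rational : is_rational_rep act;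
  graded_rep_grading : is_grading Vd;
  graded_rep_finite : forall d, finite_dim (Vd d);
  graded_rep_invariant : forall d, is_invariant act (Vd d)
}.

Definition fixed (G : 'M[K]_n -> Prop) act (v : V) : Prop :=
  forall g, G g -> act g v = v.

End Rep.

(* The ring Z[t_1^{+-1},...,t_n^{+-1}] is realized inside the fraction field of
   Z[t_1,...,t_n], as the fractions whose denominator is a monomial. *)
Definition is_laurent (x : {fraction {mpoly int[n]}}) : Prop :=
  exists (p : {mpoly int[n]}) (a : 'X_{1..n}), x = p%:F / 'X_[a]%:F.

(* t_1^(a_1) ... t_n^(a_n) *)
Definition laurent_monomial (a : 'rV[int]_n) : {fraction {mpoly int[n]}} :=
  \prod_(i < n) ('X_i)%:F ^ a 0 i.

(* [c] is the formal character of the subrepresentation U of V. *)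
Definition is_formal_char (V : lmodType K) (act : 'M[K]_n -> V -> V)
    (U : V -> Prop) (c : {fraction {mpoly int[n]}}) : Prop :=
  exists (p : {mpoly int[n]}) (a : 'X_{1..n}), c = p%:F / 'X_[a]%:F /\
    forall z : 'rV[K]_n, (forall i, z 0 i != 0) ->
      has_trace U (act (diag_mx z)) (mmap intr (z 0) p / mmap1 (z 0) a).

End Representations.

(* A formal power series is its sequence of coefficients. *)
Definition fps_mul_poly (R : nzRingType) (f : nat -> R) (p : {poly R}) :
    nat -> R :=
  fun d => \sum_(i < d.+1) f i * p`_(d - i).

Definition nice_rational n (f : nat -> {fraction {mpoly int[n]}}) : Prop :=
  (forall d, is_laurent (f d)) /\
  exists (P : {poly {fraction {mpoly int[n]}}}) (s : seq ('rV[int]_n * nat)),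
    let D := \prod_(ak <- s) (1 - laurent_monomial ak.1 *: 'X^(ak.2)) in
    [/\ forall i, is_laurent P`_i,
        D != 0
      & forall d, fps_mul_poly f D d = P`_d].

(* If e_1,...,e_m is a homogeneous basis of W then S(W) is {mpoly K[m]}, with
   'X_i standing for e_i. *)
Section SymmetricAlgebra.
Variables (K : fieldType) (m : nat).

(* The algebra endomorphism of S(W) induced by the endomorphism of W with
   matrix A: it maps 'X_j to \sum_i A i j *: 'X_i. *)
Definition sym_act (A : 'M[K]_m) (f : {mpoly K[m]}) : {mpoly K[m]} :=
  f \mPo [tuple \sum_(i < m) A i j *: 'X_i | j < m].

(* Homogeneity for the grading in which 'X_i has degree w i. *)
Definition sym_homog (w : 'I_m -> nat) (d : nat) (f : {mpoly K[m]}) : Prop :=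
  forall a, a \in msupp f -> (\sum_(i < m) a i * w i)%N = d.

Definition sym_fixed n (G : 'M[K]_n -> Prop) (A : 'M[K]_n -> 'M[K]_m)
    (f : {mpoly K[m]}) : Prop :=
  forall g, G g -> sym_act (A g) f = f.

End SymmetricAlgebra.

(* e is a homogeneous basis of the graded representation W, with e j of degree
   w j, and A g is the matrix of g in the basis e. *)
Record is_homogeneous_frame (K : fieldType) (n : nat) (W : lmodType K)
    (act : 'M[K]_n -> W -> W) (Wd : nat -> W -> Prop)
    (m : nat) (e : 'I_m -> W) (w : 'I_m -> nat) (A : 'M[K]_n -> 'M[K]_m) :
    Prop := IsHomogeneousFrame {
  frame_basis : is_basis (fun _ => True) e;
  frame_degree : forall j, Wd (w j) (e j);
  frame_matrix : forall g, g \in unitmx -> is_matrix_of (act g) e (A g)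
}.

(* Y belongs to the class C, with associated symmetric algebra S(W), where W is
   given by the data w and A of a homogeneous frame. *)
Record in_class_C (K : fieldType) (n m : nat)
    (w : 'I_m -> nat) (A : 'M[K]_n -> 'M[K]_m) (Y : lmodType K)
    (act : 'M[K]_n -> Y -> Y) (Yd : nat -> Y -> Prop)
    (smul : {mpoly K[m]} -> Y -> Y) : Prop := InClassC {
  classC_rep : is_graded_rep act Yd;
  classC_scalar : forall c y, smul c%:MP y = c *: y;
  classC_mulA : forall f g y, smul (f * g) y = smul f (smul g y);
  classC_mulDl : forall f g y, smul (f + g) y = smul f y + smul g y;
  classC_mulDr : forall f y z, smul f (y + z) = smul f y + smul f z;
  classC_graded : forall i j f y,
    sym_homog w i f -> Yd j y -> Yd (i + j)%N (smul f y);
  classC_fin_gen : exists r (y : 'I_r -> Y), forall v,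
    exists f : 'I_r -> {mpoly K[m]}, v = \sum_i smul (f i) (y i);
  classC_equivariant : forall g f y, g \in unitmx ->
    act g (smul f y) = smul (sym_act (A g) f) (act g y)
}.

Definition invariant_modules_fin_gen (K : fieldType) (n : nat)
    (G : 'M[K]_n -> Prop) : Prop :=
  forall (W : lmodType K) (wact : 'M[K]_n -> W -> W) (Wd : nat -> W -> Prop)
    (m : nat) (e : 'I_m -> W) (w : 'I_m -> nat) (A : 'M[K]_n -> 'M[K]_m),
  is_graded_rep wact Wd -> is_homogeneous_frame wact Wd e w A ->
  forall (Y : lmodType K) (act : 'M[K]_n -> Y -> Y) (Yd : nat -> Y -> Prop)
    (smul : {mpoly K[m]} -> Y -> Y),
  in_class_C w A act Yd smul ->
  exists r (y : 'I_r -> Y), (forall i, fixed G act (y i)) /\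
    forall v, fixed G act v -> exists f : 'I_r -> {mpoly K[m]},
      (forall i, sym_fixed G A (f i)) /\ v = \sum_i smul (f i) (y i).

Record is_graded_GL_algebra (K : fieldType) (n : nat) (R : comAlgType K)
    (act : 'M[K]_n -> R -> R) (Rd : nat -> R -> Prop) : Prop :=
    IsGradedGLAlgebra {
  GLalg_rational : is_rational_rep act;
  GLalg_act1 : forall g, g \in unitmx -> act g 1 = 1;
  GLalg_actM : forall g x y, g \in unitmx -> act g (x * y) = act g x * act g y;
  GLalg_grading : is_grading Rd;
  GLalg_one : Rd 0 1;
  GLalg_mul : forall i j x y, Rd i x -> Rd j y -> Rd (i + j)%N (x * y);
  GLalg_invariant : forall d, is_invariant act (Rd d)
}.

Definition fin_gen_subalgebra (K : fieldType) (R : comAlgType K)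
    (S : R -> Prop) : Prop :=
  exists r (x : 'I_r -> R), (forall i, S (x i)) /\
    forall y, S y -> exists p : {mpoly K[r]}, y = mmap (in_alg R) x p.

Definition invariant_algebras_fin_gen (K : fieldType) (n : nat)
    (G : 'M[K]_n -> Prop) : Prop :=
  forall (R : comAlgType K) (act : 'M[K]_n -> R -> R) (Rd : nat -> R -> Prop),
  is_graded_GL_algebra act Rd -> fin_gen_subalgebra (fun _ : R => True) ->
  fin_gen_subalgebra (fixed G act).

(* Main.v *)
Require Import Defs.
From HB Require Import structures.
From mathcomp Require Import all_boot all_order all_algebra.
From mathcomp Require Import mpoly mxtens.
From mathcomp Require Import zify ring.
From Stdlib Require Import Classical ClassicalEpsilon.

Set Implicit Arguments.
Unset Strict Implicit.
Unset Printing Implicit Defensive.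

Import GRing.Theory.
Local Open Scope ring_scope.

(** Let [f] be the character series of [Z].  The argument writes [f] as a finite
    combination of character series of modules [V (x) S(W)], for which the
    claim follows from finite generation, and transfers this combination from
    characters to dimensions of invariants.

    The factors [1 - t^a q^k] with [k = 0] of the given denominator are nonzero
    constants and can be cancelled.  Every [t^a] is a weight of a tensor product
    of copies of the standard representation and its dual, so there is a graded
    representation [W], in positive degrees, for which the product
    [E = prod (1 - t^b q^j)] over the weights of [W] is a multiple of the
    remaining denominator (torus_algebra).  Since [E] is the inverse of the
    character series [sigma] of [S(W)], one gets [f = P sigma] where [P = f E] is
    a polynomial in [q].  Its coefficients are virtual characters: those of [f]
    are characters, and those of [E] are obtained from those of [sigma] by the
    recursion [E sigma = 1].  Hence [Z] plus finitely many shifted modules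
    [V' (x) S(W)] has in each degree the same character as a sum of finitely many
    shifted modules [V (x) S(W)].

    In characteristic zero a character determines a rational representation of
    [GL_n] (mxrep_iso, fixed_dim_of_character), hence also the dimension of the
    invariants of [G].  This rests on the Reynolds functional.  On functions with
    denominator [det^k] it sends [p / det^k] to the apolar pairing of [p] with
    [det^k], normalized; it is invariant because linear substitutions are adjoint
    to their transposes and [det^k] is a semi-invariant.  Averaging with it
    splits representations, and shows that two representations whose characters
    agree on the group have a nonzero equivariant map between them.  Agreement on
    the diagonal torus is enough (class_function_torus): a class function is a
    polynomial in the coefficients of the characteristic polynomial, and the
    elementary symmetric functions are algebraically independent.

    The module [V (x) S(W)] is the part of [S(W + V)] that is linear in [V].  So
    only the finite generation of the algebra of invariants of a symmetric
    algebra is needed.  It is an instance of the condition on algebras, and it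
    follows from the condition on modules by applying that to the augmentation
    ideal and running Hilbert's argument (generators_of_modules).  The Hilbert
    series of this bigraded algebra counts the monomials in the generators that
    are not leading monomials of relations.  These monomials form a down-closed
    set of lattice points, and by Dickson's lemma such a set has a rational
    generating function (rational_down_closed). *)

Lemma functional_choice (A B : Type) (R : A -> B -> Prop) :
  (forall x, exists y, R x y) -> exists f, forall x, R x (f x).
Proof.
move=> h; exists (fun x => proj1_sig (constructive_indefinite_description _ (h x))).
by move=> x; case: (constructive_indefinite_description _ (h x)).
Qed.

(** * Rational power series *)

Section PowerSeries.
Variable R : comNzRingType.
Implicit Types (f g : nat -> R) (p q : {poly R}).

(** Coefficients of index below [N] only involve the truncation at [N], so
    identities between power series reduce to identities between
    polynomials. *)
Lemma fps_mul_trunc f p N d : (d < N)%N ->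
  fps_mul_poly f p d = ((\poly_(i < N) f i) * p)`_d.
Proof.
move=> ltdN; rewrite coefM; apply: eq_bigr => i _; rewrite coef_poly.
by rewrite (leq_ltn_trans _ ltdN) // -ltnS.
Qed.

Lemma eq_fps_mul f g p d : (forall i, (i <= d)%N -> f i = g i) ->
  fps_mul_poly f p d = fps_mul_poly g p d.
Proof. by move=> e; apply: eq_bigr => i _; rewrite e // -ltnS. Qed.

Lemma fps_mul_coefs p q d : fps_mul_poly (fun i => p`_i) q d = (p * q)`_d.
Proof. by rewrite coefM. Qed.

Lemma fps_mulA f p q d :
  fps_mul_poly (fps_mul_poly f p) q d = fps_mul_poly f (p * q) d.
Proof.
rewrite (@fps_mul_trunc f _ d.+1) // mulrA [RHS]coefM; apply: eq_bigr => i _.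
by rewrite (@fps_mul_trunc f p d.+1).
Qed.

Lemma fps_mul1 f d : fps_mul_poly f 1 d = f d.
Proof. by rewrite (@fps_mul_trunc f _ d.+1) // mulr1 coef_poly ltnSn. Qed.

Lemma fps_mulDl f g p d :
  fps_mul_poly (fun i => f i + g i) p d = fps_mul_poly f p d + fps_mul_poly g p d.
Proof. by rewrite -big_split; apply: eq_bigr => i _; rewrite mulrDl. Qed.

Lemma fps_mulNl f p d : fps_mul_poly (fun i => - f i) p d = - fps_mul_poly f p d.
Proof. by rewrite -sumrN; apply: eq_bigr => i _; rewrite mulNr. Qed.

Lemma fps_mul_shift f p j d :
  fps_mul_poly (fun i => if (j <= i)%N then f (i - j)%N else 0) p d =
  if (j <= d)%N then fps_mul_poly f p (d - j) else 0.
Proof.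
rewrite (@fps_mul_trunc _ _ d.+1) //.
have -> : \poly_(i < d.+1) (if (j <= i)%N then f (i - j)%N else 0) =
    'X^j * \poly_(i < d.+1 - j) f i.
  apply/polyP => i; rewrite coefXnM !coef_poly.
  case: (ltnP i j) => [ltij|leji]; first by rewrite if_same.
  by have -> : (i - j < d.+1 - j)%N = (i < d.+1)%N by lia.
rewrite -mulrA coefXnM; case: (ltnP d j) => // lejd.
by rewrite (@fps_mul_trunc _ _ (d.+1 - j)) //; lia.
Qed.

Lemma fps_mul_constr f p c d :
  fps_mul_poly f (p * c%:P) d = fps_mul_poly f p d * c.
Proof. by rewrite !(@fps_mul_trunc _ _ d.+1) // mulrA coefMC. Qed.

Lemma fps_mul_binomial f c w d :
  fps_mul_poly f (1 - c *: 'X^w) d =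
  f d - (if (w <= d)%N then c * f (d - w)%N else 0).
Proof.
rewrite (@fps_mul_trunc _ _ d.+1) // mulrBr mulr1 coefB -scalerAr coefZ.
rewrite coefMXn !coef_poly ltnSn ltnS leq_subr ltnNge.
by case: leqP => //= _; rewrite mulr0.
Qed.

End PowerSeries.

Definition denom (es : seq nat) : {poly int} := \prod_(e <- es) (1 - 'X^e).

Definition rational_series (f : nat -> int) : Prop :=
  exists (es : seq nat) (P : {poly int}), all (leq 1) es /\
    forall d, fps_mul_poly f (denom es) d = P`_d.

Lemma denom_cat es es' : denom (es ++ es') = denom es * denom es'.
Proof. exact: big_cat. Qed.

Lemma rational_ext f g : f =1 g -> rational_series f -> rational_series g.
Proof.
move=> e [es [P [es0 h]]]; exists es, P; split=> // d.
by rewrite -h; apply: eq_fps_mul => i _; rewrite e.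
Qed.

Lemma rational_poly (P : {poly int}) : rational_series (fun d => P`_d).
Proof. by exists [::], P; split=> // d; rewrite /denom big_nil fps_mul1. Qed.

Lemma rational_add f g : rational_series f -> rational_series g ->
  rational_series (fun d => f d + g d).
Proof.
move=> [es [P [es0 hP]]] [es' [P' [es0' hP']]].
exists (es ++ es'), (P * denom es' + P' * denom es); split.
  by rewrite all_cat es0.
move=> d; rewrite denom_cat fps_mulDl coefD -!fps_mul_coefs; congr (_ + _).
  by rewrite -fps_mulA; apply: eq_fps_mul => i _; rewrite hP.
by rewrite mulrC -fps_mulA; apply: eq_fps_mul => i _; rewrite hP'.
Qed.

Lemma rational_opp f : rational_series f -> rational_series (fun d => - f d).
Proof.
move=> [es [P [es0 hP]]]; exists es, (- P); split=> // d.
by rewrite fps_mulNl hP coefN.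
Qed.

Lemma rational_sum (I : Type) (r : seq I) (F : I -> nat -> int) :
  (forall i, rational_series (F i)) -> rational_series (fun d => \sum_(i <- r) F i d).
Proof.
move=> h; elim: r => [|i r IH].
  by apply: (rational_ext _ (rational_poly 0)) => d; rewrite coef0 big_nil.
by apply: (rational_ext _ (rational_add (h i) IH)) => d; rewrite big_cons.
Qed.

Lemma rational_shift j f : rational_series f ->
  rational_series (fun d => if (j <= d)%N then f (d - j)%N else 0).
Proof.
move=> [es [P [es0 hP]]]; exists es, ('X^j * P); split=> // d.
by rewrite fps_mul_shift hP coefXnM ltnNge; case: leqP.
Qed.

Lemma rational_behead f : rational_series f -> rational_series (fun d => f d.+1).
Proof.
move=> [es [P [es0 hP]]].
(* [f] minus its constant term, times the denominator; it is divisible by [X]. *)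
pose Q := P - f 0%N *: denom es.
exists es, (\poly_(i < size Q) Q`_i.+1); split=> // d.
rewrite coef_poly; have -> : (if (d < size Q)%N then Q`_d.+1 else 0) = Q`_d.+1.
  by case: ltnP => // h; rewrite nth_default // leqW.
rewrite coefB coefZ -hP {2}/fps_mul_poly big_ord_recl /= subn0 addrAC subrr add0r.
by apply: eq_bigr => i _; rewrite /bump /= add1n subSS.
Qed.

(** Multiplication by [1 - X^w] turns a recursion with step [w] into its
    inhomogeneous term. *)
Lemma rational_rec w f g : (0 < w)%N -> rational_series g ->
  (forall d, f d = g d + if (w <= d)%N then f (d - w)%N else 0) ->
  rational_series f.
Proof.
move=> w0 [es [P [es0 hP]]] hf; exists (w :: es), P; split; first by rewrite /= w0.
move=> d; rewrite /denom big_cons -fps_mulA -hP; apply: eq_fps_mul => i _.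
rewrite -['X^w]scale1r fps_mul_binomial mul1r hf; ring.
Qed.

(** * Counting lattice points of a down-closed set *)

Definition weight_of (ws a : seq nat) : nat := sumn [seq p.1 * p.2 | p <- zip a ws]%N.

Lemma weight_of_cons w ws c a :
  weight_of (w :: ws) (c :: a) = (c * w + weight_of ws a)%N.
Proof. by []. Qed.

Fixpoint weighted (ws : seq nat) (d : nat) : seq (seq nat) :=
  if ws is w :: ws' then
    flatten [seq [seq c :: a | a <- weighted ws' (d - c * w)] |
             c <- iota 0 d.+1 & (c * w <= d)%N]
  else if d == 0%N then [:: [::]] else [::].

Lemma weighted_cons w ws d : weighted (w :: ws) d =
  flatten [seq [seq c :: a | a <- weighted ws (d - c * w)] |
           c <- [seq c <- iota 0 d.+1 | c * w <= d]]%N.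
Proof. by []. Qed.

Arguments weighted : simpl never.

Lemma mem_weighted ws d a : all (leq 1) ws ->
  (a \in weighted ws d) = (size a == size ws) && (weight_of ws a == d).
Proof.
elim: ws d a => [|w ws IH] d a.
  by move=> _; rewrite /weighted; case: a => [|c a]; rewrite /weight_of /=; case: d.
move=> /andP[w0 ws0]; rewrite weighted_cons; apply/flatten_mapP/idP.
  move=> [c]; rewrite mem_filter mem_iota => /andP[h1 h2] /mapP[b].
  rewrite IH // => /andP[/eqP h3 /eqP h4] ->; rewrite /= h3 eqxx /=.
  by rewrite /weight_of /= -/(weight_of ws b) h4 subnKC.
case: a => [|c a] // /andP[]; rewrite eqSS weight_of_cons => h1 /eqP h2; exists c.
  by rewrite mem_filter mem_iota add0n; nia.
by apply/mapP; exists a => //; rewrite IH // h1 -h2 addKn eqxx.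
Qed.

Lemma uniq_weighted ws d : uniq (weighted ws d).
Proof.
elim: ws d => [|w ws IH] d; first by rewrite /weighted; case: (d == 0%N).
rewrite weighted_cons.
set s := filter _ _; have : uniq s by apply: filter_uniq; rewrite iota_uniq.
elim: s => //= c s IHs /andP[cs us].
rewrite cat_uniq IHs // map_inj_uniq ?IH ?andbT /=; last by move=> a b [].
apply/hasPn => a /flatten_mapP[c' c's /mapP[b _ ->]].
by apply/mapP => -[b' _ [ec _]]; rewrite -ec c's in cs.
Qed.

Definition incr_head (a : seq nat) := if a is c :: a' then c.+1 :: a' else a.

(** A point either has first coordinate zero, or lies over the point with
    that coordinate lowered by one. *)
Lemma sum_weighted_cons (V : nmodType) w ws d (F : seq nat -> V) :
  (0 < w)%N -> all (leq 1) ws ->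
  \sum_(a <- weighted (w :: ws) d) F a =
  \sum_(a <- weighted ws d) F (0%N :: a) +
  (if (w <= d)%N then \sum_(a <- weighted (w :: ws) (d - w)) F (incr_head a) else 0).
Proof.
move=> w0 ws0; have wws0 : all (leq 1) (w :: ws) by rewrite /= w0.
pose s := if (w <= d)%N then weighted (w :: ws) (d - w) else [::].
rewrite (perm_big ([seq 0%N :: a | a <- weighted ws d] ++ [seq incr_head a | a <- s])).
  rewrite big_cat !big_map /s; congr (_ + _).
  by case: ifP => //; rewrite big_nil.
have sP a : a \in s -> exists c a', [/\ a = c :: a', size a' = size ws & (w + weight_of (w :: ws) a)%N = d].
  rewrite /s; case: leqP => // h; rewrite mem_weighted // => /andP[].
  by case: a => //= c a; rewrite eqSS => /eqP h1 /eqP h2; exists c, a; split=> //; lia.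
apply: uniq_perm; first exact: uniq_weighted.
  rewrite cat_uniq map_inj_uniq ?uniq_weighted; last by move=> ? ? [].
  rewrite map_inj_in_uniq /=.
    rewrite /s; case: ifP; rewrite ?uniq_weighted /= ?andbT => _ //.
    by apply/hasPn => a /mapP[b hb ->]; apply/mapP => -[b' _]; case: b hb => // ? ?.
  by move=> x y /sP[c [a [-> _ _]]] /sP[c' [a' [-> _ _]]] /= [-> ->].
move=> a. rewrite mem_weighted // mem_cat; apply/idP/orP.
  case: a => [|[|c] a] //= /andP[]; rewrite eqSS => /eqP h1; rewrite weight_of_cons.
    by rewrite mul0n add0n => h2; left; apply/mapP; exists a => //; rewrite mem_weighted // h1 eqxx.
  move=> /eqP h2; right; apply/mapP; exists (c :: a) => //.
  rewrite /s; have -> : (w <= d)%N by lia.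
  by rewrite mem_weighted //= h1 eqxx weight_of_cons; apply/eqP; lia.
move=> [/mapP[b] | /mapP[b]].
  rewrite mem_weighted // => /andP[/eqP h1 /eqP h2] ->.
  by rewrite /= h1 eqxx weight_of_cons h2 eqxx.
move=> /sP[c [a' [-> h2 h3]]] ->; rewrite /= h2 eqxx weight_of_cons.
by apply/eqP; rewrite -h3 weight_of_cons; lia.
Qed.

(** The position of a minimum of each tail is repeatedly taken as the next
    index. *)
Lemma nondecreasing_subsequence (u : nat -> nat) :
  exists phi : nat -> nat, (forall i j, (i < j)%N -> (phi i < phi j)%N) /\
    forall i j, (i <= j)%N -> (u (phi i) <= u (phi j))%N.
Proof.
have tail_min N : exists k, (N <= k)%N /\ forall j, (N <= j)%N -> (u k <= u j)%N.
  suff h b k : (u k <= b)%N -> (N <= k)%N ->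
      exists k, (N <= k)%N /\ forall j, (N <= j)%N -> (u k <= u j)%N.
    exact: (h (u N) N).
  elim: b k => [|b IH] k hk Nk.
    by exists k; split=> // j _; move: hk; rewrite leqn0 => /eqP ->.
  case: (classic (exists j, (N <= j)%N /\ (u j < u k)%N)) => [[j [Nj hj]]|h].
    by apply: (IH j) => //; lia.
  exists k; split=> // j Nj; rewrite leqNgt; apply/negP => hj; apply: h.
  by exists j.
have [next nextP] := functional_choice tail_min.
pose phi := fix phi i := if i is i'.+1 then next (phi i').+1 else next 0%N.
have phiS i : (phi i < phi i.+1)%N by have [] := nextP (phi i).+1.
have mono i j : (i < j)%N -> (phi i < phi j)%N.
  by apply: (homo_ltn (r := fun m n => m < n)%N) => // n m p; apply: ltn_trans.
exists phi; split=> // i j; rewrite leq_eqVlt => /orP[/eqP -> //|ltij].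
have le0 : (phi i <= phi j)%N by rewrite ltnW ?mono.
case: i ltij le0 => [|i] ltij le0 /=; first by have [_] := nextP 0%N; apply.
have [_] := nextP (phi i).+1; apply; apply: mono; lia.
Qed.

(** A subsequence along which the last coordinates increase is refined, by
    the one-dimensional case, to one along which the first coordinate does
    as well. *)
Lemma dickson r (u : nat -> seq nat) : (forall i, size (u i) = r) ->
  exists phi : nat -> nat, (forall i j, (i < j)%N -> (phi i < phi j)%N) /\
    forall i j, (i <= j)%N -> all2 leq (u (phi i)) (u (phi j)).
Proof.
elim: r u => [|r IH] u hu.
  by exists id; split=> // i j _; rewrite /= (size0nil (hu i)) (size0nil (hu j)).
have [phi [phiI phiM]] := IH (fun i => behead (u i)) (fun i => etrans (size_behead _) (congr1 predn (hu i))).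
have [psi [psiI psiM]] := nondecreasing_subsequence (fun i => head 0%N (u (phi i))).
exists (phi \o psi); split=> [i j ltij|i j leij] /=; first exact/phiI/psiI.
have h1 := psiM i j leij.
have h2 : all2 leq (behead (u (phi (psi i)))) (behead (u (phi (psi j)))).
  apply: phiM; move: leij; rewrite leq_eqVlt => /orP[/eqP -> //|/psiI].
  exact: ltnW.
move: h1 h2 (hu (phi (psi i))) (hu (phi (psi j))) => /=.
by case: (u _) => // c a; case: (u _) => //= c' a' -> ->.
Qed.

Definition down_closed r (D : pred (seq nat)) : Prop :=
  forall a b, size b = r -> all2 leq a b -> D b -> D a.

Lemma all2_leq_refl a : all2 leq a a.
Proof. by elim: a => //= c a ->; rewrite leqnn. Qed.

(** By Dickson's lemma the slices of [D] at first coordinate [C], which decrease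
    with [C], are constant from some [C] on; each slice is handled by induction
    on the number of coordinates. *)
Lemma rational_down_closed ws (D : pred (seq nat)) :
  all (leq 1) ws -> down_closed (size ws) D ->
  rational_series (fun d => \sum_(a <- weighted ws d) (D a)%:R).
Proof.
elim: ws D => [|w ws IH] D.
  move=> _ _; apply: (rational_ext _ (rational_poly (D [::])%:R%:P)) => d.
  by rewrite coefC /=; case: d => [|d] /=; rewrite ?big_seq1 ?big_nil.
move=> ws0; have /andP[w0 ws0'] := ws0; move=> Ddown.
pose lift C a := iter C incr_head a.
have liftE C c a : lift C (c :: a) = (C + c)%N :: a.
  by elim: C => //= C ->.
(* Points leaving the slices infinitely often would contradict Dickson's
   lemma. *)
have stab : exists C, forall a, size a = (size ws).+1 ->
    D (lift C a) = D (lift C.+1 a).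
  apply: NNPP => h.
  have {}h C : exists a, [/\ size a = (size ws).+1, D (lift C a) & ~~ D (lift C.+1 a)].
    apply: NNPP => h'; apply: h; exists C => a ha.
    case e : (D (lift C a)); case e' : (D (lift C.+1 a)) => //.
      by case: h'; exists a; split=> //; rewrite e'.
    case: a ha e e' => // c a [ha]; rewrite !liftE => e e'.
    rewrite -e; apply: (Ddown _ _ _ _ e'); rewrite /= ?ha //.
    by rewrite all2_leq_refl andbT; lia.
  have [u uP] := functional_choice h.
  have usz i : size (u i) = (size ws).+1 by have [] := uP i.
  have [phi [phiI phiM]] := dickson usz.
  have [_ _ /negP] := uP (phi 0%N); apply.
  have [_ D1 _] := uP (phi 1%N).
  have := phiM 0%N 1%N isT; have := phiI 0%N 1%N isT.
  move: (usz (phi 0%N)) (usz (phi 1%N)) D1.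
  case: (u _) => // c a [sa]; case: (u _) => // c' a' [sa']; rewrite !liftE.
  move=> D1 lt01 /= /andP[le1 le2]; apply: (Ddown _ _ _ _ D1); rewrite /= ?sa' //.
  by rewrite le2 andbT; lia.
case: stab => C; elim: C D Ddown => [|C IHC] D Ddown stab.
  apply: (@rational_rec w _ (fun d => \sum_(a <- weighted ws d) (D (0%N :: a))%:R)) => //.
    apply: (IH (fun a => D (0%N :: a))) => // a b sb le_ab.
    by apply: Ddown => //=; rewrite sb.
  move=> d; rewrite sum_weighted_cons //; congr (_ + _); case: ifP => // _.
  rewrite !big_seq; apply: eq_bigr => a; rewrite mem_weighted // => /andP[/eqP sa _].
  by rewrite -stab.
apply: (rational_ext _ (rational_add
  (f := fun d => \sum_(a <- weighted ws d) (D (0%N :: a))%:R)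
  _ (rational_shift w (f := fun d =>
      \sum_(a <- weighted (w :: ws) d) (D (incr_head a))%:R) _))) => [d||].
- by rewrite [RHS]sum_weighted_cons.
- apply: (IH (fun a => D (0%N :: a))) => // a b sb le_ab.
  by apply: Ddown => //=; rewrite sb.
apply: (IHC (fun a => D (incr_head a))) => [[|c a] [|c' a'] //= sb /andP[le1 le2]|a sa].
  by apply: Ddown => //=; rewrite ltnS le1.
exact: stab.
Qed.

(** * Dimensions, traces and fixed vectors *)

Section Dimension.
Variables (K : fieldType) (V : lmodType K).
Implicit Types (U S : V -> Prop).

Lemma linear_comb (V' : lmodType K) (f : V -> V') (I : Type) (r : seq I)
    (c : I -> K) (e : I -> V) : linear f ->
  f (\sum_(i <- r) c i *: e i) = \sum_(i <- r) c i *: f (e i).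
Proof.
move=> lf; have f0 : f 0 = 0.
  by have := lf (-1) 0 0; rewrite scaler0 addr0 scaleN1r addNr.
by elim: r => [|i r IH]; rewrite ?big_nil // !big_cons lf IH.
Qed.

Lemma subspace_comb U (I : Type) (r : seq I) (c : I -> K) (e : I -> V) :
  is_subspace U -> (forall i, U (e i)) -> U (\sum_(i <- r) c i *: e i).
Proof.
move=> [U0 UP] Ue; elim: r => [|i r IH]; rewrite ?big_nil // big_cons.
exact: UP.
Qed.

Lemma free_size m k (e : 'I_m -> V) (f : 'I_k -> V) :
  free_family e -> (forall i, in_span f (e i)) -> (m <= k)%N.
Proof.
move=> fe /functional_choice[c ce].
pose C := \matrix_(i, j) c i j.
suff /eqP <- : row_free C by apply: rank_leq_col.
apply: inj_row_free => v vC; apply/rowP => i; rewrite mxE.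
apply: (fe (v 0)) => //.
transitivity (\sum_j (v *m C) 0 j *: f j).
  under eq_bigr => k0 _ do rewrite ce scaler_sumr.
  rewrite exchange_big; apply: eq_bigr => j _ /=; rewrite mxE scaler_suml.
  by apply: eq_bigr => k0 _; rewrite mxE scalerA.
by rewrite vC big1 // => j _; rewrite mxE scale0r.
Qed.

Lemma in_span_self m (e : 'I_m -> V) i : in_span e (e i).
Proof.
exists (fun j => (j == i)%:R); rewrite (bigD1 i) //= eqxx scale1r big1 ?addr0 //.
by move=> j /negPf ->; rewrite scale0r.
Qed.

Lemma is_basis_mem U m (e : 'I_m -> V) i : is_basis U e -> U (e i).
Proof. by move=> [_ sp]; apply/sp/in_span_self. Qed.

Lemma has_dim_unique U m k : has_dim U m -> has_dim U k -> m = k.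
Proof.
move=> [e be] [f bf]; apply/eqP; rewrite eqn_leq; apply/andP; split.
  by apply: (free_size be.1) => i; apply/bf.2/(is_basis_mem i be).
by apply: (free_size bf.1) => i; apply/be.2/(is_basis_mem i bf).
Qed.

Lemma free_coord m (e : 'I_m -> V) (c c' : 'I_m -> K) : free_family e ->
  \sum_i c i *: e i = \sum_i c' i *: e i -> forall i, c i = c' i.
Proof.
move=> fe ecc i; apply/eqP; rewrite -subr_eq0; apply/eqP.
apply: (fe (fun i => c i - c' i)).
by under eq_bigr do rewrite scalerBl; rewrite sumrB ecc subrr.
Qed.

Lemma comb_comp p q r (E : 'I_p -> V) (M : 'M[K]_(p, q)) (N : 'M[K]_(q, r)) j :
  \sum_i N i j *: (\sum_i' M i' i *: E i') = \sum_i (M *m N) i j *: E i.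
Proof.
under eq_bigr do rewrite scaler_sumr.
rewrite exchange_big; apply: eq_bigr => i _ /=; rewrite mxE scaler_suml.
by apply: eq_bigr => i' _; rewrite scalerA mulrC.
Qed.

Lemma free_mx_inj m k (e : 'I_m -> V) (C D : 'M[K]_(m, k)) : free_family e ->
  (forall j, \sum_i C i j *: e i = \sum_i D i j *: e i) -> C = D.
Proof. by move=> fe h; apply/matrixP => i j; exact: (free_coord fe (h j)). Qed.

Lemma comb1 m (e : 'I_m -> V) j : \sum_i (1%:M : 'M[K]_m) i j *: e i = e j.
Proof.
rewrite (bigD1 j) //= mxE eqxx scale1r big1 ?addr0 // => i' /negPf.
by rewrite mxE => ->; rewrite scale0r.
Qed.

Lemma change_of_basis U m k (e : 'I_m -> V) (e' : 'I_k -> V) :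
  is_basis U e -> is_basis U e' ->
  exists C : 'M[K]_(m, k), forall j, e' j = \sum_i C i j *: e i.
Proof.
move=> be be'.
have /functional_choice[c cP] j : in_span e (e' j) by apply/be.2/(is_basis_mem j be').
by exists (\matrix_(i, j) c j i) => j; rewrite cP; apply: eq_bigr => i _; rewrite mxE.
Qed.

(** Since [has_trace] leaves the choice of the basis open, a character may
    be given in bases that vary with the group element; conjugation by the
    change of basis shows that this does not matter. *)
Lemma has_trace_unique U (f : V -> V) m (e : 'I_m -> V) A x : linear f ->
  is_basis U e -> is_matrix_of f e A -> has_trace U f x -> x = \tr A.
Proof.
move=> lf be fA [k [e' [A' [be' fA' ->]]]].
have [C CP] := change_of_basis be be'.
have [D DP] := change_of_basis be' be.
have DC : D *m C = 1%:M.
  apply: (free_mx_inj be'.1) => j; rewrite -comb_comp comb1.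
  by under eq_bigr do rewrite -DP; rewrite -CP.
have AC : A *m C = C *m A'.
  apply: (free_mx_inj be.1) => j; rewrite -!comb_comp.
  under eq_bigr do rewrite -fA; under [RHS]eq_bigr do rewrite -CP.
  by rewrite -fA' CP linear_comb.
have CD : C *m D = 1%:M.
  apply: (free_mx_inj be.1) => j; rewrite -comb_comp comb1.
  by under eq_bigr do rewrite -CP; rewrite -DP.
by rewrite -[A]mulmx1 -CD mulmxA AC -mulmxA mxtrace_mulC -mulmxA DC mulmx1.
Qed.

Lemma extend_free m (e : 'I_m -> V) v : free_family e -> ~ in_span e v ->
  free_family (fun i : 'I_m.+1 => if unlift ord0 i is Some j then e j else v).
Proof.
move=> fe nv c; rewrite big_ord_recl unlift_none.
under eq_bigr do rewrite liftK.
move=> h; have c0 : c ord0 = 0.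
  apply/eqP/negP => c0; apply: nv; exists (fun i => - (c ord0)^-1 * c (lift ord0 i)).
  under eq_bigr do rewrite -scalerA.
  rewrite -scaler_sumr; move/eqP: h; rewrite addrC addr_eq0 => /eqP ->.
  by rewrite scaleNr scalerN opprK scalerA mulVf ?scale1r //; apply/negP.
move: h; rewrite c0 scale0r add0r => /fe h i.
by case: (unliftP ord0 i) => [j|] ->.
Qed.

(** A free family that does not span can be enlarged, and free families in
    the ambient space have bounded size. *)
Lemma finite_dim_sub U S : finite_dim U -> is_subspace S ->
  (forall v, S v -> U v) -> finite_dim S.
Proof.
move=> [m [f bf]] subS SU.
suff h j k (e : 'I_k -> V) : (k + j)%N = m -> free_family e ->
    (forall i, S (e i)) -> finite_dim S.
  by apply: (h m 0%N (fun _ => 0)) => [||[]] // c _ [].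
elim: j k e => [|j IH] k e ekm fe Se; case: (classic (forall v, S v -> in_span e v)) => sp.
- exists k, e; split=> // v; split=> [/sp //|[c ->]]; exact: subspace_comb.
- have [v hv] := not_all_ex_not _ _ sp; have [Sv nv] := imply_to_and _ _ hv.
  have : (k.+1 <= m)%N; last by rewrite -ekm addn0 ltnn.
  apply: (free_size (extend_free fe nv)) => i; apply/bf.2/SU.
  by case: unlift.
- exists k, e; split=> // v; split=> [/sp //|[c ->]]; exact: subspace_comb.
have [v hv] := not_all_ex_not _ _ sp; have [Sv nv] := imply_to_and _ _ hv.
apply: (IH _ _ _ (extend_free fe nv)); first by rewrite addSnnS.
by move=> i; case: unlift.
Qed.

End Dimension.

(** A dimension is read off on either side of an isomorphism of subspaces; only
    its inverse has to be given on the whole space. *)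
Lemma has_dim_inj (K : fieldType) (V V' : lmodType K) (U : V -> Prop)
    (U' : V' -> Prop) (psi : V' -> V) h :
  linear psi -> injective psi -> (forall v, U' v <-> U (psi v)) ->
  (forall u, U u -> exists v, u = psi v) -> has_dim U h -> has_dim U' h.
Proof.
move=> lpsi ipsi UU' im [b bb].
have /functional_choice[b' b'P] i : exists v, b i = psi v by apply/im/(is_basis_mem i bb).
have comb c : psi (\sum_i c i *: b' i) = \sum_i c i *: b i.
  by rewrite linear_comb //; apply: eq_bigr => i _; rewrite b'P.
have psi0 : psi 0 = 0.
  by have := linear_comb [::] (fun=> 0) (fun _ : 'I_0 => 0) lpsi; rewrite !big_nil.
exists b'; split=> [c c0|v].
  by apply: bb.1; rewrite -comb c0.
rewrite UU' bb.2; split=> -[c cP]; exists c; last by rewrite cP comb.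
by apply: ipsi; rewrite comb.
Qed.

Section FixedVectors.
Variables (K : fieldType) (n : nat) (G : 'M[K]_n -> Prop).

Definition mx_fixed m (rho : 'M[K]_n -> 'M[K]_m) (c : 'cV[K]_m) : Prop :=
  forall g, G g -> rho g *m c = c.

(** Coordinates in a basis turn the invariants in a subspace into the fixed
    vectors of a matrix representation, where block sums and base changes
    are available. *)
Lemma mx_fixed_of_basis (V : lmodType K) (act : 'M[K]_n -> V -> V)
    (U : V -> Prop) m (e : 'I_m -> V) (rho : 'M[K]_n -> 'M[K]_m) h :
  (forall g, G g -> linear (act g)) -> is_basis U e ->
  (forall g, G g -> is_matrix_of (act g) e (rho g)) ->
  has_dim (fun v => U v /\ fixed G act v) h -> has_dim (mx_fixed rho) h.
Proof.
move=> lact be mact.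
pose psi (c : 'cV[K]_m) := \sum_i c i 0 *: e i.
have ipsi : injective psi.
  by move=> c c' /(free_coord be.1) h'; apply/colP.
apply: (@has_dim_inj _ _ _ _ _ psi) => //.
- move=> a u v; rewrite /psi scaler_sumr -big_split; apply: eq_bigr => i _ /=.
  by rewrite !mxE scalerDl scalerA.
- move=> c; have actE g : G g -> act g (psi c) = psi (rho g *m c).
    move=> Gg; rewrite /psi linear_comb; last exact: lact.
    by under eq_bigr do rewrite mact //; rewrite comb_comp.
  split=> [fc|[_ fc]].
    split; first by apply/be.2; exists (fun i => c i 0).
    by move=> g Gg; rewrite actE // fc.
  by move=> g Gg; apply: ipsi; rewrite -actE // fc.
move=> u [/be.2[c ->] _]; exists (\col_i c i).
by apply: eq_bigr => i _; rewrite mxE.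
Qed.

Lemma mx_fixed_iso m k (rho : 'M[K]_n -> 'M[K]_m) (sigma : 'M[K]_n -> 'M[K]_k)
    (P : 'M[K]_(m, k)) (Q : 'M[K]_(k, m)) h :
  P *m Q = 1%:M -> Q *m P = 1%:M -> (forall g, G g -> rho g *m P = P *m sigma g) ->
  has_dim (mx_fixed rho) h -> has_dim (mx_fixed sigma) h.
Proof.
move=> PQ QP rP; apply: (@has_dim_inj _ _ _ _ _ (mulmx P)).
- by move=> a u v; rewrite mulmxDr -scalemxAr.
- by move=> u v /(congr1 (mulmx Q)); rewrite !mulmxA QP !mul1mx.
- move=> c; split=> fc g Gg; first by rewrite mulmxA rP // -mulmxA fc.
  by rewrite -[LHS]mul1mx -QP -mulmxA [P *m _]mulmxA -rP // -mulmxA fc // mulmxA QP mul1mx.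
by move=> u _; exists (Q *m u); rewrite mulmxA PQ mul1mx.
Qed.

Lemma mx_fixed_block m k (rho : 'M[K]_n -> 'M[K]_m) (sigma : 'M[K]_n -> 'M[K]_k) h h' :
  has_dim (mx_fixed rho) h -> has_dim (mx_fixed sigma) h' ->
  has_dim (mx_fixed (fun g => block_mx (rho g) 0 0 (sigma g))) (h + h').
Proof.
move=> [b bb] [b' bb'].
pose e i := match split i with inl j => col_mx (b j) 0 | inr j => col_mx 0 (b' j) end.
have comb c : \sum_i c i *: e i =
    col_mx (\sum_i c (lshift _ i) *: b i) (\sum_i c (rshift _ i) *: b' i).
  rewrite big_split_ord /=.
  under eq_bigr do rewrite /e (unsplitK (inl _)) scale_col_mx scaler0.
  under [X in _ + X]eq_bigr do rewrite /e (unsplitK (inr _)) scale_col_mx scaler0.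
  have sumcol p q r (F : 'I_r -> 'cV[K]_p) (F' : 'I_r -> 'cV[K]_q) :
      \sum_i col_mx (F i) (F' i) = col_mx (\sum_i F i) (\sum_i F' i).
    elim: (index_enum _) => [|i s IH]; first by rewrite !big_nil col_mx0.
    by rewrite !big_cons IH add_col_mx.
  by rewrite !sumcol !big1_eq add_col_mx add0r addr0.
exists e; split=> [c|v].
  rewrite comb -col_mx0 => /eq_col_mx[/bb.1 h1 /bb'.1 h2] i.
  by rewrite -(splitK i); case: split => j /=.
rewrite -[v]vsubmxK; split=> [fv|[c cP] g Gg].
  have [fu fd] : mx_fixed rho (usubmx v) /\ mx_fixed sigma (dsubmx v).
    split=> g Gg; have := fv g Gg; rewrite mul_block_col !mul0mx addr0 add0r.
      by case/eq_col_mx.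
    by case/eq_col_mx.
  have [c cP] := (bb.2 _).1 fu; have [c' cP'] := (bb'.2 _).1 fd.
  exists (fun i => match split i with inl j => c j | inr j => c' j end).
  rewrite comb cP cP'; congr col_mx; apply: eq_bigr => i _.
    by rewrite (unsplitK (inl _)).
  by rewrite (unsplitK (inr _)).
rewrite cP comb mul_block_col !mul0mx addr0 add0r; congr col_mx.
  by apply: (bb.2 _).2 => //; exists (fun i => c (lshift _ i)).
by apply: (bb'.2 _).2 => //; exists (fun i => c (rshift _ i)).
Qed.

End FixedVectors.

(** * Polynomials and linear substitutions *)

Section MPolyInduction.
Variables (R : comNzRingType) (n : nat).

Lemma mpoly_ind_mulX (P : {mpoly R[n]} -> Prop) :
  (forall c, P c%:MP) -> (forall p q, P p -> P q -> P (p + q)) ->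
  (forall i p, P p -> P ('X_i * p)) -> forall p, P p.
Proof.
move=> PC PD PX; suff PM c m : P (c *: 'X_[m]).
  elim/mpolyind => [|c m p _ _ Pp]; first by rewrite -mpolyC0.
  exact: PD.
move: {2}(mdeg m) (erefl (mdeg m)) => d; elim: d m => [|d IH] m.
  by move=> /eqP; rewrite mdeg_eq0 => /eqP ->; rewrite mpolyX0 alg_mpolyC.
move=> dm; have [i mi] : exists i, m i != 0%N.
  apply/existsP; rewrite -negb_forall; apply/negP => /forallP m0.
  by move: dm; rewrite mdegE big1 // => i _; apply/eqP/m0.
have em : m = (U_(i) + (m - U_(i)))%MM by rewrite addmC submK // lep1mP.
have -> : c *: 'X_[m] = 'X_i * (c *: 'X_[(m - U_(i))]) :> {mpoly R[n]}.
  by rewrite -scalerAr -mpolyXD -em.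
by apply/PX/IH; move: dm; rewrite {1}em mdegD mdeg1 => -[].
Qed.

Lemma mpoly_ind_alg (P : {mpoly R[n]} -> Prop) :
  (forall c, P c%:MP) -> (forall p q, P p -> P q -> P (p + q)) ->
  (forall p q, P p -> P q -> P (p * q)) -> (forall i, P 'X_i) -> forall p, P p.
Proof.
by move=> PC PD PM PX; apply: mpoly_ind_mulX => // i p; apply: PM.
Qed.

End MPolyInduction.

Section InfiniteField.
Variables (K : fieldType) (charK : [pchar K] =i pred0).

Lemma natr_eq0_char0 k : ((k%:R : K) == 0) = (k == 0)%N.
Proof. by have /pcharf0P -> := charK. Qed.

Lemma natr_inj_char0 (i j : nat) : (i%:R : K) = j%:R -> i = j.
Proof.
wlog ij : i j / (i <= j)%N => [hw|].
  by case: (leqP i j) => [/hw//|/ltnW /hw h e]; apply/esym/h/esym.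
move=> e; apply/eqP; rewrite eqn_leq ij /= -subn_eq0 -natr_eq0_char0.
by rewrite natrB // e subrr.
Qed.

Lemma poly_eq0_horner (q : {poly K}) : (forall x, q.[x] = 0) -> q = 0.
Proof.
move=> q0; apply: (@roots_geq_poly_eq0 _ _ [seq i%:R | i <- iota 0 (size q)]).
- by apply/allP => x _; apply/eqP.
- by rewrite map_inj_uniq ?iota_uniq // => i j; apply: natr_inj_char0.
by rewrite size_map size_iota.
Qed.

(** Induction on the number of variables: for fixed values of the others, a
    polynomial in the last variable that vanishes everywhere has zero
    coefficients, the field being infinite. *)
Lemma meval_eq0 n (p : {mpoly K[n]}) : (forall v, p.@[v] = 0) -> p = 0.
Proof.
elim: n p => [|n IH] p p0.
  have := p0 (fun _ => 0); rewrite (nvar0_mpolyC p) mevalC => ->.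
  by rewrite mpolyC0.
have evalE v : p.@[v] = (map_poly (meval (fun i => v (widen_ord (leqnSn n) i))) (muni p)).[v ord_max].
  rewrite muniE mevalE rmorph_sum horner_sum; apply: eq_bigr => m _ /=.
  rewrite map_polyZ hornerZ /= map_polyXn hornerXn mevalZ mevalX big_ord_recr /= mulrA.
  by congr (_ * _ * _); apply: eq_bigr => i _; rewrite mnmE.
have {}p0 : muni p = 0.
  apply/polyP => k; rewrite coef0; apply: IH => v.
  set q := map_poly (meval v) (muni p).
  suff q0 : q = 0 by rewrite -[LHS](coef_map (meval v)) -/q q0 coef0.
  apply: poly_eq0_horner => x.
  pose w (i : 'I_n.+1) := if unlift ord_max i is Some j then v j else x.
  rewrite -[RHS](p0 w) evalE /w unlift_none; congr (_.[_]).
  apply: eq_map_poly => r; apply: meval_eq => i.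
  have -> : widen_ord (leqnSn n) i = lift ord_max i by apply: val_inj; rewrite [RHS]lift_max.
  by rewrite liftK.
apply/mpolyP => m; rewrite mcoeff0.
have := congr1 (fun q : {poly {mpoly K[n]}} => (q`_(m ord_max))@_[multinom m (widen_ord (leqnSn n) i) | i < n]) p0.
rewrite /= coef0 mcoeff0 => <-.
rewrite muniE coef_sum raddf_sum /=.
under eq_bigr do rewrite coefZ coefXn mulr_natr mcoeffMn mcoeffZ mcoeffX.
case: (boolP (m \in msupp p)) => mp.
  rewrite (bigD1_seq m) ?msupp_uniq //= !eqxx mulr1 mulr1n big1 ?addr0 // => m' m'm.
  case: eqP => [e|]; last by rewrite mulr0 mul0rn.
  case: eqP => [e'|]; last by rewrite mulr0n.
  case/eqP: m'm; apply/mnmP => i; case: (unliftP ord_max i) => [j|] -> //.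
  have -> : lift ord_max j = widen_ord (leqnSn n) j by apply: val_inj; rewrite [LHS]lift_max.
  by move/mnmP: e => /(_ j); rewrite !mnmE.
rewrite memN_msupp_eq0 // big_seq big1 // => m' m'p.
case: eqP => [e|]; last by rewrite mulr0 mul0rn.
case: eqP => [e'|]; last by rewrite mulr0n.
case/negP: mp; suff -> : m = m' by [].
apply/mnmP => i; case: (unliftP ord_max i) => [j|] -> //.
have -> : lift ord_max j = widen_ord (leqnSn n) j by apply: val_inj; rewrite [LHS]lift_max.
by move/mnmP: e => /(_ j); rewrite !mnmE.
Qed.

Lemma meval_inj n (p q : {mpoly K[n]}) : (forall v, p.@[v] = q.@[v]) -> p = q.
Proof.
by move=> h; apply/eqP; rewrite -subr_eq0; apply/eqP/meval_eq0 => v; rewrite mevalB h subrr.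
Qed.

End InfiniteField.

Section SymAct.
Variables (K : fieldType) (m : nat).
Implicit Types (A B : 'M[K]_m) (f g : {mpoly K[m]}).

Lemma sym_actC A c : sym_act A c%:MP = c%:MP.
Proof. exact: comp_mpolyC. Qed.

Lemma sym_actD A : {morph sym_act A : f g / f + g}.
Proof. by move=> f g; exact: comp_mpolyD. Qed.

Lemma sym_actZ A c f : sym_act A (c *: f) = c *: sym_act A f.
Proof. exact: comp_mpolyZ. Qed.

Lemma sym_actM A : {morph sym_act A : f g / f * g}.
Proof. by move=> f g; exact: rmorphM. Qed.

Lemma sym_act_sum A (I : Type) (r : seq I) (P : pred I) (F : I -> {mpoly K[m]}) :
  sym_act A (\sum_(i <- r | P i) F i) = \sum_(i <- r | P i) sym_act A (F i).
Proof. exact: raddf_sum. Qed.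

Lemma sym_act_prod A (I : Type) (r : seq I) (P : pred I) (F : I -> {mpoly K[m]}) :
  sym_act A (\prod_(i <- r | P i) F i) = \prod_(i <- r | P i) sym_act A (F i).
Proof. exact: rmorph_prod. Qed.

Lemma sym_act_exp A f k : sym_act A (f ^+ k) = sym_act A f ^+ k.
Proof. exact: rmorphXn. Qed.

Lemma sym_actX A j : sym_act A 'X_j = \sum_i A i j *: 'X_i.
Proof. by rewrite /sym_act comp_mpolyXU -tnth_nth tnth_mktuple. Qed.

Lemma sym_act_linear A : linear (sym_act A).
Proof. by move=> c f g; rewrite sym_actD sym_actZ. Qed.

Lemma sym_act1 f : sym_act 1%:M f = f.
Proof.
elim/mpoly_ind_alg: f => [c|p q hp hq|p q hp hq|i].
- exact: sym_actC.
- by rewrite sym_actD hp hq.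
- by rewrite sym_actM hp hq.
rewrite sym_actX (bigD1 i) //= mxE eqxx scale1r big1 ?addr0 // => j /negPf.
by rewrite mxE => ->; rewrite scale0r.
Qed.

Lemma sym_act_mulmx A B f : sym_act (A *m B) f = sym_act A (sym_act B f).
Proof.
elim/mpoly_ind_alg: f => [c|p q hp hq|p q hp hq|j].
- by rewrite !sym_actC.
- by rewrite !sym_actD hp hq.
- by rewrite !sym_actM hp hq.
rewrite !sym_actX sym_act_sum; under [RHS]eq_bigr do rewrite sym_actZ sym_actX scaler_sumr.
rewrite exchange_big; apply: eq_bigr => i _ /=; rewrite mxE scaler_suml.
by apply: eq_bigr => k _; rewrite scalerA mulrC.
Qed.

Lemma meval_sym_act A f v : (sym_act A f).@[v] = f.@[fun j => \sum_i A i j * v i].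
Proof.
rewrite /sym_act comp_mpoly_meval; apply: meval_eq => j; rewrite tnth_mktuple.
by rewrite raddf_sum /=; apply: eq_bigr => i _; rewrite mevalZ mevalXU.
Qed.

Lemma sym_act_mcoeff0 A f : (sym_act A f)@_0 = f@_0.
Proof.
have eval0 (p : {mpoly K[m]}) : p.@[fun=> 0] = p@_0.
  elim/mpoly_ind_mulX: p => [c|p q hp hq|i p _].
  - by rewrite mevalC mcoeffC eqxx mulr1.
  - by rewrite mevalD mcoeffD hp hq.
  by rewrite mevalM mevalXU mul0r -[_@_0]/(mcoeff 0%MM _) rmorphM /= mcoeffX mnm1_eq0 mul0r.
rewrite -!eval0 meval_sym_act; apply: meval_eq => j.
by rewrite big1 // => i _; rewrite mulr0.
Qed.

Lemma mderiv_sym_act A f i :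
  (sym_act A f)^`M(i) = \sum_j A i j *: sym_act A f^`M(j).
Proof.
elim/mpoly_ind_alg: f => [c|p q hp hq|p q hp hq|k].
- by rewrite sym_actC mderivC big1 // => j _; rewrite mderivC sym_actC mpolyC0 scaler0.
- rewrite sym_actD mderivD hp hq -big_split; apply: eq_bigr => j _.
  by rewrite mderivD sym_actD scalerDr.
- rewrite sym_actM mderivM hp hq mulr_suml mulr_sumr -big_split; apply: eq_bigr => j _ /=.
  by rewrite mderivM sym_actD !sym_actM scalerDr scalerAl scalerAr.
rewrite sym_actX raddf_sum /=.
have dX a b : ('X_a : {mpoly K[m]})^`M(b) = ((a == b)%:R)%:MP.
  rewrite mderivX mnm1E; case: eqP => [->|_]; last by rewrite scale0r mpolyC0.
  by rewrite scale1r -{1}[U_(b)%MM]add0m addmK mpolyX0.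
under eq_bigr do rewrite mderivZ dX; under [RHS]eq_bigr do rewrite dX sym_actC.
rewrite (bigD1 i) //= eqxx big1 ?addr0 => [|j /negPf ->]; last by rewrite mpolyC0 scaler0.
rewrite [RHS](bigD1 k) //= eqxx big1 ?addr0 // => j /negPf.
by rewrite eq_sym => ->; rewrite mpolyC0 scaler0.
Qed.

End SymAct.

(** * The apolar pairing and the Reynolds functional *)

Section LinearExtension.
Variables (R : comNzRingType) (n : nat) (phi : 'X_{1..n} -> R).

(** The linear form with prescribed values on monomials. *)
Definition lin_ext (p : {mpoly R[n]}) : R := \sum_(m <- msupp p) p@_m * phi m.

Lemma lin_extE s p : uniq s -> {subset msupp p <= s} ->
  lin_ext p = \sum_(m <- s) p@_m * phi m.
Proof.
move=> us ps; rewrite [RHS](bigID (mem (msupp p))) /= [X in _ + X]big1; last first.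
  by move=> m mp; rewrite memN_msupp_eq0 ?mul0r.
rewrite addr0 -big_filter; apply: perm_big; apply: uniq_perm => [||m].
- exact: msupp_uniq.
- exact: filter_uniq.
by rewrite mem_filter andb_idr // => /ps.
Qed.

Lemma lin_ext_linear : forall a p q, lin_ext (a *: p + q) = a * lin_ext p + lin_ext q.
Proof.
move=> a p q; pose s := undup (msupp p ++ msupp q ++ msupp (a *: p + q)).
have sub r : {subset msupp r <= msupp p ++ msupp q ++ msupp (a *: p + q)} ->
    lin_ext r = \sum_(m <- s) r@_m * phi m.
  by move=> h; apply: lin_extE; rewrite ?undup_uniq // => m /h; rewrite mem_undup.
rewrite !sub => [|m|m|m]; try by rewrite !mem_cat => ->; rewrite ?orbT.
rewrite mulr_sumr -big_split; apply: eq_bigr => m _ /=.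
by rewrite mcoeffD mcoeffZ mulrDl mulrA.
Qed.

End LinearExtension.

Section Apolar.
Variables (K : fieldType) (n : nat).
Implicit Types p q : {mpoly K[n]}.

(** The constant term of [p(d/dx) q]. *)
Definition apolar p q : K := lin_ext (fun m => (q^`M[m])@_0) p.

Lemma apolar_linl a p p' q : apolar (a *: p + p') q = a * apolar p q + apolar p' q.
Proof. exact: lin_ext_linear. Qed.

Lemma apolarDl p p' q : apolar (p + p') q = apolar p q + apolar p' q.
Proof. by have := apolar_linl 1 p p' q; rewrite scale1r mul1r. Qed.

Lemma apolar0l q : apolar 0 q = 0.
Proof. by rewrite /apolar /lin_ext msupp0 big_nil. Qed.

Lemma apolarZl a p q : apolar (a *: p) q = a * apolar p q.
Proof. by have := apolar_linl a p 0 q; rewrite !addr0 apolar0l addr0. Qed.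

Lemma apolar_linr a p q q' : apolar p (a *: q + q') = a * apolar p q + apolar p q'.
Proof.
rewrite /apolar /lin_ext mulr_sumr -big_split; apply: eq_bigr => m _ /=.
by rewrite mderivmD mderivmZ mcoeffD mcoeffZ mulrDr; ring.
Qed.

Lemma apolar0r p : apolar p 0 = 0.
Proof.
by rewrite /apolar /lin_ext big1 // => m _; rewrite raddf0 mcoeff0 mulr0.
Qed.

Lemma apolar_sumr (I : Type) (r : seq I) (F : I -> {mpoly K[n]}) (c : I -> K) p :
  apolar p (\sum_(i <- r) c i *: F i) = \sum_(i <- r) c i * apolar p (F i).
Proof.
elim: r => [|i r IH]; rewrite ?big_nil ?apolar0r // !big_cons.
by rewrite apolar_linr IH.
Qed.

Lemma apolar_suml (I : Type) (r : seq I) (F : I -> {mpoly K[n]}) (c : I -> K) q :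
  apolar (\sum_(i <- r) c i *: F i) q = \sum_(i <- r) c i * apolar (F i) q.
Proof.
elim: r => [|i r IH]; rewrite ?big_nil ?apolar0l // !big_cons.
by rewrite apolar_linl IH.
Qed.

Lemma apolarC c q : apolar c%:MP q = c * q@_0.
Proof.
rewrite -alg_mpolyC apolarZl; congr (_ * _).
by rewrite /apolar /lin_ext -mpolyC1 msupp1 big_seq1 mcoeffC eqxx !mul1r mderivm0m.
Qed.

Lemma apolarX i p q : apolar ('X_i * p) q = apolar p q^`M(i).
Proof.
elim/mpolyind: p q => [|c m p _ _ IH] q; first by rewrite mulr0 !apolar0l.
rewrite mulrDr !apolarDl IH; congr (_ + _).
rewrite -scalerAr -mpolyXD !apolarZl; congr (_ * _).
by rewrite /apolar /lin_ext !msuppX !big_seq1 !mcoeffX !eqxx !mul1r mderivmDm mderivmU1m.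
Qed.

(** A linear substitution and its transpose are adjoint: multiplication by a
    variable is adjoint to the derivation, and the two sides of the chain rule
    carry the same matrix. *)
Lemma apolar_adjoint A p q : apolar (sym_act A^T p) q = apolar p (sym_act A q).
Proof.
elim/mpoly_ind_mulX: p q => [c|p p' hp hp'|i p hp] q.
- by rewrite sym_actC !apolarC sym_act_mcoeff0.
- by rewrite sym_actD !apolarDl hp hp'.
rewrite sym_actM sym_actX apolarX mderiv_sym_act apolar_sumr mulr_suml.
under eq_bigr do rewrite -scalerAl.
rewrite apolar_suml; apply: eq_bigr => j _.
by rewrite mxE apolarX hp.
Qed.

End Apolar.

(** For a polynomial with integer coefficients the pairing with itself is a
    sum of squares weighted by factorials; characteristic zero keeps this
    positive integer nonzero. *)
Lemma apolar_self_neq0 (K : fieldType) (charK : [pchar K] =i pred0) n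
    (p : {mpoly int[n]}) :
  p != 0 -> apolar (map_mpoly intr p : {mpoly K[n]}) (map_mpoly intr p) != 0.
Proof.
move=> p0; set q : {mpoly K[n]} := map_mpoly intr p.
pose S := (\sum_(m <- msupp p) absz p@_m ^ 2 * \prod_(i < n) (m i)`!)%N.
suff -> : apolar q q = S%:R.
  rewrite natr_eq0_char0 // /S.
  rewrite (bigD1_seq (mlead p)) ?msupp_uniq ?mlead_supp //=.
  rewrite -lt0n ltn_addr // muln_gt0 expn_gt0 absz_gt0 mleadc_eq0 p0 /=.
  by apply: prodn_gt0 => i; apply: fact_gt0.
rewrite /apolar (@lin_extE _ _ _ (msupp p)) ?msupp_uniq //; last first.
  move=> m; rewrite !mcoeff_msupp mcoeff_map_mpoly /=; apply: contra => /eqP ->.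
  by rewrite mulr0z /=.
rewrite natr_sum; apply: eq_bigr => m _.
rewrite mcoeff_mderivm !addm0 mcoeff_map_mpoly /=.
rewrite -[X in _ * X]mulr_natr mulrA natrM -rmorphM /=.
have -> : p@_m * p@_m = ((absz p@_m ^ 2)%N)%:Z by nia.
congr (_ * _%:R); apply: eq_bigr => i _.
by rewrite ffactnn.
Qed.

(** * Regular functions on the general linear group *)

Section Regular.
Variables (K : fieldType) (charK : [pchar K] =i pred0) (n : nat).
Implicit Types (f : 'M[K]_n -> K) (p q : {mpoly K[n * n]}) (g h : 'M[K]_n).

Definition det_mpoly (R : comNzRingType) : {mpoly R[n * n]} :=
  \det (\matrix_(i < n, j < n) 'X_(mxvec_index i j)).

Lemma meval_det_mpoly g : (det_mpoly K).@[mxvec g 0] = \det g.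
Proof.
rewrite -[LHS](det_map_mx (meval (mxvec g 0))); congr (\det _).
by apply/matrixP => i j; rewrite 2!mxE /= mevalXU mxvecE.
Qed.

Lemma det_mpoly_neq0 (R : comNzRingType) : det_mpoly R != 0.
Proof.
apply/eqP => d0; have := congr1 (meval (mxvec (1%:M : 'M[R]_n) 0)) d0.
rewrite meval0 -[LHS](det_map_mx (meval (mxvec (1%:M : 'M[R]_n) 0))).
have -> : map_mx (meval (mxvec (1%:M : 'M[R]_n) 0))
    (\matrix_(i < n, j < n) 'X_(mxvec_index i j)) = 1%:M.
  by apply/matrixP => i j; rewrite 2!mxE /= mevalXU mxvecE.
by rewrite det1; apply/eqP/oner_neq0.
Qed.

Lemma det_mpoly_intr : map_mpoly intr (det_mpoly int) = det_mpoly K.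
Proof.
rewrite /det_mpoly -det_map_mx; congr (\det _).
by apply/matrixP => i j; rewrite !mxE /= map_mpolyX.
Qed.

Lemma det_unit_neq0 g : g \in unitmx -> \det g != 0.
Proof. by rewrite unitmxE unitfE. Qed.

Definition regular_num k f p : Prop :=
  forall g, g \in unitmx -> f g = p.@[mxvec g 0] / \det g ^+ k.

(** Vanishing on the group is vanishing after multiplication by the
    determinant. *)
Lemma regular_num_unique k f p q : regular_num k f p -> regular_num k f q -> p = q.
Proof.
move=> fp fq; apply/eqP; rewrite -subr_eq0.
suff : (p - q) * det_mpoly K == 0.
  by rewrite mulf_eq0 (negPf (det_mpoly_neq0 K)) orbF.
apply/eqP/meval_eq0 => // v.
pose g := vec_mx (\row_i v i) : 'M[K]_n.
have gv : mxvec g 0 =1 v by move=> i; rewrite /g vec_mxK mxE.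
rewrite -(meval_eq _ gv) mevalM mevalB meval_det_mpoly.
case: (boolP (g \in unitmx)) => [ug|].
  have d0 : \det g ^+ k != 0 by rewrite expf_neq0 ?det_unit_neq0.
  have := fp g ug; rewrite fq // => /(mulIf (invr_neq0 d0)) ->.
  by rewrite subrr mul0r.
by rewrite unitmxE unitfE negbK => /eqP ->; rewrite mulr0.
Qed.

Lemma regular_numS k j f p : regular_num k f p ->
  regular_num (k + j) f (p * det_mpoly K ^+ j).
Proof.
move=> fp g ug; rewrite fp // mevalM rmorphXn /= meval_det_mpoly exprD invfM.
have d0 : \det g ^+ j != 0 by rewrite expf_neq0 ?det_unit_neq0.
by rewrite mulrACA divff // mulr1.
Qed.

Lemma regular_ext f f' : (forall g, g \in unitmx -> f g = f' g) ->
  regular_fun f -> regular_fun f'.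
Proof. by move=> e [p [k h]]; exists p, k => g ug; rewrite -e // h. Qed.

Lemma regular_cst c : regular_fun (fun _ : 'M[K]_n => c).
Proof. by exists c%:MP, 0%N => g _; rewrite mevalC expr0 divr1. Qed.

Lemma regular_entry i j : regular_fun (fun g : 'M[K]_n => g i j).
Proof.
by exists 'X_(mxvec_index i j), 0%N => g _; rewrite mevalXU mxvecE expr0 divr1.
Qed.

Lemma regular_add f f' : regular_fun f -> regular_fun f' ->
  regular_fun (fun g => f g + f' g).
Proof.
move=> [p [k hp]] [q [l hq]].
exists (p * det_mpoly K ^+ l + q * det_mpoly K ^+ k), (k + l)%N => g ug.
rewrite (regular_numS l hp) // [f' g](regular_numS k hq) // [(l + k)%N]addnC.
by rewrite mevalD mulrDl.
Qed.

Lemma regular_mul f f' : regular_fun f -> regular_fun f' ->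
  regular_fun (fun g => f g * f' g).
Proof.
move=> [p [k hp]] [q [l hq]]; exists (p * q), (k + l)%N => g ug.
by rewrite hp // hq // mevalM exprD invfM mulrACA.
Qed.

Lemma regular_sum (I : Type) (r : seq I) (F : I -> 'M[K]_n -> K) :
  (forall i, regular_fun (F i)) -> regular_fun (fun g => \sum_(i <- r) F i g).
Proof.
move=> h; elim: r => [|i r IH].
  by apply: (regular_ext _ (regular_cst 0)) => g _; rewrite big_nil.
by apply: (regular_ext _ (regular_add (h i) IH)) => g _; rewrite big_cons.
Qed.

Lemma regular_prod (I : Type) (r : seq I) (F : I -> 'M[K]_n -> K) :
  (forall i, regular_fun (F i)) -> regular_fun (fun g => \prod_(i <- r) F i g).
Proof.
move=> h; elim: r => [|i r IH].
  by apply: (regular_ext _ (regular_cst 1)) => g _; rewrite big_nil.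
by apply: (regular_ext _ (regular_mul (h i) IH)) => g _; rewrite big_cons.
Qed.

Lemma regular_exp f k : regular_fun f -> regular_fun (fun g => f g ^+ k).
Proof.
move=> h; elim: k => [|k IH]; first by apply: (regular_ext _ (regular_cst 1)).
by apply: (regular_ext _ (regular_mul h IH)) => g _; rewrite exprS.
Qed.

Lemma regular_det : regular_fun (fun g : 'M[K]_n => \det g).
Proof.
by exists (det_mpoly K), 0%N => g _; rewrite meval_det_mpoly expr0 divr1.
Qed.

Lemma regular_detV : regular_fun (fun g : 'M[K]_n => (\det g)^-1).
Proof. by exists 1, 1%N => g _; rewrite meval1 expr1 mul1r. Qed.

Lemma regular_invmx_entry i j : regular_fun (fun g : 'M[K]_n => invmx g i j).
Proof.
apply: (@regular_ext (fun g => (\det g)^-1 * \adj g i j)).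
  by move=> g ug; rewrite /invmx ug !mxE.
apply: regular_mul; first exact: regular_detV.
apply: (@regular_ext (fun g => (-1) ^+ (j + i) * \det (row' j (col' i g)))).
  by move=> g _; rewrite mxE.
apply: regular_mul; first exact: regular_cst.
apply: regular_sum => s; apply: regular_mul; first exact: regular_cst.
apply: regular_prod => a.
move: (perm.fun_of_perm.body _ _) => b.
by apply: (regular_ext _ (regular_entry (lift j a) (lift i b))) => g _; rewrite !mxE.
Qed.

Lemma regular_meval m (p : {mpoly K[m]}) (F : 'M[K]_n -> 'I_m -> K) :
  (forall i, regular_fun (fun g => F g i)) -> regular_fun (fun g => p.@[F g]).
Proof.
move=> h; elim/mpoly_ind_alg: p => [c|p q hp hq|p q hp hq|i].
- by apply: (regular_ext _ (regular_cst c)) => g _; rewrite mevalC.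
- by apply: (regular_ext _ (regular_add hp hq)) => g _; rewrite mevalD.
- by apply: (regular_ext _ (regular_mul hp hq)) => g _; rewrite mevalM.
by apply: (regular_ext _ (h i)) => g _; rewrite mevalXU.
Qed.

Lemma regular_inv f : regular_fun f -> regular_fun (fun g => f (invmx g)).
Proof.
move=> [p [k h]].
apply: (@regular_ext (fun g => p.@[mxvec (invmx g) 0] * \det g ^+ k)).
  by move=> g ug; rewrite h ?unitmx_inv // det_inv exprVn invrK.
apply: regular_mul; last exact/regular_exp/regular_det.
apply: (@regular_meval _ p (fun g i => mxvec (invmx g) 0 i)) => i.
case/mxvec_indexP: i => i j.
by apply: (regular_ext _ (regular_invmx_entry i j)) => g _; rewrite mxvecE.
Qed.

(** The Reynolds functional is built for a fixed power of the determinant,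
    hence the interest in a common denominator. *)
Lemma regular_common (I : finType) (F : I -> 'M[K]_n -> K) :
  (forall i, regular_fun (F i)) ->
  exists k, forall i, exists p, regular_num k (F i) p.
Proof.
move=> h; have {h}/functional_choice[kp kpP] i : exists kp, regular_num kp.1 (F i) kp.2.
  by have [p [k hp]] := h i; exists (k, p).
exists (\max_i (kp i).1)%N => i.
exists ((kp i).2 * det_mpoly K ^+ (\max_i (kp i).1 - (kp i).1)).
by rewrite -{1}(subnKC (leq_bigmax (F := fun i => (kp i).1) i)); apply: regular_numS.
Qed.

(** Translation by [h] on the left, as a linear substitution of the matrix
    entries. *)
Lemma meval_translate p h g :
  (sym_act (lin_mulmx h) p).@[mxvec g 0] = p.@[mxvec (h *m g) 0].
Proof.
rewrite meval_sym_act; apply: meval_eq => j.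
rewrite -(mul_vec_lin (mulmx h)) mxE; apply: eq_bigr => i _.
by rewrite mulrC.
Qed.

Lemma lin_mulmx_tr h : (lin_mulmx h : 'M[K]_(n * n))^T = lin_mulmx h^T.
Proof.
have lE h' (a b c d : 'I_n) :
    (lin_mulmx h' : 'M[K]_(n * n)) (mxvec_index a b) (mxvec_index c d) =
    h' c a *+ (b == d).
  rewrite mxE /= -mxvec_delta mxvecK mxvecE mxE (bigD1 a) //= mxE eqxx mulr_natr /=.
  rewrite big1 ?addr0 1?eq_sym // => k /negPf ka.
  by rewrite mxE ka mulr0.
apply/matrixP => i j; case/mxvec_indexP: i => a b; case/mxvec_indexP: j => c d.
by rewrite mxE !lE mxE eq_sym.
Qed.

Definition reynolds_num k p : K :=
  apolar (det_mpoly K ^+ k) p / apolar (det_mpoly K ^+ k) (det_mpoly K ^+ k).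

Lemma reynolds_num_det k : reynolds_num k (det_mpoly K ^+ k) = 1.
Proof.
rewrite /reynolds_num divff // -det_mpoly_intr -rmorphXn.
by apply: apolar_self_neq0 => //; rewrite expf_neq0 ?det_mpoly_neq0.
Qed.

Lemma reynolds_num_linear k a p q :
  reynolds_num k (a *: p + q) = a * reynolds_num k p + reynolds_num k q.
Proof. by rewrite /reynolds_num apolar_linr mulrDl mulrA. Qed.

(** Powers of the determinant are semi-invariant under translation, so pairing
    with them is, too. *)
Lemma reynolds_num_translate k h p :
  reynolds_num k (sym_act (lin_mulmx h) p) = \det h ^+ k * reynolds_num k p.
Proof.
rewrite /reynolds_num -apolar_adjoint lin_mulmx_tr mulrA; congr (_ / _).
rewrite -apolarZl; congr (apolar _ _).
apply: (meval_inj charK) => v; pose g := vec_mx (\row_i v i) : 'M[K]_n.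
have gv : mxvec g 0 =1 v by move=> i; rewrite /g vec_mxK mxE.
rewrite -!(meval_eq _ gv) meval_translate mevalZ !rmorphXn /= !meval_det_mpoly.
by rewrite det_mulmx det_tr exprMn.
Qed.

(** The exponent [k] is fixed once and for all, which avoids comparing the
    functionals for different powers of the determinant; a finite set of
    matrix coefficients always has a common [k]. *)
Lemma reynolds_functional k : exists I : ('M[K]_n -> K) -> K,
  [/\ forall f p, regular_num k f p -> I f = reynolds_num k p,
      I (fun=> 1) = 1
    & forall f p h, regular_num k f p -> h \in unitmx ->
        I (fun g => f (h *m g)) = I f].
Proof.
pose I f := reynolds_num k (epsilon (inhabits 0) (regular_num k f)).
have IE f p : regular_num k f p -> I f = reynolds_num k p.
  move=> fp; congr reynolds_num; apply: (regular_num_unique _ fp).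
  exact: (epsilon_spec (inhabits 0) (regular_num k f) (ex_intro _ p fp)).
exists I; split=> //.
  rewrite (IE _ (det_mpoly K ^+ k)) ?reynolds_num_det // => g ug.
  by rewrite rmorphXn /= meval_det_mpoly divff // expf_neq0 ?det_unit_neq0.
move=> f p h fp uh; rewrite (IE f p) //.
rewrite (IE _ ((\det h ^- k) *: sym_act (lin_mulmx h) p)).
  rewrite -[X in reynolds_num k X]addr0 reynolds_num_linear.
  have -> : reynolds_num k 0 = 0 by rewrite /reynolds_num apolar0r mul0r.
  rewrite addr0 reynolds_num_translate mulKf // expf_neq0 ?det_unit_neq0 //.
move=> g ug; rewrite fp ?unitmx_mul ?uh // mevalZ meval_translate det_mulmx exprMn.
by rewrite invfM mulrCA mulrA.
Qed.

End Regular.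

(** * Rational matrix representations and their characters *)

Section MatrixReps.
Variables (K : fieldType) (charK : [pchar K] =i pred0) (n : nat).
Implicit Types (g h : 'M[K]_n).

Record is_mxrep m (rho : 'M[K]_n -> 'M[K]_m) : Prop := IsMxRep {
  mxrep1 : rho 1%:M = 1%:M;
  mxrepM : forall g h, g \in unitmx -> h \in unitmx ->
    rho (g *m h) = rho g *m rho h;
  mxrep_regular : forall i j, regular_fun (fun g => rho g i j)
}.

Lemma mxrep_invr m (rho : 'M[K]_n -> 'M[K]_m) g : is_mxrep rho ->
  g \in unitmx -> rho g *m rho (invmx g) = 1%:M.
Proof. by move=> h ug; rewrite -mxrepM ?unitmx_inv // mulmxV // mxrep1. Qed.

Lemma mxrep_invl m (rho : 'M[K]_n -> 'M[K]_m) g : is_mxrep rho ->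
  g \in unitmx -> rho (invmx g) *m rho g = 1%:M.
Proof. by move=> h ug; rewrite -mxrepM ?unitmx_inv // mulVmx // mxrep1. Qed.

Lemma mxrep_cst m : is_mxrep (fun _ : 'M[K]_n => 1%:M : 'M[K]_m).
Proof. by split=> [//|*|i j]; [rewrite mulmx1 | exact: regular_cst]. Qed.

Lemma mxrep_standard : is_mxrep (fun g : 'M[K]_n => g).
Proof. by split=> // i j; exact: regular_entry. Qed.

Lemma invmx_mul g h : g \in unitmx -> h \in unitmx ->
  invmx (g *m h) = invmx h *m invmx g.
Proof.
move=> ug uh; have ugh : g *m h \in unitmx by rewrite unitmx_mul ug.
have e : (g *m h) *m (invmx h *m invmx g) = 1%:M.
  by rewrite mulmxA -(mulmxA g) mulmxV // mulmx1 mulmxV.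
by rewrite -[LHS]mulmx1 -e mulmxA mulVmx // mul1mx.
Qed.

Lemma mxrep_dual m (rho : 'M[K]_n -> 'M[K]_m) : is_mxrep rho ->
  is_mxrep (fun g => (rho (invmx g))^T).
Proof.
move=> h; split=> [|g g' ug ug'|i j].
- by rewrite invmx1 mxrep1 // trmx1.
- by rewrite -trmx_mul -mxrepM ?unitmx_inv // invmx_mul.
by apply: (regular_ext _ (regular_inv (mxrep_regular h j i))) => g _; rewrite mxE.
Qed.

Lemma mxrep_tens m k (rho : 'M[K]_n -> 'M[K]_m) (sigma : 'M[K]_n -> 'M[K]_k) :
  is_mxrep rho -> is_mxrep sigma -> is_mxrep (fun g => rho g *t sigma g).
Proof.
move=> h h'; split=> [|g g' ug ug'|i j].
- rewrite !mxrep1 //; apply/matrixP => i j.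
  case: (mxtens_indexP i) => a b; case: (mxtens_indexP j) => c d.
  by rewrite tensmxE !mxE (can_eq (@mxtens_indexK m k)) xpair_eqE -natrM mulnb.
- by rewrite tensmx_mul !mxrepM.
apply: (@regular_ext _ _ (fun g => rho g (mxtens_unindex i).1 (mxtens_unindex j).1 *
   sigma g (mxtens_unindex i).2 (mxtens_unindex j).2)).
  by move=> g _; rewrite mxE.
by apply: regular_mul; apply: mxrep_regular.
Qed.

Lemma mxtrace_tens m k (A : 'M[K]_m) (B : 'M[K]_k) : \tr (A *t B) = \tr A * \tr B.
Proof. by rewrite /mxtrace mulr_sum; apply: eq_bigr => i _; rewrite mxE. Qed.

Lemma mxrep_block m k (rho : 'M[K]_n -> 'M[K]_m) (sigma : 'M[K]_n -> 'M[K]_k) :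
  is_mxrep rho -> is_mxrep sigma -> is_mxrep (fun g => block_mx (rho g) 0 0 (sigma g)).
Proof.
move=> h h'; split=> [|g g' ug ug'|i j].
- by rewrite !mxrep1 // -scalar_mx_block.
- by rewrite mulmx_block !mul0mx !mulmx0 !addr0 !add0r !mxrepM.
case: (split_ordP i) => a ->; case: (split_ordP j) => b ->.
- by apply: (regular_ext _ (mxrep_regular h a b)) => g _; rewrite block_mxEul.
- by apply: (regular_ext _ (@regular_cst K n 0)) => g _; rewrite block_mxEur mxE.
- by apply: (regular_ext _ (@regular_cst K n 0)) => g _; rewrite block_mxEdl mxE.
by apply: (regular_ext _ (mxrep_regular h' a b)) => g _; rewrite block_mxEdr.
Qed.

(** The representation on the image of an equivariant idempotent [C *m R]. *)
Lemma mxrep_summand m r (rho : 'M[K]_n -> 'M[K]_m) (C : 'M[K]_(m, r)) (R : 'M[K]_(r, m)) :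
  is_mxrep rho -> R *m C = 1%:M ->
  (forall g, g \in unitmx -> rho g *m (C *m R) = C *m R *m rho g) ->
  is_mxrep (fun g => R *m rho g *m C).
Proof.
move=> h RC comm; split=> [|g g' ug ug'|i j].
- by rewrite mxrep1 // mulmx1.
- have e : R *m rho g *m C *m R = R *m rho g.
    by rewrite -!mulmxA comm // !mulmxA RC mul1mx.
  by rewrite mxrepM // !mulmxA e.
apply: (@regular_ext _ _ (fun g => \sum_b \sum_a R i a * rho g a b * C b j)).
  move=> g _; rewrite mxE; apply: eq_bigr => b _; rewrite mxE mulr_suml.
  by apply: eq_bigr.
apply: regular_sum => b; apply: regular_sum => a.
apply: regular_mul; last exact: regular_cst.
by apply: regular_mul; [exact: regular_cst | exact: mxrep_regular].
Qed.

Lemma idem_split m (E : 'M[K]_m) : E *m E = E ->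
  exists r (C : 'M[K]_(m, r)) (R : 'M[K]_(r, m)),
    [/\ r = \rank E, C *m R = E & R *m C = 1%:M].
Proof.
move=> EE; have /row_fullP[L LC] := col_base_full E.
have /row_freeP[S RS] := row_base_free E; have CR := mulmx_base E.
exists (\rank E), (col_base E), (row_base E); split=> //.
move: (col_base E) (row_base E) LC RS CR => C R LC RS CR.
have : L *m (C *m R *m (C *m R)) *m S = L *m (C *m R) *m S by rewrite CR EE.
by rewrite !mulmxA LC !mul1mx RS -mulmxA RS mulmx1.
Qed.

Lemma mxtrace_idem m (E : 'M[K]_m) : E *m E = E -> \tr E = (\rank E)%:R.
Proof.
move=> /idem_split[r [C [R [<- CR RC]]]].
by rewrite -CR mxtrace_mulC RC mxtrace1.
Qed.

Section Average.
Variables (k : nat) (I : ('M[K]_n -> K) -> K).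
Hypothesis IE : forall f p, regular_num k f p -> I f = reynolds_num k p.
Hypothesis I1 : I (fun=> 1) = 1.
Hypothesis IT : forall f p h, regular_num k f p -> h \in unitmx ->
  I (fun g => f (h *m g)) = I f.

Definition has_num (f : 'M[K]_n -> K) : Prop := exists p, regular_num k f p.

Lemma num_ext f f' : (forall g, g \in unitmx -> f g = f' g) -> has_num f -> has_num f'.
Proof. by move=> e [p fp]; exists p => g ug; rewrite -e // fp. Qed.

Lemma num_linear a f f' : has_num f -> has_num f' -> has_num (fun g => a * f g + f' g).
Proof.
move=> [p fp] [q fq]; exists (a *: p + q) => g ug.
by rewrite fp // fq // mevalD mevalZ mulrDl mulrA.
Qed.

Lemma num_one : has_num (fun=> 1).
Proof.
exists (det_mpoly n K ^+ k) => g ug.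
by rewrite rmorphXn /= meval_det_mpoly divff // expf_neq0 ?det_unit_neq0.
Qed.

Lemma num_zero : has_num (fun=> 0).
Proof. by exists 0 => g ug; rewrite meval0 mul0r. Qed.

Lemma num_comb (J : Type) (r : seq J) (c : J -> K) (F : J -> 'M[K]_n -> K) :
  (forall j, has_num (F j)) -> has_num (fun g => \sum_(j <- r) c j * F j g).
Proof.
move=> h; elim: r => [|j r IH].
  by apply: (num_ext _ num_zero) => g _; rewrite big_nil.
by apply: (num_ext _ (num_linear (c j) (h j) IH)) => g _; rewrite big_cons.
Qed.

Lemma I_ext f f' : (forall g, g \in unitmx -> f g = f' g) -> has_num f -> I f = I f'.
Proof.
move=> e [p fp]; rewrite (IE fp); apply/esym/IE => g ug.
by rewrite -e // fp.
Qed.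

Lemma I_linear a f f' : has_num f -> has_num f' ->
  I (fun g => a * f g + f' g) = a * I f + I f'.
Proof.
move=> [p fp] [q fq]; rewrite (IE fp) (IE fq) -reynolds_num_linear.
by apply: IE => g ug; rewrite fp // fq // mevalD mevalZ mulrDl mulrA.
Qed.

Lemma I_zero : I (fun=> 0) = 0.
Proof.
have -> : I (fun=> 0) = -1 * I (fun=> 0) + I (fun=> 0).
  rewrite -I_linear; [|exact: num_zero|exact: num_zero].
  by apply: I_ext num_zero => g _; rewrite mulr0 addr0.
by rewrite mulN1r addNr.
Qed.

Lemma I_comb (J : Type) (r : seq J) (c : J -> K) (F : J -> 'M[K]_n -> K) :
  (forall j, has_num (F j)) ->
  I (fun g => \sum_(j <- r) c j * F j g) = \sum_(j <- r) c j * I (F j).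
Proof.
move=> h; elim: r => [|j r IH].
  by rewrite big_nil -[RHS]I_zero; apply/esym/I_ext => [g _|]; [rewrite big_nil|exact: num_zero].
rewrite big_cons -IH -I_linear; [|exact: h|exact: num_comb].
by apply: I_ext => [g _|]; [rewrite big_cons|apply: num_comb].
Qed.

Definition average a b (F : 'M[K]_n -> 'M[K]_(a, b)) : 'M[K]_(a, b) :=
  \matrix_(i, j) I (fun g => F g i j).

Definition mx_num a b (F : 'M[K]_n -> 'M[K]_(a, b)) : Prop :=
  forall i j, has_num (fun g => F g i j).

Lemma average_ext a b (F F' : 'M[K]_n -> 'M[K]_(a, b)) :
  (forall g, g \in unitmx -> F g = F' g) -> mx_num F -> average F = average F'.
Proof.
by move=> e h; apply/matrixP => i j; rewrite !mxE; apply: I_ext => // g /e ->.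
Qed.

Lemma average_mul a b c d (C : 'M[K]_(c, a)) (D : 'M[K]_(b, d))
    (F : 'M[K]_n -> 'M[K]_(a, b)) : mx_num F ->
  average (fun g => C *m F g *m D) = C *m average F *m D.
Proof.
move=> h; apply/matrixP => i j; rewrite mxE.
have E (X : 'M[K]_(a, b)) :
    (C *m X *m D) i j = \sum_(p : 'I_a * 'I_b) (C i p.1 * D p.2 j) * X p.1 p.2.
  rewrite mxE; under eq_bigr do rewrite mxE mulr_suml.
  rewrite exchange_big pair_big; apply: eq_bigr => p _ /=; ring.
rewrite E -(I_ext (f := fun g => \sum_(p : 'I_a * 'I_b) (C i p.1 * D p.2 j) * F g p.1 p.2)).
- by rewrite I_comb //; apply: eq_bigr => p _; rewrite mxE.
- by move=> g _; rewrite E.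
by apply: num_comb => p; apply: h.
Qed.

Lemma average_translate a b (F : 'M[K]_n -> 'M[K]_(a, b)) h : mx_num F ->
  h \in unitmx -> average (fun g => F (h *m g)) = average F.
Proof.
by move=> hF uh; apply/matrixP => i j; rewrite !mxE; have [p fp] := hF i j; apply: IT fp uh.
Qed.

Lemma average_cst a b (C : 'M[K]_(a, b)) : average (fun _ => C) = C.
Proof.
apply/matrixP => i j; rewrite mxE.
transitivity (C i j * I (fun=> 1) + I (fun=> 0)).
  rewrite -I_linear; [|exact: num_one|exact: num_zero].
  apply/esym/I_ext => [g _|]; first by rewrite mulr1 addr0.
  exact: (num_linear _ num_one num_zero).
by rewrite I1 I_zero mulr1 addr0.
Qed.

Lemma mx_num_cst a b (C : 'M[K]_(a, b)) : mx_num (fun _ => C).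
Proof.
move=> i j; apply: (num_ext _ (num_linear (C i j) num_one num_zero)) => g _.
by rewrite mulr1 addr0.
Qed.

Lemma average_fixed m (rho : 'M[K]_n -> 'M[K]_m) h : is_mxrep rho -> mx_num rho ->
  h \in unitmx -> rho h *m average rho = average rho.
Proof.
move=> hr nr uh; rewrite -[LHS]mulmx1 -average_mul // -[RHS](average_translate nr uh).
apply/esym/average_ext => [g ug|i j]; first by rewrite mulmx1 mxrepM.
apply: (num_ext (f := fun g => (rho h *m rho g *m 1%:M) i j)) => [g ug|].
  by rewrite mulmx1 mxrepM.
apply: (num_ext (f := fun g => \sum_a rho h i a * rho g a j)) => [g ug|].
  by rewrite mulmx1 mxE.
by apply: num_comb => a; apply: nr.
Qed.

Lemma average_fix m (rho : 'M[K]_n -> 'M[K]_m) b (v : 'M[K]_(m, b)) : mx_num rho ->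
  (forall g, g \in unitmx -> rho g *m v = v) -> average rho *m v = v.
Proof.
move=> nr fv; rewrite -[average rho]mul1mx -average_mul // -[RHS]average_cst.
apply/esym/average_ext; last exact: mx_num_cst.
by move=> g ug; rewrite mul1mx fv.
Qed.

(** The average is the projection onto the fixed vectors, so its trace
    counts them; and this trace is computed from the character alone. *)
Lemma trace_average m (rho : 'M[K]_n -> 'M[K]_m) : is_mxrep rho -> mx_num rho ->
  I (fun g => \tr (rho g)) = (\rank (average rho))%:R.
Proof.
move=> hr nr; rewrite -mxtrace_idem; last first.
  by apply: average_fix => // g; apply: average_fixed.
rewrite -(I_ext (f := fun g => \sum_i 1 * rho g i i)).
- by rewrite I_comb //; apply: eq_bigr => i _; rewrite mul1r mxE.
- by move=> g _; apply: eq_bigr => i _; rewrite mul1r.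
by apply: num_comb.
Qed.

End Average.
End MatrixReps.

Section Isomorphism.
Variables (K : fieldType) (charK : [pchar K] =i pred0) (n : nat).
Implicit Types (g h : 'M[K]_n).

Lemma has_num_raise k j (f : 'M[K]_n -> K) : has_num k f -> has_num (k + j) f.
Proof. by move=> [p fp]; exists (p * det_mpoly n K ^+ j); apply: regular_numS. Qed.

Lemma mx_num_common a b (F : 'M[K]_n -> 'M[K]_(a, b)) :
  (forall i j, regular_fun (fun g => F g i j)) -> exists k, mx_num k F.
Proof.
move=> h; have [k kP] := @regular_common _ _ (('I_a * 'I_b)%type : finType)
  (fun p g => F g p.1 p.2) (fun p => h p.1 p.2).
by exists k => i j; have [p fp] := kP (i, j); exists p.
Qed.

Definition unvec m k (c : 'cV[K]_(m * k)) : 'M[K]_(m, k) :=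
  \matrix_(i, j) c (mxtens_index (i, j)) 0.

Lemma unvec_inj m k : injective (@unvec m k).
Proof.
move=> c c' /matrixP e; apply/colP => x; case: (mxtens_indexP x) => i j.
by have := e i j; rewrite !mxE.
Qed.

Lemma unvec_surj m k (X : 'M[K]_(m, k)) : exists c, unvec c = X.
Proof.
exists (\col_x X (mxtens_unindex x).1 (mxtens_unindex x).2).
by apply/matrixP => i j; rewrite !mxE mxtens_indexK.
Qed.

Lemma unvec_tens m k (A : 'M[K]_m) (B : 'M[K]_k) c :
  unvec ((A *t B) *m c) = A *m unvec c *m B^T.
Proof.
apply/matrixP => i j; rewrite !mxE.
rewrite (reindex (@mxtens_index m k)) /=; last first.
  by exists (@mxtens_unindex m k) => x _; rewrite ?mxtens_indexK ?mxtens_unindexK.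
under [RHS]eq_bigr do rewrite !mxE mulr_suml.
rewrite exchange_big pair_big; apply: eq_bigr => -[a b] _ /=.
by rewrite tensmxE mxE; ring.
Qed.

(** Equivariant matrices are the fixed vectors of a tensor product, whose
    number depends on the characters only; for two copies of one
    representation the identity is such a matrix. *)
Lemma nonzero_intertwiner m k (rho : 'M[K]_n -> 'M[K]_m) (sigma : 'M[K]_n -> 'M[K]_k) :
  is_mxrep rho -> is_mxrep sigma ->
  (forall g, g \in unitmx -> \tr (rho g) = \tr (sigma g)) -> (0 < m)%N ->
  exists2 X : 'M[K]_(m, k), X != 0 &
    forall g, g \in unitmx -> rho g *m X = X *m sigma g.
Proof.
move=> hr hs tr m0.
have ht := mxrep_tens hr (mxrep_dual hs).
have ht' := mxrep_tens hr (mxrep_dual hr).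
have [a na] := mx_num_common (mxrep_regular ht).
have [b nb] := mx_num_common (mxrep_regular ht').
have {}na : mx_num (a + b) (fun g => rho g *t (sigma (invmx g))^T).
  by move=> i j; apply: has_num_raise.
have {}nb : mx_num (a + b) (fun g => rho g *t (rho (invmx g))^T).
  by move=> i j; rewrite addnC; apply: has_num_raise.
have [I [IE I1 IT]] := reynolds_functional charK n (a + b).
set E := average I (fun g => rho g *t (sigma (invmx g))^T).
have rE : (\rank E)%:R = (\rank (average I (fun g => rho g *t (rho (invmx g))^T)))%:R :> K.
  rewrite -!(trace_average IE I1 IT) //; apply: (I_ext IE) => [g ug|].
    by rewrite !mxtrace_tens !mxtrace_tr (tr (invmx g)) ?unitmx_inv.
  apply: (num_ext (f := fun g => \sum_i 1 * (rho g *t (sigma (invmx g))^T) i i)).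
    by move=> g _; apply: eq_bigr => i _; rewrite mul1r.
  by apply: num_comb => i.
have [c cP] := unvec_surj (1%:M : 'M[K]_m).
have fc : average I (fun g => rho g *t (rho (invmx g))^T) *m c = c.
  apply: (average_fix IE I1) => // g ug; apply: unvec_inj.
  by rewrite unvec_tens cP trmxK mulmx1 mxrep_invr.
have E0 : E != 0.
  rewrite -mxrank_eq0 -(natr_eq0_char0 charK) rE (natr_eq0_char0 charK) mxrank_eq0.
  apply/eqP => e0; move: fc cP; rewrite e0 mul0mx => <- /matrixP /(_ (Ordinal m0) (Ordinal m0)).
  by rewrite !mxE eqxx => /esym/eqP; rewrite oner_eq0.
have [j Ej] : exists j, col j E != 0.
  apply/existsP; rewrite -negb_forall; apply: contra E0 => /forallP h.
  by apply/eqP/matrixP => i j; have /eqP/colP/(_ i) := h j; rewrite !mxE.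
exists (unvec (col j E)).
  apply: contra Ej => /eqP e; apply/eqP/unvec_inj; rewrite e.
  by apply/matrixP => i i'; rewrite !mxE.
move=> g ug; have := average_fixed IE IT ht na ug.
rewrite -/E => /(congr1 (col j)); rewrite colE -mulmxA -colE.
move=> /(congr1 (@unvec _ _)); rewrite unvec_tens trmxK => e.
by rewrite -[in RHS]e -(mulmxA _ (sigma _)) mxrep_invl // mulmx1.
Qed.

(** The averaged pseudo-inverse of an equivariant matrix is still a
    pseudo-inverse, and is equivariant. *)
Lemma equivariant_pinv m k (rho : 'M[K]_n -> 'M[K]_m) (sigma : 'M[K]_n -> 'M[K]_k)
    (X : 'M[K]_(m, k)) : is_mxrep rho -> is_mxrep sigma ->
  (forall g, g \in unitmx -> rho g *m X = X *m sigma g) ->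
  exists Y : 'M[K]_(k, m), [/\ X *m Y *m X = X, Y *m X *m Y = Y &
    forall g, g \in unitmx -> sigma g *m Y = Y *m rho g].
Proof.
move=> hr hs eX.
suff [Y [XYX eY]] : exists Y : 'M[K]_(k, m), X *m Y *m X = X /\
    forall g, g \in unitmx -> sigma g *m Y = Y *m rho g.
  exists (Y *m X *m Y); split.
  - by rewrite !mulmxA XYX XYX.
  - have e : Y *m X *m Y *m X = Y *m X by rewrite -!mulmxA (mulmxA X) XYX.
    by rewrite !mulmxA !e.
  by move=> g ug; rewrite !mulmxA eY // -(mulmxA Y) eX // -!mulmxA eY.
pose F g := sigma g *m pinvmx X *m rho (invmx g).
have regF i j : regular_fun (fun g => F g i j).
  apply: (@regular_ext _ _ (fun g => \sum_b (\sum_a sigma g i a * pinvmx X a b) *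
      rho (invmx g) b j)).
    by move=> g _; rewrite mxE; apply: eq_bigr => b _; rewrite mxE.
  apply: regular_sum => b; apply: regular_mul; last first.
    exact/(regular_inv (mxrep_regular hr b j)).
  apply: regular_sum => a; apply: regular_mul; last exact: regular_cst.
  exact: mxrep_regular.
have [a na] := mx_num_common regF.
have [I [IE I1 IT]] := reynolds_functional charK n a.
exists (average I F); split.
  rewrite -(average_mul IE) // -[RHS](average_cst IE I1).
  apply/esym/(average_ext IE); last exact: mx_num_cst.
  move=> g ug; have -> : X *m F g *m X = rho g *m (X *m pinvmx X *m X) *m sigma (invmx g).
    by rewrite /F !mulmxA -eX // -!mulmxA eX ?unitmx_inv.
  by rewrite mulmxKpV // eX // -mulmxA mxrep_invr // mulmx1.
move=> h uh.
have e : sigma h *m average I F *m rho (invmx h) = average I F.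
  rewrite -(average_mul IE) // -[RHS](average_translate IT na uh).
  apply/esym/(average_ext IE) => [g ug|i j].
    by rewrite /F mxrepM // invmx_mul // mxrepM ?unitmx_inv // !mulmxA.
  have [p fp] := na i j.
  exists (\det h ^- a *: sym_act (lin_mulmx h) p) => g ug.
  transitivity (F (h *m g) i j).
    by rewrite /F mxrepM // invmx_mul // mxrepM ?unitmx_inv // !mulmxA.
  rewrite fp ?unitmx_mul ?uh // mevalZ meval_translate det_mulmx exprMn.
  by rewrite invfM mulrCA mulrA.
by rewrite -[in RHS]e -mulmxA mxrep_invl // mulmx1.
Qed.

(** Representations with the same character are isomorphic: splitting off the
    support of a nonzero equivariant matrix leaves smaller representations that
    still have the same character. *)
Lemma mxrep_iso m k (rho : 'M[K]_n -> 'M[K]_m) (sigma : 'M[K]_n -> 'M[K]_k) :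
  is_mxrep rho -> is_mxrep sigma ->
  (forall g, g \in unitmx -> \tr (rho g) = \tr (sigma g)) ->
  exists (P : 'M[K]_(m, k)) (Q : 'M[K]_(k, m)),
    [/\ P *m Q = 1%:M, Q *m P = 1%:M &
        forall g, g \in unitmx -> rho g *m P = P *m sigma g].
Proof.
move: {2}m.+1 (ltnSn m) => N; elim: N m k rho sigma => // N IH m k rho sigma ltmN hr hs tr.
have emk : m = k.
  apply: (natr_inj_char0 charK).
  by have := tr 1%:M (unitmx1 _ _); rewrite !mxrep1 // !mxtrace1.
case: (posnP m) => [m0|m0].
  have k0 : k = 0%N by rewrite -emk.
  exists 0, 0; split=> [||g _]; apply/matrixP => i; have := ltn_ord i.
  - by rewrite [X in (_ < X)%N -> _]m0.
  - by rewrite [X in (_ < X)%N -> _]k0.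
  by rewrite [X in (_ < X)%N -> _]m0.
have [X X0 eX] := nonzero_intertwiner hr hs tr m0.
have [Y [XYX YXY eY]] := equivariant_pinv hr hs eX.
have idX : (X *m Y) *m (X *m Y) = X *m Y by rewrite !mulmxA XYX.
have idY : (Y *m X) *m (Y *m X) = Y *m X by rewrite !mulmxA YXY.
have idem p (e : 'M[K]_p) : e *m e = e -> (1%:M - e) *m (1%:M - e) = 1%:M - e.
  by move=> ee; rewrite mulmxBl mul1mx mulmxBr mulmx1 ee subrr subr0.
have [r1 [C1 [R1 [er1 CR1 RC1]]]] := idem_split (idem _ _ idX).
have [r2 [C2 [R2 [_ CR2 RC2]]]] := idem_split (idem _ _ idY).
have comm1 g : g \in unitmx -> rho g *m (C1 *m R1) = C1 *m R1 *m rho g.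
  by move=> ug; rewrite CR1 mulmxBr mulmxBl mulmx1 mul1mx !mulmxA eX // -!mulmxA eY.
have comm2 g : g \in unitmx -> sigma g *m (C2 *m R2) = C2 *m R2 *m sigma g.
  by move=> ug; rewrite CR2 mulmxBr mulmxBl mulmx1 mul1mx !mulmxA eY // -!mulmxA eX.
have h1 := mxrep_summand hr RC1 comm1.
have h2 := mxrep_summand hs RC2 comm2.
have small : (r1 < N)%N.
  rewrite er1.
  have : (\rank (1%:M - X *m Y)%R + \rank (X *m Y)%R)%N = m.
    apply: (natr_inj_char0 charK); rewrite natrD -!mxtrace_idem //; last exact: idem.
    by rewrite -mxtraceD subrK mxtrace1.
  have : (0 < \rank (X *m Y)%R)%N.
    rewrite lt0n mxrank_eq0; apply: contra X0 => /eqP e0.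
    by rewrite -XYX e0 mul0mx.
  by move=> r0 e; rewrite -ltnS (leq_trans _ ltmN) // ltnS -[X in (_ < X)%N]e -addn1 leq_add2l.
have [|P [Q [PQ QP eP]]] := IH _ _ _ _ small h1 h2.
  move=> g ug; rewrite mxtrace_mulC mulmxA [RHS]mxtrace_mulC mulmxA CR1 CR2.
  rewrite !mulmxBl !mul1mx !raddfB /= tr //; congr (_ - _).
  by rewrite -!mulmxA -eY // [X *m (_ *m _)]mulmxA mxtrace_mulC.
have XC2 : X *m C2 = 0.
  have -> : C2 = (1%:M - Y *m X) *m C2 by rewrite -CR2 -mulmxA RC2 mulmx1.
  by rewrite mulmxA mulmxBr mulmx1 mulmxA XYX subrr mul0mx.
have YC1 : Y *m C1 = 0.
  have -> : C1 = (1%:M - X *m Y) *m C1 by rewrite -CR1 -mulmxA RC1 mulmx1.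
  by rewrite mulmxA mulmxBr mulmx1 mulmxA YXY subrr mul0mx.
have R1X : R1 *m X = 0.
  have -> : R1 = R1 *m (1%:M - X *m Y) by rewrite -CR1 mulmxA RC1 mul1mx.
  by rewrite -mulmxA mulmxBl mul1mx XYX subrr mulmx0.
have R2Y : R2 *m Y = 0.
  have -> : R2 = R2 *m (1%:M - Y *m X) by rewrite -CR2 mulmxA RC2 mul1mx.
  by rewrite -mulmxA mulmxBl mul1mx YXY subrr mulmx0.
(* The isomorphism of the supports and that of the complements, added. *)
exists (X + C1 *m P *m R2), (Y + C2 *m Q *m R1); split.
- rewrite mulmxDl !mulmxDr !mulmxA XC2 !mul0mx addr0 -!(mulmxA (C1 *m P)) R2Y.
  rewrite mulmx0 add0r !mulmxA -(mulmxA _ R2) RC2 mulmx1 -(mulmxA C1) PQ mulmx1 CR1.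
  by rewrite addrC subrK.
- rewrite mulmxDl !mulmxDr !mulmxA YC1 !mul0mx addr0 -!(mulmxA (C2 *m Q)) R1X.
  rewrite mulmx0 add0r !mulmxA -(mulmxA _ R1) RC1 mulmx1 -(mulmxA C2) QP mulmx1 CR2.
  by rewrite addrC subrK.
move=> g ug; rewrite mulmxDr mulmxDl eX //; congr (_ + _).
have e1 : rho g *m C1 = C1 *m (R1 *m rho g *m C1).
  by rewrite !mulmxA -comm1 // -!mulmxA RC1 mulmx1.
have e2 : (R2 *m sigma g *m C2) *m R2 = R2 *m sigma g.
  by rewrite -!mulmxA comm2 // !mulmxA RC2 mul1mx.
by rewrite !mulmxA e1 -(mulmxA C1) eP // -(mulmxA C1) -(mulmxA P) e2 !mulmxA.
Qed.

End Isomorphism.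

(** * Class functions are determined by their values on the torus *)

Section Companion.
Variables (K : fieldType) (n : nat).
Implicit Types (g x : 'M[K]_n.+1) (v : 'rV[K]_n.+1).

Definition krylov v x : 'M[K]_n.+1 := \matrix_(i < n.+1) iter i (fun u => u *m x) v.

(** The companion matrix of the monic polynomial whose coefficients are, up
    to sign, the [b i], with [b i] in the place of the elementary symmetric
    function of degree [i.+1]. *)
Definition companion (b : 'I_n.+1 -> K) : 'M[K]_n.+1 :=
  \matrix_(i, j) if i == ord_max then - ((-1) ^+ (n.+1 - j) * b (rev_ord j))
                 else (j == i.+1 :> nat)%:R.

Lemma companion_mul b k (M : 'M[K]_(n.+1, k)) i j :
  (companion b *m M) i j =
  if i == ord_max then - \sum_(l < n.+1) (-1) ^+ (n.+1 - l) * b (rev_ord l) * M l j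
  else M (inord i.+1) j.
Proof.
rewrite mxE; under eq_bigr do rewrite mxE; case: eqP => [_|ni].
  by rewrite -sumrN; apply: eq_bigr => l _; rewrite mulNr.
have lt_i : (i.+1 < n.+1)%N.
  by rewrite ltn_neqAle ltn_ord andbT; apply/eqP => -[e]; apply/ni/val_inj.
rewrite (bigD1 (inord i.+1)) //= inordK // eqxx mul1r big1 ?addr0 // => l.
by rewrite -val_eqE /= inordK // => /negPf ->; rewrite mul0r.
Qed.

(** Multiplication by [x] shifts the rows [v], [v x], [v x^2], and so on;
    the image of the last row is some combination of these rows, which form
    a basis. *)
Lemma krylov_companion v x : krylov v x \in unitmx ->
  exists b, krylov v x *m x = companion b *m krylov v x.
Proof.
set M := krylov v x => uM; pose a := iter n.+1 (fun u => u *m x) v *m invmx M.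
pose b i := - ((-1) ^+ (n.+1 - rev_ord i) * a 0 (rev_ord i)).
have bE l : b (rev_ord l) = - ((-1) ^+ (n.+1 - l) * a 0 l) by rewrite /b rev_ordK.
exists b.
apply/matrixP => i j; rewrite companion_mul.
have -> : (M *m x) i j = iter i.+1 (fun u => u *m x) v 0 j.
  have -> : (M *m x) i j = row i (M *m x) 0 j by rewrite [RHS]mxE.
  by rewrite row_mul rowK.
case: eqP => [-> /=|ni]; last first.
  have lt_i : (i.+1 < n.+1)%N.
    by rewrite ltn_neqAle ltn_ord andbT; apply/eqP => -[e]; apply/ni/val_inj.
  by rewrite [RHS]mxE inordK.
have -> : iter n (fun u => u *m x) v *m x = a *m M by rewrite /a mulmxKV.
rewrite mxE -sumrN; apply: eq_bigr => l _.
by rewrite bE mulrN mulNr opprK signrMK.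
Qed.

Lemma krylov_of_companion b : krylov (delta_mx 0 0) (companion b) = 1%:M.
Proof.
apply/row_matrixP => i; rewrite rowK row1.
case: i => i /=; elim: i => [|i IH] lti /=.
  by congr delta_mx; apply: val_inj.
rewrite (IH (ltnW lti)); apply/rowP => j; rewrite -rowE !mxE /=.
by rewrite -val_eqE /= ltn_eqF // -val_eqE.
Qed.

(** The rows of the Vandermonde matrix are the successive images of the all-
    ones vector under [diag_mx z], so this is the Krylov relation for a
    diagonal matrix. *)
Lemma vandermonde_companion (z : 'rV[K]_n.+1) :
  Vandermonde n.+1 z *m diag_mx z =
  companion (fun i => (mesym n.+1 K i.+1).@[z 0]) *m Vandermonde n.+1 z.
Proof.
apply/matrixP => i j; rewrite companion_mul mul_mx_diag !mxE -exprSr.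
case: eqP => [->|ni]; last first.
  have lt_i : (i.+1 < n.+1)%N.
    by rewrite ltn_neqAle ltn_ord andbT; apply/eqP => -[e]; apply/ni/val_inj.
  by rewrite inordK.
pose cs : n.+1.-tuple K := [tuple z 0 i | i < n.+1].
pose Q := \prod_(c <- cs) ('X - c%:P).
have sQ : size Q = n.+2 by rewrite size_prod_XsubC size_tuple.
have : Q.[z 0 j] = 0.
  by apply/rootP; rewrite root_prod_XsubC; apply/codomP; exists j.
have cQ (k : 'I_n.+2) : Q`_(n.+1 - k) = (-1) ^+ k * (mesym n.+1 K k).@[z 0].
  rewrite mroots_coeff; congr (_ * _); apply: meval_eq => l.
  by rewrite tnth_mktuple.
have Q1 : Q`_n.+1 = 1 by have := cQ ord0; rewrite subn0 expr0 mul1r mesym0E meval1.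
rewrite horner_coef sQ big_ord_recr /= Q1 mul1r => /eqP.
rewrite addrC addr_eq0 => /eqP ->; congr (- _); apply: eq_bigr => l _.
rewrite !mxE; congr (_ * _).
have lt_l : (n.+1 - l < n.+2)%N by rewrite ltnS leq_subr.
have := cQ (Ordinal lt_l); rewrite /= subKn 1?ltnW // => ->.
by rewrite /= subSS -subSn // -ltnS.
Qed.

End Companion.

Section ClassFunction.
Variables (K : fieldType) (charK : [pchar K] =i pred0).

Lemma companion_num n (p : {mpoly K[n.+1 * n.+1]}) : exists q : {mpoly K[n.+1]},
  forall b, q.@[b] = p.@[mxvec (companion b) 0] :> K.
Proof.
pose e (x : 'I_(n.+1 * n.+1)) : {mpoly K[n.+1]} :=
  (mxvec (\matrix_(i < n.+1, j < n.+1) if i == ord_max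
    then - ((-1) ^+ (n.+1 - j) * 'X_(rev_ord j)) else (j == i.+1 :> nat)%:R)) 0 x.
exists (p \mPo [tuple e x | x < n.+1 * n.+1]) => b.
rewrite comp_mpoly_meval; apply: meval_eq => x; rewrite tnth_mktuple /e.
case/mxvec_indexP: x => i j; rewrite !mxvecE !mxE; case: ifP => _; last first.
  by rewrite rmorph_nat.
by rewrite mevalN mevalM rmorphXn /= mevalN meval1 mevalXU.
Qed.

Lemma krylov_num n : exists q : {mpoly K[n.+1 * n.+1]},
  forall g : 'M[K]_n.+1, q.@[mxvec g 0] = \det (krylov (delta_mx 0 0) g).
Proof.
pose X : 'M[{mpoly K[n.+1 * n.+1]}]_n.+1 := \matrix_(i, j) 'X_(mxvec_index i j).
pose u i : 'rV[{mpoly K[n.+1 * n.+1]}]_n.+1 := iter i (fun u => u *m X) (delta_mx 0 0).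
exists (\det (\matrix_(i < n.+1) u i)) => g.
rewrite -[LHS](det_map_mx (meval (mxvec g 0))); congr (\det _).
have XE : map_mx (meval (mxvec g 0)) X = g.
  by apply/matrixP => i j; rewrite 2!mxE /= mevalXU mxvecE.
apply/row_matrixP => i; rewrite -map_row !rowK /u.
elim: (i : nat) => [|j IH] /=; first by rewrite map_delta_mx.
by rewrite map_mxM XE IH.
Qed.

(** A generic matrix is conjugate to a companion matrix by a Krylov matrix.  On
    companion matrices a class function is a polynomial in the elementary
    symmetric functions of the eigenvalues; if it vanishes on the torus, it is
    zero since these functions are algebraically independent. *)
Lemma class_function_torus n (f : 'M[K]_n -> K) : regular_fun f ->
  (forall g h, g \in unitmx -> h \in unitmx -> f (h *m g *m invmx h) = f g) ->
  (forall z : 'rV[K]_n, (forall i, z 0 i != 0) -> f (diag_mx z) = 0) ->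
  forall g, g \in unitmx -> f g = 0.
Proof.
case: n f => [|n] f [p [k fp]] fconj ftorus.
  by move=> g _; rewrite -(ftorus 0) => [|[]//]; congr f; apply/matrixP => -[].
have [q qE] := companion_num p.
have conj0 g M b : g \in unitmx -> M \in unitmx ->
    M *m g = companion b *m M -> companion b \in unitmx /\ f (companion b) = f g.
  move=> ug uM e; have -> : companion b = M *m g *m invmx M by rewrite e mulmxK.
  by rewrite fconj // !unitmx_mul ug uM unitmx_inv.
have q0 : q = 0.
  apply: (@msym_fundamental_un0 _ _).
  (* Where [D] does not vanish, [v] lies in the torus and its coordinates are
     distinct, so that the Vandermonde matrix is invertible. *)
  pose D : {mpoly K[n.+1]} := \prod_i 'X_i * \prod_(i < n.+1) \prod_(j < n.+1 | (i < j)%N) ('X_j - 'X_i).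
  have DE v : D.@[v] = (\prod_i v i) * \prod_(i < n.+1) \prod_(j < n.+1 | (i < j)%N) (v j - v i).
    rewrite mevalM !rmorph_prod /=; congr (_ * _); apply: eq_bigr => i _.
      by rewrite mevalXU.
    by rewrite rmorph_prod; apply: eq_bigr => j _; rewrite /= mevalB !mevalXU.
  have D0 : D != 0.
    apply/eqP => /(congr1 (meval (fun i : 'I_n.+1 => (i.+1)%:R))).
    rewrite meval0 DE => /eqP; rewrite mulf_eq0 => /orP[] /prodf_eq0[i _].
      by rewrite natr_eq0_char0.
    move=> /prodf_eq0[j ltij]; rewrite -natrB ?natr_eq0_char0 //; last by rewrite ltnS ltnW.
    by rewrite subSS subn_eq0 leqNgt ltij.
  apply/eqP; have : (q \mPo [tuple mesym n.+1 K i.+1 | i < n.+1]) * D == 0; last first.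
    by rewrite mulf_eq0 (negPf D0) orbF.
  apply/eqP/(meval_eq0 charK) => v; rewrite mevalM.
  case: (eqVneq D.@[v] 0) => [->|]; first by rewrite mulr0.
  rewrite DE mulf_eq0 negb_or => /andP[/prodf_neq0 v0 /prodf_neq0 vv].
  pose z : 'rV[K]_n.+1 := \row_i v i.
  have uz : diag_mx z \in unitmx.
    rewrite unitmxE unitfE det_diag; apply/prodf_neq0 => i _.
    by rewrite mxE; apply: v0.
  have uV : Vandermonde n.+1 z \in unitmx.
    rewrite unitmxE unitfE det_Vandermonde; apply/prodf_neq0 => i _.
    by under eq_bigr do rewrite !mxE; apply: vv.
  have [uC fC] := conj0 _ _ _ uz uV (vandermonde_companion z).
  have fz : f (diag_mx z) = 0 by apply: ftorus => i; rewrite mxE; apply: v0.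
  move: fC; rewrite fz fp // => /eqP; rewrite mulf_eq0 invr_eq0.
  rewrite (negPf (expf_neq0 _ (det_unit_neq0 uC))) orbF -qE => /eqP qz.
  rewrite comp_mpoly_meval (_ : q.@[_] = 0) ?mul0r // -[RHS]qz.
  apply: meval_eq => i; rewrite tnth_mktuple; apply: meval_eq => j.
  by rewrite mxE.
(* A matrix whose Krylov matrix is invertible is conjugate to a companion
   matrix; this holds off the zero set of [kr]. *)
have [kr krE] := krylov_num n.
have kr0 : kr != 0.
  apply/eqP => e; have := krE (companion (fun _ => 0)).
  by rewrite krylov_of_companion det1 e meval0 => /esym/eqP; rewrite oner_eq0.
suff p0 : p = 0 by move=> g ug; rewrite fp // p0 meval0 mul0r.
apply/eqP; have : p * (kr * det_mpoly n.+1 K) == 0; last first.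
  by rewrite !mulf_eq0 (negPf kr0) (negPf (det_mpoly_neq0 _ _)) !orbF.
apply/eqP/(meval_eq0 charK) => v; pose g : 'M[K]_n.+1 := vec_mx (\row_i v i).
have gv : mxvec g 0 =1 v by move=> i; rewrite /g vec_mxK mxE.
rewrite -(meval_eq _ gv) !mevalM krE meval_det_mpoly.
case: (boolP (g \in unitmx)) => [ug|]; last first.
  by rewrite unitmxE unitfE negbK => /eqP ->; rewrite !mulr0.
case: (boolP (krylov (delta_mx 0 0) g \in unitmx)) => [uk|]; last first.
  by rewrite unitmxE unitfE negbK => /eqP ->; rewrite mul0r mulr0.
have [b be] := krylov_companion uk; have [uC fC] := conj0 _ _ _ ug uk be.
have : f g = 0 by rewrite -fC fp // -qE q0 meval0 mul0r.
rewrite fp // => /eqP; rewrite mulf_eq0 invr_eq0.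
by rewrite (negPf (expf_neq0 _ (det_unit_neq0 ug))) orbF => /eqP ->; rewrite mul0r.
Qed.

End ClassFunction.

Theorem fixed_dim_of_character (K : fieldType) (charK : [pchar K] =i pred0) n m k
    (G : 'M[K]_n -> Prop) (rho : 'M[K]_n -> 'M[K]_m) (sigma : 'M[K]_n -> 'M[K]_k) h :
  (forall g, G g -> g \in unitmx) -> is_mxrep rho -> is_mxrep sigma ->
  (forall z : 'rV[K]_n, (forall i, z 0 i != 0) ->
     \tr (rho (diag_mx z)) = \tr (sigma (diag_mx z))) ->
  has_dim (mx_fixed G rho) h -> has_dim (mx_fixed G sigma) h.
Proof.
move=> Gu hr hs tr; have [|P [Q [PQ QP eP]]] := mxrep_iso charK hr hs.
  move=> g ug; apply/eqP; rewrite -subr_eq0; apply/eqP.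
  apply: (class_function_torus charK
    (f := fun g => \tr (rho g) - \tr (sigma g))) ug => [|g' g'' ug' ug''|z z0].
  - apply: (@regular_ext _ _ (fun g => \sum_i rho g i i + (-1) * \sum_i sigma g i i)).
      by move=> g' _; rewrite mulN1r.
    apply: regular_add; first by apply: regular_sum => i; apply: mxrep_regular.
    apply: regular_mul; first exact: regular_cst.
    by apply: regular_sum => i; apply: mxrep_regular.
  - have conj p (tau : 'M[K]_n -> 'M[K]_p) : is_mxrep tau ->
        \tr (tau (g'' *m g' *m invmx g'')) = \tr (tau g').
      move=> ht; rewrite !mxrepM ?unitmx_mul ?unitmx_inv ?ug'' // mxtrace_mulC mulmxA.
      by rewrite mxrep_invl // mul1mx.
    by rewrite !conj.
  by rewrite tr // subrr.
by apply: mx_fixed_iso PQ QP _ => g /Gu; apply: eP.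
Qed.

(** * Symmetric algebras as graded representations *)

Section Homogeneous.
Variables (K : fieldType) (m : nat).
Implicit Types (f g : {mpoly K[m]}) (w : 'I_m -> nat) (a : 'X_{1..m})
  (Q : pred 'X_{1..m}).

Definition wdeg w a : nat := (\sum_(i < m) a i * w i)%N.

Lemma wdegD w a b : wdeg w (a + b)%MM = (wdeg w a + wdeg w b)%N.
Proof. by rewrite -big_split; apply: eq_bigr => i _; rewrite mnmDE mulnDl. Qed.

Lemma wdeg0 w : wdeg w 0%MM = 0%N.
Proof. by rewrite /wdeg big1 // => i _; rewrite mnm0E. Qed.

Lemma wdeg1 w i : wdeg w U_(i)%MM = w i.
Proof.
rewrite /wdeg (bigD1 i) //= mnm1E eqxx mul1n big1 ?addn0 // => j /negPf.
by rewrite mnm1E eq_sym => ->.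
Qed.

Definition mpart (Q : pred 'X_{1..m}) f : {mpoly K[m]} :=
  \sum_(a <- msupp f | Q a) f@_a *: 'X_[a].

Lemma mcoeff_mpart Q f a : (mpart Q f)@_a = if Q a then f@_a else 0.
Proof.
rewrite raddf_sum /= big_mkcond /=.
under eq_bigr => b _ do rewrite mcoeffZ mcoeffX.
case: (boolP (a \in msupp f)) => af.
  rewrite (bigD1_seq a) ?msupp_uniq //= eqxx mulr1 big1 ?addr0 // => b /negPf ->.
  by rewrite mulr0 if_same.
rewrite memN_msupp_eq0 // if_same big_seq big1 // => b bf; case: ifP => // _.
by case: eqP => [e|]; rewrite ?mulr0 //; rewrite -e bf in af.
Qed.

Lemma mpart_linear Q : linear (mpart Q).
Proof.
move=> c f g; apply/mpolyP => a; rewrite mcoeffD mcoeffZ !mcoeff_mpart mcoeffD mcoeffZ.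
by case: ifP => // _; rewrite mulr0 addr0.
Qed.

Lemma mpart_sum Q (I : Type) (r : seq I) (F : I -> {mpoly K[m]}) :
  mpart Q (\sum_(i <- r) F i) = \sum_(i <- r) mpart Q (F i).
Proof.
have := linear_comb r (fun=> 1) F (@mpart_linear Q).
under eq_bigr do rewrite scale1r; move=> ->.
by apply: eq_bigr => i _; rewrite scale1r.
Qed.

Lemma msupp_mpart Q f a : a \in msupp (mpart Q f) -> Q a /\ a \in msupp f.
Proof. by rewrite !mcoeff_msupp mcoeff_mpart; case: ifP => // _; rewrite eqxx. Qed.

Lemma mpart_id Q f : (forall a, a \in msupp f -> Q a) -> mpart Q f = f.
Proof.
move=> h; apply/mpolyP => a; rewrite mcoeff_mpart.
case: ifP => // /negP nQ; rewrite memN_msupp_eq0 //; by apply/negP => /h.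
Qed.

Lemma mpart_eq0 Q f : (forall a, a \in msupp f -> ~~ Q a) -> mpart Q f = 0.
Proof.
move=> h; apply/mpolyP => a; rewrite mcoeff_mpart mcoeff0.
case: ifP => // Qa; rewrite memN_msupp_eq0 //; by apply/negP => /h; rewrite Qa.
Qed.

Definition hpart w d := mpart (fun a => wdeg w a == d).

Lemma hpart_sum w d (I : Type) (r : seq I) (F : I -> {mpoly K[m]}) :
  hpart w d (\sum_(i <- r) F i) = \sum_(i <- r) hpart w d (F i).
Proof. exact: mpart_sum. Qed.

Lemma sym_homog_hpart w d f : sym_homog w d (hpart w d f).
Proof. by move=> a /msupp_mpart[/eqP]. Qed.

Lemma sym_homog_mpart w d Q f : sym_homog w d f -> sym_homog w d (mpart Q f).
Proof. by move=> h a /msupp_mpart[_ /h]. Qed.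

Lemma hpart_homog w d e f : sym_homog w e f ->
  hpart w d f = if e == d then f else 0.
Proof.
move=> h; case: eqP => [<-|ne]; first by apply: mpart_id => a /h /eqP.
by apply: mpart_eq0 => a /h ea; apply/eqP => e'; apply: ne; rewrite -ea.
Qed.

Lemma sum_hpart w f N : (forall a, a \in msupp f -> (wdeg w a < N)%N) ->
  f = \sum_(d < N) hpart w d f.
Proof.
move=> h; apply/mpolyP => a; rewrite raddf_sum /=.
under eq_bigr do rewrite mcoeff_mpart.
case: (boolP (a \in msupp f)) => [af|/memN_msupp_eq0 ->]; last by rewrite big1 // => i _; rewrite if_same.
rewrite (bigD1 (Ordinal (h a af))) //= eqxx big1 ?addr0 // => i.
by rewrite -val_eqE eq_sym /= => /negPf ->.
Qed.

Lemma wdeg_bound w f : exists N, forall a, a \in msupp f -> (wdeg w a < N)%N.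
Proof.
exists (\max_(a <- msupp f) wdeg w a).+1 => a af.
by rewrite ltnS (big_rem a) //= leq_maxl.
Qed.

Lemma sym_homog0 w d : sym_homog w d (0 : {mpoly K[m]}).
Proof. by move=> a; rewrite msupp0. Qed.

Lemma sym_homogD w d f g : sym_homog w d f -> sym_homog w d g -> sym_homog w d (f + g).
Proof. by move=> hf hg a /msuppD_le; rewrite mem_cat => /orP[/hf|/hg]. Qed.

Lemma sym_homogZ w d c f : sym_homog w d f -> sym_homog w d (c *: f).
Proof. by move=> hf a /msuppZ_le /hf. Qed.

Lemma sym_homog_sum w d (I : Type) (r : seq I) (F : I -> {mpoly K[m]}) :
  (forall i, sym_homog w d (F i)) -> sym_homog w d (\sum_(i <- r) F i).
Proof.
move=> h; elim: r => [|i r IH]; first by rewrite big_nil; apply: sym_homog0.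
by rewrite big_cons; apply: sym_homogD.
Qed.

Lemma sym_homogM w d e f g : sym_homog w d f -> sym_homog w e g ->
  sym_homog w (d + e)%N (f * g).
Proof.
move=> hf hg a /msuppM_le /allpairsP[[b c] /= [bf cg ->]].
by rewrite -/(wdeg w _) wdegD; congr (_ + _)%N; [apply: hf | apply: hg].
Qed.

Lemma sym_homogX w a : sym_homog w (wdeg w a) ('X_[a] : {mpoly K[m]}).
Proof. by move=> b; rewrite msuppX inE => /eqP ->. Qed.

Lemma sym_homogC w c : sym_homog w 0 (c%:MP : {mpoly K[m]}).
Proof.
by rewrite -alg_mpolyC -mpolyX0 -(wdeg0 w); apply: sym_homogZ; apply: sym_homogX.
Qed.

Lemma monomial_basis (s : seq 'X_{1..m}) : uniq s ->
  is_basis (fun f : {mpoly K[m]} => forall a, a \in msupp f -> a \in s)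
    (fun k : 'I_(size s) => 'X_[tnth (in_tuple s) k]).
Proof.
move=> us; have coef (c : 'I_(size s) -> K) k :
    (\sum_i c i *: 'X_[tnth (in_tuple s) i])@_(tnth (in_tuple s) k) = c k.
  rewrite raddf_sum /= (bigD1 k) //= mcoeffZ mcoeffX eqxx mulr1 big1 ?addr0 // => i ik.
  rewrite mcoeffZ mcoeffX; have -> : (tnth (in_tuple s) i == tnth (in_tuple s) k) = false.
    apply/negbTE; apply: contra ik; rewrite !(tnth_nth 0%MM) nth_uniq //.
  by rewrite mulr0.
split=> [c c0 k|f]; first by rewrite -coef c0 mcoeff0.
split=> [fs|[c ->] a].
  exists (fun k => f@_(tnth (in_tuple s) k)); apply/mpolyP => a.
  rewrite raddf_sum /=; under eq_bigr do rewrite mcoeffZ mcoeffX.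
  case: (boolP (a \in s)) => [/(tnthP (in_tuple s))[k ->]|nas].
    by rewrite -[LHS](coef (fun k => f@_(tnth (in_tuple s) k))) raddf_sum /=;
       apply: eq_bigr => i _; rewrite mcoeffZ mcoeffX.
  rewrite memN_msupp_eq0 ?big1 // => [i _|]; last by apply: contra nas => /fs.
  by case: eqP => [e|]; rewrite ?mulr0 //; rewrite -e mem_tnth in nas.
move/msupp_sum_le => /flatten_mapP[k _ /msuppZ_le].
by rewrite msuppX inE => /eqP ->; apply: mem_tnth.
Qed.

Definition monomials_of_weight w d : seq 'X_{1..m} :=
  [seq [multinom nth 0%N u i | i < m] | u <- weighted [seq w i | i <- enum 'I_m] d].

Lemma weight_of_wdeg w (u : seq nat) : size u = m ->
  weight_of [seq w i | i <- enum 'I_m] u = wdeg w [multinom nth 0%N u i | i < m].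
Proof.
move=> sa; rewrite /weight_of sumnE big_map /wdeg.
have sz : size (zip u [seq w i | i <- enum 'I_m]) = m.
  by rewrite size_zip size_map size_enum_ord sa minnn.
rewrite (big_nth (0%N, 0%N)) sz big_mkord; apply: eq_bigr => i _.
rewrite mnmE nth_zip; last by rewrite size_map size_enum_ord.
congr (_ * _)%N.
by rewrite (nth_map i) ?size_enum_ord // nth_ord_enum.
Qed.

Lemma mem_monomials_of_weight w d a : (forall i, 0 < w i)%N ->
  (a \in monomials_of_weight w d) = (wdeg w a == d).
Proof.
move=> w0; have ws0 : all (leq 1) [seq w i | i <- enum 'I_m].
  by apply/allP => x /mapP[i _ ->].
have sw : size [seq w i | i <- enum 'I_m] = m by rewrite size_map size_enum_ord.
apply/mapP/eqP => [[b]|da].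
  rewrite mem_weighted // sw => /andP[/eqP sb /eqP db] ->.
  by rewrite -weight_of_wdeg.
have ea : a = [multinom nth 0%N (val a) i | i < m].
  by apply/mnmP => i; rewrite mnmE (mnm_nth 0%N).
exists (tval (val a)) => //; rewrite mem_weighted // sw size_tuple eqxx /=.
by rewrite weight_of_wdeg ?size_tuple // -ea da.
Qed.

Lemma uniq_monomials_of_weight w d : (forall i, 0 < w i)%N ->
  uniq (monomials_of_weight w d).
Proof.
move=> w0; have ws0 : all (leq 1) [seq w i | i <- enum 'I_m].
  by apply/allP => x /mapP[i _ ->].
have sw : size [seq w i | i <- enum 'I_m] = m by rewrite size_map size_enum_ord.
rewrite map_inj_in_uniq ?uniq_weighted // => a b.
rewrite !mem_weighted // sw => /andP[/eqP sa _] /andP[/eqP sb _] /mnmP e.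
apply: (@eq_from_nth _ 0%N); rewrite sa ?sb // => i im.
by have := e (Ordinal im); rewrite !mnmE.
Qed.

Lemma finite_dim_homog w d : (forall i, 0 < w i)%N ->
  finite_dim (fun f : {mpoly K[m]} => sym_homog w d f).
Proof.
move=> w0; have [fr sp] := monomial_basis (uniq_monomials_of_weight d w0).
eexists; exists (fun k => 'X_[tnth (in_tuple (monomials_of_weight w d)) k]).
split=> // f; rewrite -sp; split=> h a /h.
  by move=> <-; rewrite mem_monomials_of_weight.
by rewrite mem_monomials_of_weight // => /eqP.
Qed.

End Homogeneous.

Definition respects (K : fieldType) m (w : 'I_m -> nat) (A : 'M[K]_m) : Prop :=
  forall i j, w i != w j -> A i j = 0.

Section HomogeneousSubstitution.
Variables (K : fieldType) (m r : nat) (w : 'I_m -> nat) (v : 'I_r -> nat).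
Variable x : r.-tuple {mpoly K[m]}.
Hypothesis xw : forall i, sym_homog w (v i) (tnth x i).
Implicit Types (f : {mpoly K[r]}).

Lemma sym_homog_comp d f : sym_homog v d f -> sym_homog w d (f \mPo x).
Proof.
move=> hf; have mono a : sym_homog w (wdeg v a) ('X_[a] \mPo x).
  move: {2}(mdeg a) (erefl (mdeg a)) => k; elim: k a => [|k IH] a.
    move/eqP; rewrite mdeg_eq0 => /eqP ->.
    by rewrite mpolyX0 comp_mpoly1 -mpolyC1 wdeg0; apply: sym_homogC.
  move=> da; have [i ai] : exists i, a i != 0%N.
    apply/existsP; rewrite -negb_forall; apply/negP => /forallP a0.
    by move: da; rewrite mdegE big1 // => i _; apply/eqP/a0.
  have ea : a = (U_(i) + (a - U_(i)))%MM by rewrite addmC submK // lep1mP.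
  rewrite {2}ea mpolyXD rmorphM {1}ea wdegD; apply: sym_homogM.
    by rewrite wdeg1 /= comp_mpolyXU -tnth_nth.
  by apply: IH; move: da; rewrite {1}ea mdegD mdeg1 => -[].
rewrite (mpolyE f) raddf_sum big_seq.
apply: (big_ind (sym_homog w d)) => [|p q|a af].
- exact: sym_homog0.
- exact: sym_homogD.
by rewrite /= comp_mpolyZ -(hf a af); apply/sym_homogZ/mono.
Qed.

Lemma hpart_comp d f : hpart w d (f \mPo x) = hpart v d f \mPo x.
Proof.
have [N hN] := wdeg_bound v f.
rewrite {1}(sum_hpart hN) raddf_sum hpart_sum /=.
have hp (e : nat) : hpart w d (hpart v e f \mPo x) =
    if e == d then hpart v e f \mPo x else 0.
  by apply/hpart_homog/sym_homog_comp; apply: sym_homog_hpart.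
rewrite (eq_bigr _ (fun (e : 'I_N) _ => hp e)).
case: (ltnP d N) => [dN|Nd].
  rewrite (bigD1 (Ordinal dN)) //= eqxx big1 ?addr0 // => i.
  by rewrite -val_eqE /= => /negPf ->.
rewrite big1 => [|i _]; last by rewrite ltn_eqF // (leq_trans _ Nd).
suff -> : hpart v d f = 0 by rewrite raddf0.
by apply: mpart_eq0 => a /hN aN; rewrite ltn_eqF // (leq_trans aN).
Qed.

End HomogeneousSubstitution.

Section HomogeneousAction.
Variables (K : fieldType) (m : nat) (w : 'I_m -> nat) (A : 'M[K]_m).
Hypothesis rA : respects w A.

Lemma sym_act_tuple_homog i :
  sym_homog w (w i) (tnth [tuple \sum_(i < m) A i j *: ('X_i : {mpoly K[m]}) | j < m] i).
Proof.
rewrite tnth_mktuple; apply: sym_homog_sum => j.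
case: (eqVneq (w j) (w i)) => [<-|/rA ->]; last by rewrite scale0r; apply: sym_homog0.
by apply: sym_homogZ; rewrite -[w j]wdeg1; apply: sym_homogX.
Qed.

Lemma sym_homog_act d f : sym_homog w d f -> sym_homog w d (sym_act A f).
Proof. exact/sym_homog_comp/sym_act_tuple_homog. Qed.

Lemma hpart_act d f : hpart w d (sym_act A f) = sym_act A (hpart w d f).
Proof. exact/hpart_comp/sym_act_tuple_homog. Qed.

End HomogeneousAction.

Section GradedRep.
Variables (K : fieldType) (n m : nat) (A : 'M[K]_n -> 'M[K]_m) (w : 'I_m -> nat).
Hypothesis repA : is_mxrep A.

Lemma regular_mcoeff_sym_act (f : {mpoly K[m]}) a :
  regular_fun (fun g => (sym_act (A g) f)@_a).
Proof.
elim/mpoly_ind_alg: f a => [c|p q hp hq|p q hp hq|i] a.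
- by apply: (regular_ext _ (@regular_cst K n (c%:MP@_a))) => g _; rewrite sym_actC.
- by apply: (regular_ext _ (regular_add (hp a) (hq a))) => g _; rewrite sym_actD mcoeffD.
- pose r := [seq k : 'X_{1..m < (mdeg a).+1, (mdeg a).+1} <- index_enum _ |
     a == (k.1 + k.2)%MM].
  apply: (@regular_ext _ _ (fun g => \sum_(k <- r)
      (sym_act (A g) p)@_k.1 * (sym_act (A g) q)@_k.2)).
    by move=> g _; rewrite sym_actM mcoeffM big_filter.
  by apply: regular_sum => k; apply: regular_mul.
apply: (@regular_ext _ _ (fun g => \sum_j A g j i * ('X_j : {mpoly K[m]})@_a)).
  by move=> g _; rewrite sym_actX raddf_sum; apply: eq_bigr => j _; rewrite /= mcoeffZ.
apply: regular_sum => j; apply: regular_mul; last exact: regular_cst.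
exact: mxrep_regular.
Qed.

(** A space with an equivariant embedding into [S(W)] is a rational
    representation: matrix coefficients are recovered from finitely many
    polynomial coefficients by a left inverse. *)
Section Embedding.
Variables (V : lmodType K) (act : 'M[K]_n -> V -> V) (iota : V -> {mpoly K[m]}).
Hypothesis iota_lin : linear iota.
Hypothesis iota_inj : injective iota.
Hypothesis iota_act : forall g v, g \in unitmx -> iota (act g v) = sym_act (A g) (iota v).

Lemma embedded_regular k (e : 'I_k -> V) (M : 'M[K]_n -> 'M[K]_k) : free_family e ->
  (forall g, g \in unitmx -> is_matrix_of (act g) e (M g)) ->
  forall i j, regular_fun (fun g => M g i j).
Proof.
move=> fe eM i j; pose s := undup (flatten [seq msupp (iota (e i)) | i <- enum 'I_k]).
have iota0 : iota 0 = 0.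
  by have := linear_comb [::] (fun=> 0) (fun _ : 'I_0 => 0) iota_lin; rewrite !big_nil.
(* Coordinates of the [e i] on all monomials that occur in them. *)
pose B := \matrix_(i < k, b < size s) (iota (e i))@_(tnth (in_tuple s) b).
have freeB : row_free B.
  apply: inj_row_free => v vB; apply/rowP => l; rewrite mxE.
  apply: (fe (v 0)); apply: iota_inj; rewrite iota0 linear_comb //.
  apply/mpolyP => a; rewrite mcoeff0 raddf_sum /=.
  case: (boolP (a \in s)) => [/(tnthP (in_tuple s))[b ->]|nas].
    transitivity ((v *m B) 0 b); last by rewrite vB mxE.
    by rewrite mxE; apply: eq_bigr => l' _; rewrite mcoeffZ mxE.
  rewrite big1 // => l' _; rewrite mcoeffZ memN_msupp_eq0 ?mulr0 //.
  apply: contra nas => ha; rewrite mem_undup; apply/flatten_mapP.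
  by exists l' => //; rewrite mem_enum.
have [R BR] := row_freeP freeB.
apply: (@regular_ext _ _ (fun g => \sum_b
    (sym_act (A g) (iota (e j)))@_(tnth (in_tuple s) b) * R b i)); last first.
  apply: regular_sum => b; apply: regular_mul; last exact: regular_cst.
  exact: regular_mcoeff_sym_act.
move=> g ug; have /rowP/(_ i) : row j ((M g)^T *m B *m R) = row j (M g)^T.
  by rewrite -mulmxA BR mulmx1.
rewrite !mxE => <-; apply: eq_bigr => b _; congr (_ * _).
rewrite mxE -iota_act // eM // linear_comb // raddf_sum /=.
by apply: eq_bigr => l _; rewrite mcoeffZ !mxE.
Qed.

Variable Vd : nat -> V -> Prop.
Hypothesis VdE : forall d v, Vd d v <-> sym_homog w d (iota v).
Hypothesis resA : forall g, g \in unitmx -> respects w (A g).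
Hypothesis w0 : forall i, (0 < w i)%N.
Hypothesis iota_hpart : forall d v, exists u, iota u = hpart w d (iota v).

Lemma embedded_grading : is_grading Vd.
Proof.
have iota0 : iota 0 = 0.
  by have := linear_comb [::] (fun=> 0) (fun _ : 'I_0 => 0) iota_lin; rewrite !big_nil.
have iota_sum N (u : nat -> V) : iota (\sum_(d < N) u d) = \sum_(d < N) iota (u d).
  have := linear_comb (index_enum 'I_N) (fun=> 1) (fun d : 'I_N => u d) iota_lin.
  under eq_bigr do rewrite scale1r; move=> ->.
  by apply: eq_bigr => d _; rewrite scale1r.
split.
- move=> d; split=> [|a u v]; first by apply/VdE; rewrite iota0; apply: sym_homog0.
  move=> /VdE hu /VdE hv; apply/VdE; rewrite iota_lin.
  by apply: sym_homogD => //; apply: sym_homogZ.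
- move=> v; have [N hN] := wdeg_bound w (iota v).
  have /functional_choice[u uP] d := iota_hpart d v.
  exists N, u; split=> [d|]; first by apply/VdE; rewrite uP; apply: sym_homog_hpart.
  apply: iota_inj; rewrite iota_sum {1}(sum_hpart hN).
  by apply: eq_bigr => d _; rewrite uP.
move=> N u hu u0 d dN; apply: iota_inj; rewrite iota0.
have := congr1 (hpart w d) (congr1 iota u0).
rewrite iota0 iota_sum hpart_sum (bigD1 (Ordinal dN)) //=.
rewrite (hpart_homog _ ((VdE _ _).1 (hu d))) eqxx big1 ?addr0 => [->|e ed].
  by apply: mpart_eq0 => a; rewrite msupp0.
rewrite (hpart_homog _ ((VdE _ _).1 (hu e))).
by move: ed; rewrite -val_eqE /= => /negPf ->.
Qed.

Lemma embedded_finite d : finite_dim (Vd d).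
Proof.
have iota0 : iota 0 = 0.
  by have := linear_comb [::] (fun=> 0) (fun _ : 'I_0 => 0) iota_lin; rewrite !big_nil.
have [k hk] : finite_dim (fun f => sym_homog w d f /\ exists v, f = iota v).
  apply: (finite_dim_sub (@finite_dim_homog K _ _ d w0)) => [|v []//].
  split=> [|a u v [hu [u' eu]] [hv [v' ev]]].
    by split; [exact: sym_homog0 | exists 0; rewrite iota0].
  split; last by exists (a *: u' + v'); rewrite iota_lin eu ev.
  by apply: sym_homogD => //; apply: sym_homogZ.
exists k; apply: (has_dim_inj iota_lin iota_inj _ _ hk) => [v|u []//].
by rewrite VdE; split=> [h|[]//]; split=> //; exists v.
Qed.

Lemma embedded_invariant d : is_invariant act (Vd d).
Proof.
move=> g v ug /VdE hv; apply/VdE; rewrite iota_act //.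
by apply: sym_homog_act => //; apply: resA.
Qed.

Lemma embedded_rational : is_rational_rep act.
Proof.
split.
- by move=> g ug a u v; apply: iota_inj; rewrite iota_lin !iota_act // iota_lin sym_act_linear.
- by move=> v; apply: iota_inj; rewrite iota_act ?unitmx1 // mxrep1 // sym_act1.
- move=> g h v ug uh; have ugh : g *m h \in unitmx by rewrite unitmx_mul ug.
  apply: iota_inj; rewrite (iota_act _ ugh) (iota_act _ ug) (iota_act _ uh).
  by rewrite (mxrepM repA ug uh) sym_act_mulmx.
- move=> v; have [N [u [hu ->]]] := grading_span embedded_grading v.
  exists N, (fun i => u i); split=> // i; exists (Vd i).
  by split; [exact: embedded_finite | exact: embedded_invariant | exact: hu].
exact: embedded_regular.
Qed.

Lemma embedded_graded : is_graded_rep act Vd.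
Proof.
split; [exact: embedded_rational | exact: embedded_grading |
        exact: embedded_finite | exact: embedded_invariant].
Qed.

End Embedding.

End GradedRep.

Lemma mxrep_of_subspace (K : fieldType) n (V : lmodType K) (act : 'M[K]_n -> V -> V)
    (U : V -> Prop) m (e : 'I_m -> V) :
  is_rational_rep act -> is_invariant act U -> is_basis U e ->
  exists rho : 'M[K]_n -> 'M[K]_m, is_mxrep rho /\
    forall g, g \in unitmx -> is_matrix_of (act g) e (rho g).
Proof.
move=> ract inv be.
have /functional_choice[rho rhoP] g : exists M : 'M[K]_m,
    g \in unitmx -> is_matrix_of (act g) e M.
  case: (boolP (g \in unitmx)) => ug; last by exists 0.
  have /functional_choice[c cP] j : in_span e (act g (e j)).
    apply/be.2; apply: inv => //. exact: (is_basis_mem j be).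
  by exists (\matrix_(i, j) c j i) => _ j; rewrite cP; apply: eq_bigr => i _; rewrite mxE.
exists rho; split=> //; split.
- apply: (free_mx_inj be.1) => j; rewrite -(rhoP _ (unitmx1 _ _)) comb1.
  exact: rep_one ract _.
- move=> g h ug uh; have ugh : g *m h \in unitmx by rewrite unitmx_mul ug.
  apply: (free_mx_inj be.1) => j; rewrite -(rhoP _ ugh) (rep_mul ract) //.
  rewrite (rhoP _ uh) linear_comb; last exact: rep_linear ract _ ug.
  under eq_bigr do rewrite (rhoP _ ug).
  by rewrite comb_comp.
by apply: (rep_rational ract be.1) => g ug; apply: rhoP.
Qed.

(** * Finite generation of the invariants of a symmetric algebra *)

Section Generation.
Variables (K : fieldType) (m : nat).
Implicit Types (f g : {mpoly K[m]}) (s : seq {mpoly K[m]}).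

(** An inductive form of membership in a generated subalgebra, independent
    of any numbering of the generators. *)
Inductive gen_alg s : {mpoly K[m]} -> Prop :=
| gen_const c : gen_alg s c%:MP
| gen_mem x : x \in s -> gen_alg s x
| gen_add f g : gen_alg s f -> gen_alg s g -> gen_alg s (f + g)
| gen_mul f g : gen_alg s f -> gen_alg s g -> gen_alg s (f * g).

Lemma gen_sum s (I : Type) (r : seq I) (F : I -> {mpoly K[m]}) :
  (forall i, gen_alg s (F i)) -> gen_alg s (\sum_(i <- r) F i).
Proof.
move=> h; elim: r => [|i r IH]; last by rewrite big_cons; apply: gen_add.
by rewrite big_nil -mpolyC0; apply: gen_const.
Qed.

Lemma gen_trans s s' f : (forall x, x \in s -> gen_alg s' x) -> gen_alg s f -> gen_alg s' f.
Proof.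
move=> h; elim=> [c|x /h //|p q _ hp _ hq|p q _ hp _ hq].
- exact: gen_const.
- exact: gen_add.
exact: gen_mul.
Qed.

Lemma hpartM w d f g :
  hpart w d (f * g) = \sum_(c < d.+1) hpart w (d - c)%N f * hpart w c g.
Proof.
have [Nf hf] := wdeg_bound w f; have [Ng hg] := wdeg_bound w g.
pose N := (maxn (maxn Nf Ng) d.+1).
have hf' a : a \in msupp f -> (wdeg w a < N)%N.
  by move=> /hf h; rewrite (leq_trans h) // /N -maxnA leq_maxl.
have hg' a : a \in msupp g -> (wdeg w a < N)%N.
  by move=> /hg h; rewrite (leq_trans h) // /N maxnAC leq_maxr.
have dN : (d < N)%N by rewrite leq_maxr.
rewrite {1}(sum_hpart hf') {1}(sum_hpart hg') mulr_suml.
under eq_bigr do rewrite mulr_sumr.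
rewrite exchange_big hpart_sum /=.
have hE (c e : nat) : hpart w d (hpart w e f * hpart w c g) =
    if (e + c == d)%N then hpart w e f * hpart w c g else 0.
  by apply/hpart_homog/sym_homogM; apply: sym_homog_hpart.
rewrite (big_ord_widen N (fun c : nat => hpart w (d - c)%N f * hpart w c g)) // [RHS]big_mkcond.
apply: eq_bigr => c _; rewrite hpart_sum.
under eq_bigr do rewrite hE.
rewrite ltnS; case: leqP => [cd|dc].
  have lt' : (d - c < N)%N by rewrite (leq_ltn_trans (leq_subr _ _)).
  rewrite (bigD1 (Ordinal lt')) //= subnK // eqxx big1 ?addr0 // => e.
  rewrite -val_eqE /= => ne; case: eqP => // e'; case/eqP: ne.
  by rewrite -e' addnK.
by rewrite big1 // => e _; case: eqP => // e'; move: dc; rewrite -e' ltnNge leq_addl.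
Qed.

Lemma wdeg_eq0 (w : 'I_m -> nat) a : (forall i, 0 < w i)%N -> wdeg w a = 0%N -> a = 0%MM.
Proof.
move=> w0 /eqP; rewrite /wdeg sum_nat_eq0 => /forallP h.
apply/mnmP => i; rewrite mnm0E; have := h i; rewrite /= muln_eq0.
by rewrite eqn0Ngt [(w i == 0)%N]eqn0Ngt w0 orbF -eqn0Ngt => /eqP.
Qed.

Lemma hpart0E (w : 'I_m -> nat) f : (forall i, 0 < w i)%N -> hpart w 0 f = (f@_0)%:MP.
Proof.
move=> w0; apply/mpolyP => a; rewrite mcoeff_mpart mcoeffC.
case: eqP => [/(wdeg_eq0 w0) ->|h]; first by rewrite eqxx mulr1.
case: eqP => [ea|]; last by rewrite mulr0.
by case: h; rewrite ea wdeg0.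
Qed.

End Generation.

Section Augmentation.
Variables (K : fieldType) (m : nat).

Definition aug_pred : {pred {mpoly K[m]}} := [pred p : {mpoly K[m]} | p@_0%MM == 0].

Fact aug_submod : submod_closed aug_pred.
Proof.
split=> [|a u v]; rewrite !inE ?mcoeff0 // => /eqP hu /eqP hv.
by rewrite mcoeffD mcoeffZ hu hv mulr0 addr0.
Qed.

HB.instance Definition _ := GRing.isSubmodClosed.Build K {mpoly K[m]} aug_pred aug_submod.

(** The augmentation ideal of [S(W)], a member of the class of modules whose
    invariants are the invariants of positive degree. *)
Record aug := Aug { aug_val :> {mpoly K[m]}; aug_valP : aug_val \in aug_pred }.

HB.instance Definition _ := [isSub for aug_val].
HB.instance Definition _ := [Choice of aug by <:].
HB.instance Definition _ := [SubChoice_isSubLmodule of aug by <:].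

Lemma aug_val0 (y : aug) : (aug_val y)@_0 = 0.
Proof. by have := aug_valP y; rewrite inE => /eqP. Qed.

Lemma aug_mul_proof (f : {mpoly K[m]}) (y : aug) : f * aug_val y \in aug_pred.
Proof. by rewrite inE -[_@_0]/(mcoeff 0%MM _) rmorphM /= aug_val0 mulr0. Qed.

Lemma aug_act_proof (A : 'M[K]_m) (y : aug) : sym_act A (aug_val y) \in aug_pred.
Proof. by rewrite inE sym_act_mcoeff0 aug_val0. Qed.

Definition aug_mul f y := Aug (aug_mul_proof f y).
Definition aug_act A y := Aug (aug_act_proof A y).

Lemma aug_val_linear : linear aug_val.
Proof. by move=> a u v; exact: (linearP (\val : aug -> {mpoly K[m]})). Qed.

Lemma aug_valZ c y : aug_val (c *: y) = c *: aug_val y.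
Proof. exact: (linearZZ (\val : aug -> {mpoly K[m]})). Qed.

Lemma aug_valD y z : aug_val (y + z) = aug_val y + aug_val z.
Proof. by have := aug_val_linear 1 y z; rewrite !scale1r. Qed.

Lemma aug_val_sum (I : Type) (r : seq I) (F : I -> aug) :
  aug_val (\sum_(i <- r) F i) = \sum_(i <- r) aug_val (F i).
Proof.
have := linear_comb r (fun=> 1) F aug_val_linear.
under eq_bigr do rewrite scale1r; move=> ->.
by apply: eq_bigr => i _; rewrite scale1r.
Qed.

Lemma aug_generators (y : aug) : exists f : 'I_m -> {mpoly K[m]},
  aug_val y = \sum_i f i * 'X_i.
Proof.
suff h (p : {mpoly K[m]}) : exists c (f : 'I_m -> {mpoly K[m]}),
    p = c%:MP + \sum_i f i * 'X_i.
  have [c [f e]] := h (aug_val y); exists f.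
  have := aug_val0 y; rewrite e mcoeffD mcoeffC eqxx mulr1 raddf_sum /= big1.
    by rewrite addr0 => ->; rewrite mpolyC0 add0r.
  by move=> i _; rewrite -[_@_0]/(mcoeff 0%MM _) rmorphM /= mcoeffX mnm1_eq0 mulr0.
elim/mpoly_ind_mulX: p => [c|p q [c [f ->]] [c' [f' ->]]|i p _].
- by exists c, (fun=> 0); rewrite big1 ?addr0 // => i _; rewrite mul0r.
- exists (c + c'), (fun i => f i + f' i); rewrite mpolyCD addrACA -big_split.
  by congr (_ + _); apply: eq_bigr => i _; rewrite mulrDl.
exists 0, (fun j => if j == i then p else 0); rewrite mpolyC0 add0r.
rewrite (bigD1 i) //= eqxx mulrC big1 ?addr0 // => j /negPf ->.
by rewrite mul0r.
Qed.

End Augmentation.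

Section InvariantGenerators.
Variables (K : fieldType) (n m : nat) (G : 'M[K]_n -> Prop).
Variables (A : 'M[K]_n -> 'M[K]_m) (w : 'I_m -> nat).
Hypothesis Gunit : forall g, G g -> g \in unitmx.
Hypothesis repA : is_mxrep A.
Hypothesis w0 : forall i, (0 < w i)%N.
Hypothesis resA : forall g, g \in unitmx -> respects w (A g).
Implicit Types (f : {mpoly K[m]}) (s : seq {mpoly K[m]}).

Lemma sym_fixed_hpart (v : 'I_m -> nat) d f :
  (forall g, g \in unitmx -> respects v (A g)) ->
  sym_fixed G A f -> sym_fixed G A (hpart v d f).
Proof. by move=> rv h g Gg; rewrite -hpart_act ?h //; apply/rv/Gunit. Qed.

Definition finitely_generated_invariants : Prop :=
  exists s, (forall x, x \in s -> sym_fixed G A x) /\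
    forall f, sym_fixed G A f -> gen_alg s f.

Lemma generators_of_algebras : invariant_algebras_fin_gen G -> finitely_generated_invariants.
Proof.
move=> condG; pose act g (f : {mpoly K[m]}) := sym_act (A g) f.
have idlin : linear (id : {mpoly K[m]} -> {mpoly K[m]}) by [].
have idhp d (v : {mpoly K[m]}) : exists u, id u = hpart w d (id v) by exists (hpart w d v).
have grR : is_graded_GL_algebra act (fun d f => sym_homog w d f).
  split.
  - by apply: (@embedded_rational K n m A w repA _ act id idlin (fun _ _ h => h) _ (fun d f => sym_homog w d f)).
  - by move=> g _; rewrite /act -mpolyC1 sym_actC.
  - by move=> g x y _; exact: sym_actM.
  - exact: (@embedded_grading K m w _ id).
  - by rewrite -mpolyC1; apply: sym_homogC.
  - by move=> i j x y; apply: sym_homogM.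
  by move=> d g v ug; apply: sym_homog_act; apply: resA.
have [|r [x [xfix xgen]]] := condG _ _ _ grR.
  exists m, (fun i => 'X_i); split=> // y _; exists y.
  elim/mpoly_ind_alg: y => [c|p q hp hq|p q hp hq|i].
  - by rewrite mmapC /= alg_mpolyC.
  - by rewrite mmapD -hp -hq.
  - by rewrite rmorphM /= -hp -hq.
  by rewrite mmapX mmap1U.
exists (codom x); split=> [_ /codomP[i ->] g Gg|f hf]; first exact: xfix.
have [p ->] := xgen f hf.
elim/mpoly_ind_alg: p => [c|p q hp hq|p q hp hq|i].
- by rewrite mmapC /= alg_mpolyC; apply: gen_const.
- by rewrite mmapD; apply: gen_add.
- by rewrite rmorphM /=; apply: gen_mul.
by rewrite mmapX mmap1U; apply/gen_mem/codom_f.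
Qed.

(** Hilbert's argument: generators of the module of invariants of positive
    degree generate the algebra of invariants, by induction on the degree. *)
Lemma generators_of_modules : invariant_modules_fin_gen G -> finitely_generated_invariants.
Proof.
move=> condG.
pose iW (v : 'cV[K]_m) : {mpoly K[m]} := \sum_i v i 0 *: 'X_i.
have coefW v i : (iW v)@_U_(i) = v i 0.
  rewrite raddf_sum /= (bigD1 i) //= mcoeffZ mcoeffXU eqxx mulr1 big1 ?addr0 // => j ji.
  by rewrite mcoeffZ mcoeffXU (negPf ji) mulr0.
have linW : linear iW.
  move=> a u v; rewrite /iW scaler_sumr -big_split; apply: eq_bigr => i _ /=.
  by rewrite !mxE scalerDl scalerA.
have injW : injective iW by move=> u v e; apply/colP => i; rewrite -!coefW e.
have iWX j : iW (delta_mx j 0) = 'X_j.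
  rewrite /iW (bigD1 j) //= mxE !eqxx scale1r big1 ?addr0 // => i /negPf ij.
  by rewrite mxE ij scale0r.
pose actW g (v : 'cV[K]_m) := A g *m v.
have eqW g v : g \in unitmx -> iW (actW g v) = sym_act (A g) (iW v).
  move=> _; rewrite sym_act_sum; under [RHS]eq_bigr do rewrite sym_actZ sym_actX scaler_sumr.
  rewrite exchange_big; apply: eq_bigr => i _ /=; rewrite mxE scaler_suml.
  by apply: eq_bigr => j _; rewrite scalerA mulrC.
have hpW d v : exists u, iW u = hpart w d (iW v).
  exists (\col_i if w i == d then v i 0 else 0); apply/mpolyP => a.
  rewrite mcoeff_mpart; case: (eqVneq (mdeg a) 1%N) => [/eqP/mdeg1P[i /eqP ->]|a1].
    by rewrite !coefW wdeg1 mxE.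
  have z u : (iW u)@_a = 0.
    rewrite raddf_sum big1 // => i _; rewrite /= mcoeffZ mcoeffX.
    by case: eqP => [e|]; rewrite ?mulr0 //; rewrite -e mdeg1 in a1.
  by rewrite !z if_same.
have grW : is_graded_rep actW (fun d v => sym_homog w d (iW v)).
  by apply: (@embedded_graded K n m A w repA _ actW iW).
have frW : is_homogeneous_frame actW (fun d v => sym_homog w d (iW v))
    (fun j => delta_mx j 0) w A.
  split=> [|j|g _ j].
  - split=> [c c0 i|v].
      have := congr1 (fun v : 'cV[K]_m => v i 0) c0.
      rewrite summxE (bigD1 i) //= !mxE !eqxx mulr1 big1 ?addr0 // => j /negPf ji.
      by rewrite !mxE eq_sym ji mulr0.
    split=> // _; exists (fun i => v i 0); apply/colP => i.
    rewrite summxE (bigD1 i) //= !mxE !eqxx mulr1 big1 ?addr0 // => j /negPf ji.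
    by rewrite !mxE eq_sym ji mulr0.
  - by rewrite iWX -{1}(wdeg1 w j); apply: sym_homogX.
  apply/colP => i; rewrite /actW -colE mxE summxE (bigD1 i) //= !mxE !eqxx mulr1.
  by rewrite big1 ?addr0 // => k /negPf ki; rewrite !mxE eq_sym ki mulr0.
pose actY g (y : aug K m) := aug_act (A g) y.
have injY : injective (@aug_val K m) by apply: val_inj.
have clY : in_class_C w A actY (fun d y => sym_homog w d (aug_val y)) (@aug_mul K m).
  split.
  - apply: (@embedded_graded K n m A w repA _ actY (@aug_val K m) _ injY) => //.
    move=> d y; have h : hpart w d (aug_val y) \in @aug_pred K m.
      by rewrite inE mcoeff_mpart aug_val0 if_same.
    by exists (Aug h).
  - by move=> c y; apply: injY; rewrite aug_valZ /= mul_mpolyC.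
  - by move=> f g y; apply: injY; rewrite /= mulrA.
  - by move=> f g y; apply: injY; rewrite aug_valD /= mulrDl.
  - move=> f y z; apply: injY; rewrite [RHS]aug_valD.
    rewrite -[LHS]/(f * aug_val (y + z)) -[RHS]/(f * aug_val y + f * aug_val z).
    by rewrite aug_valD mulrDr.
  - by move=> i j f y hf hy; apply: sym_homogM.
  - have h i : 'X_i \in @aug_pred K m by rewrite inE mcoeffX mnm1_eq0.
    exists m, (fun i => Aug (h i)) => y; have [f fE] := aug_generators y; exists f.
    by apply: injY; rewrite fE aug_val_sum.
  by move=> g f y ug; apply: injY; rewrite /= sym_actM.
have [r [y [yfix ygen]]] := condG _ _ _ _ _ _ _ grW frW _ _ _ _ clY.
have yfix' i : sym_fixed G A (aug_val (y i)).
  by move=> g Gg; have := congr1 (@aug_val K m) (yfix i g Gg).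
have [N NP] : exists N, forall i a, a \in msupp (aug_val (y i)) -> (wdeg w a < N)%N.
  have /functional_choice[N NP] i := wdeg_bound w (aug_val (y i)).
  exists (\max_i N i)%N => i a /NP h; apply: (leq_trans h).
  exact: (leq_bigmax (F := N)).
(* The homogeneous parts of the module generators. *)
pose s := [seq hpart w c (aug_val (y i)) | i <- enum 'I_r, c <- iota 0 N].
have smem i c : gen_alg s (hpart w c (aug_val (y i))).
  case: (ltnP c N) => [cN|Nc].
    by apply/gen_mem/allpairsP; exists (i, c); rewrite /= mem_enum mem_iota add0n cN.
  suff -> : hpart w c (aug_val (y i)) = 0 by rewrite -mpolyC0; apply: gen_const.
  by apply: mpart_eq0 => a /NP aN; rewrite ltn_eqF // (leq_trans aN).
exists s; split.
  by move=> x /allpairsP[[i c] /= [_ _ ->]]; apply: sym_fixed_hpart.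
have gen_hom d f : sym_homog w d f -> sym_fixed G A f -> gen_alg s f.
  elim/ltn_ind: d f => d IH f hf ff.
  have ed : f = hpart w d f by rewrite (hpart_homog _ hf) eqxx.
  case: (posnP d) => [d0|d0].
    by rewrite ed d0 hpart0E //; apply: gen_const.
  have f0 : f \in @aug_pred K m.
    rewrite inE; apply/eqP; rewrite ed mcoeff_mpart wdeg0.
    by rewrite ltn_eqF.
  have [|c [cfix cE]] := ygen (Aug f0).
    by move=> g Gg; apply: injY; apply: ff.
  have {cE} fE : f = \sum_i c i * aug_val (y i).
    by have := congr1 (@aug_val K m) cE; rewrite [LHS]/= => ->; rewrite aug_val_sum.
  rewrite ed fE.
  rewrite hpart_sum; apply: gen_sum => i; rewrite hpartM; apply: gen_sum => -[e ed'] /=.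
  (* The module generators have no part of degree zero, so the coefficients
     have degree less than [d]. *)
  case: (posnP e) => [->|e0].
    rewrite (hpart0E _ w0) aug_val0 mpolyC0 mulr0 -mpolyC0; exact: gen_const.
  apply: gen_mul; last exact: smem.
  apply: (IH (d - e)%N).
  - by rewrite ltn_subrL e0.
  - exact: sym_homog_hpart.
  exact: sym_fixed_hpart.
move=> f ff; have [N' hN'] := wdeg_bound w f; rewrite (sum_hpart hN').
apply: gen_sum => d; apply: gen_hom; first exact: sym_homog_hpart.
exact: sym_fixed_hpart.
Qed.

End InvariantGenerators.

(** * Hilbert series of bigraded invariants *)

Definition asbool (P : Prop) : bool := if excluded_middle_informative P then true else false.

Lemma asboolP (P : Prop) : reflect P (asbool P).
Proof. by rewrite /asbool; case: excluded_middle_informative => h; constructor. Qed.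

Section StandardMonomials.
Variables (K : fieldType) (m r : nat) (x : r.-tuple {mpoly K[m]}).
Variables (w s : 'I_m -> nat) (D E : 'I_r -> nat).
Hypothesis xw : forall i, sym_homog w (D i) (tnth x i).
Hypothesis xs : forall i, sym_homog s (E i) (tnth x i).
Hypothesis D0 : forall i, (0 < D i)%N.
Implicit Types (p q : {mpoly K[r]}) (a b : 'X_{1..r}).

(** The exponents of the initial ideal of the relations among the [x]. The
    relations are required to be bihomogeneous so that the reduction below
    stays within one bidegree. *)
Definition leading_relation a : Prop := exists p,
  [/\ p != 0, p \mPo x = 0, sym_homog D (wdeg D a) p, sym_homog E (wdeg E a) p & mlead p = a].

Lemma leading_relation_up a b : leading_relation a -> leading_relation (a + b)%MM.
Proof.
move=> [p [p0 px hD hE pa]]; exists (p * 'X_[b]).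
have X0 : 'X_[b] != 0 :> {mpoly K[r]}.
  by apply/eqP => /(congr1 (mcoeff b)); rewrite mcoeffX eqxx mcoeff0 => /eqP; rewrite oner_eq0.
split.
- by rewrite mulf_neq0.
- by rewrite rmorphM /= px mul0r.
- by rewrite wdegD; apply: sym_homogM => //; apply: sym_homogX.
- by rewrite wdegD; apply: sym_homogM => //; apply: sym_homogX.
by rewrite mleadM // mleadXm pa.
Qed.

Lemma mlead_drop p a : (forall b, b \in msupp p -> (b <= a)%O) -> p@_a = 0 ->
  p = 0 \/ (mlead p < a)%O.
Proof.
move=> h pa; case: (eqVneq p 0) => [|p0]; [by left | right].
have lp := mlead_supp p0; rewrite Order.POrderTheory.lt_neqAle h // andbT.
by apply/eqP => e; move: lp; rewrite e mcoeff_msupp pa eqxx.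
Qed.

(** Subtracting multiples of relations lowers the leading monomial until
    only monomials that lead no relation remain. *)
Lemma standard_reduction d e p : sym_homog D d p -> sym_homog E e p ->
  exists q, [/\ q \mPo x = p \mPo x, sym_homog D d q, sym_homog E e q &
    forall a, a \in msupp q -> ~ leading_relation a].
Proof.
move: {2}(mlead p) (erefl (mlead p)) => a; elim/(well_founded_induction (@ltom_wf r)): a p.
move=> a IH p pa hD hE; case: (eqVneq p 0) => [->|p0].
  by exists 0; split=> [|||a']; rewrite ?msupp0 //; apply: sym_homog0.
have ap : a \in msupp p by rewrite -pa mlead_supp.
have da : wdeg D a = d by apply: hD.
have ea : wdeg E a = e by apply: hE.
have step p1 : (p1 = 0 \/ (mlead p1 < a)%O) -> sym_homog D d p1 -> sym_homog E e p1 ->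
    exists q, [/\ q \mPo x = p1 \mPo x, sym_homog D d q, sym_homog E e q &
      forall b, b \in msupp q -> ~ leading_relation b].
  case=> [->|lt1 h1 h2]; last exact: (IH _ lt1).
  by exists 0; split=> [|||b]; rewrite ?msupp0 //; apply: sym_homog0.
case: (classic (leading_relation a)) => [[q [q0 qx qD qE qa]]|nl].
  have qa0 : q@_a != 0 by rewrite -mcoeff_msupp -qa mlead_supp.
  have [|||q' [q'x q'D q'E q'l]] := step (p + (- (p@_a / q@_a)) *: q).
  - apply: mlead_drop; last by rewrite mcoeffD mcoeffZ mulNr divfK // subrr.
    move=> b /msuppD_le; rewrite mem_cat => /orP[|/msuppZ_le] /msupp_le_mlead.
      by rewrite pa.
    by rewrite qa.
  - by apply: sym_homogD => //; apply: sym_homogZ; rewrite -da.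
  - by apply: sym_homogD => //; apply: sym_homogZ; rewrite -ea.
  exists q'; split=> //; rewrite q'x comp_mpolyD comp_mpolyZ qx scaler0 addr0 //.
have hX1 : sym_homog D d ((- p@_a) *: 'X_[a]).
  by rewrite -da; apply/sym_homogZ/sym_homogX.
have hX2 : sym_homog E e ((- p@_a) *: 'X_[a]).
  by rewrite -ea; apply/sym_homogZ/sym_homogX.
have [|||q [qx qD qE ql]] := step (p + (- p@_a) *: 'X_[a]).
- apply: mlead_drop; last by rewrite mcoeffD mcoeffZ mcoeffX eqxx mulr1 subrr.
  move=> b /msuppD_le; rewrite mem_cat => /orP[/msupp_le_mlead|/msuppZ_le].
    by rewrite pa.
  by rewrite msuppX inE => /eqP ->.
- exact: sym_homogD.
- exact: sym_homogD.
exists (q + p@_a *: 'X_[a]); split.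
- by rewrite comp_mpolyD qx -comp_mpolyD scaleNr addrNK.
- by apply: sym_homogD => //; rewrite -da; apply/sym_homogZ/sym_homogX.
- by apply: sym_homogD => //; rewrite -ea; apply/sym_homogZ/sym_homogX.
move=> b /msuppD_le; rewrite mem_cat => /orP[/ql //|/msuppZ_le].
by rewrite msuppX inE => /eqP ->.
Qed.

Definition standard a : bool := ~~ asbool (leading_relation a).

Definition standard_list d e : seq 'X_{1..r} :=
  [seq a <- monomials_of_weight D d | (wdeg E a == e) && standard a].

(** Monomials that lead no relation are independent, because the leading
    monomial of a dependency would lead a relation; they span by reduction. *)
Lemma standard_dim (S : {mpoly K[m]} -> Prop) d e : is_subspace S ->
  (forall p, S (p \mPo x)) ->
  (forall f, S f -> exists p, f = p \mPo x) ->
  has_dim (fun f => [/\ sym_homog w d f, sym_homog s e f & S f]) (size (standard_list d e)).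
Proof.
move=> [S0 SD] Sx xS; set L := standard_list d e.
have uL : uniq L by apply/filter_uniq/uniq_monomials_of_weight.
have LE a : a \in L -> [/\ wdeg D a = d, wdeg E a = e & ~ leading_relation a].
  rewrite mem_filter mem_monomials_of_weight // => /andP[/andP[/eqP ? sa] /eqP ?].
  by split=> // /asboolP h; rewrite /standard h in sa.
have [fr sp] := @monomial_basis K _ _ uL.
pose e' (k : 'I_(size L)) : {mpoly K[r]} := 'X_[tnth (in_tuple L) k].
have comb c : \sum_k c k *: (e' k \mPo x) = (\sum_k c k *: e' k) \mPo x.
  by rewrite raddf_sum; apply: eq_bigr => k _; rewrite /= comp_mpolyZ.
exists (fun k => e' k \mPo x); split=> [c|f].
  rewrite comb => c0; apply: fr; apply/eqP/negPn/negP => p0.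
  set p := \sum_k _ in c0 p0.
  have pL : forall a, a \in msupp p -> a \in L by apply/sp; exists c.
  have [da ea] := LE _ (pL _ (mlead_supp p0)); apply; exists p; split=> // a /pL /LE[].
    by rewrite da.
  by rewrite ea.
split=> [[hw hs hS]|[c ->]].
  have [p fp] := xS f hS.
  have [||q [qx qD qE ql]] := @standard_reduction d e (hpart D d (hpart E e p)).
  - exact: sym_homog_hpart.
  - by apply: sym_homog_mpart; apply: sym_homog_hpart.
  have -> : f = q \mPo x.
    rewrite qx -(hpart_comp xw) -(hpart_comp xs) -fp.
    by rewrite (hpart_homog _ hs) eqxx (hpart_homog _ hw) eqxx.
  have /sp[c ->] : forall a, a \in msupp q -> a \in L.
    move=> a aq; rewrite mem_filter mem_monomials_of_weight //.
    rewrite [wdeg D a](qD _ aq) [wdeg E a](qE _ aq) !eqxx andbT /=.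
    by apply/negP => /asboolP; apply: ql.
  by exists c; rewrite comb.
have cL : forall a, a \in msupp (\sum_k c k *: e' k) -> a \in L by apply/sp; exists c.
rewrite comb; split=> //.
  by apply: (sym_homog_comp xw) => a /cL /LE[].
by apply: (sym_homog_comp xs) => a /cL /LE[].
Qed.

(** The monomials with second degree exactly [e] are those with second
    degree at most [e] without those of smaller second degree, and both sets
    are down-closed. *)
Lemma rational_standard e : rational_series (fun d => (size (standard_list d e))%:Z).
Proof.
pose mon (u : seq nat) := [multinom nth 0%N u i | i < r].
pose below (P : pred nat) := fun u : seq nat => P (wdeg E (mon u)) && standard (mon u).
pose ws := [seq D i | i <- enum 'I_r].
have sw : size ws = r by rewrite size_map size_enum_ord.
have ws0 : all (leq 1) ws by apply/allP => y /mapP[i _ ->].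
have nth_all2 (u v : seq nat) i : all2 leq u v -> (nth 0 u i <= nth 0 v i)%N.
  by elim: u v i => [|c u IH] [|c' v] //= [|i] /andP[h1 h2] //=; apply: IH.
have down (P : pred nat) : (forall k l, (k <= l)%N -> P l -> P k) ->
    down_closed (size ws) (below P).
  move=> Pdown u v _ uv; have le i : (mon u i <= mon v i)%N by rewrite !mnmE nth_all2.
  case/andP=> hP hs; apply/andP; split.
    by apply: Pdown hP; apply: leq_sum => i _; rewrite leq_mul2r le orbT.
  apply: contra hs => /asboolP hu; apply/asboolP.
  have -> : mon v = (mon u + (mon v - mon u))%MM.
    by rewrite addmC submK //; apply/mnm_lepP.
  exact: leading_relation_up.
have r1 := rational_down_closed ws0 (down (fun k => (k <= e)%N) (fun k l => @leq_trans l k e)).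
have r2 := rational_down_closed ws0 (down (fun k => (k < e)%N) (fun k l => @leq_ltn_trans l k e)).
apply: rational_ext (rational_add r1 (rational_opp r2)) => d.
rewrite -sumrB size_filter /monomials_of_weight count_map -/ws.
elim: (weighted ws d) => [|u l IH]; first by rewrite big_nil.
rewrite big_cons IH /= PoszD; congr (_ + _).
rewrite /below -/(mon u); case: (standard _); rewrite ?andbF ?andbT //.
by rewrite leq_eqVlt; case: eqP => [->|_] /=; rewrite ?ltnn // subrr.
Qed.

End StandardMonomials.

Section BigradedInvariants.
Variables (K : fieldType) (n m : nat) (G : 'M[K]_n -> Prop).
Variables (A : 'M[K]_n -> 'M[K]_m) (w s : 'I_m -> nat).
Hypothesis Gunit : forall g, G g -> g \in unitmx.
Hypothesis w0 : forall i, (0 < w i)%N.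
Hypothesis resw : forall g, g \in unitmx -> respects w (A g).
Hypothesis ress : forall g, g \in unitmx -> respects s (A g).

Lemma sym_fixed_subspace : is_subspace (sym_fixed G A).
Proof.
split=> [g Gg|a u v hu hv g Gg]; first by rewrite -mpolyC0 sym_actC.
by rewrite sym_act_linear hu // hv.
Qed.

Lemma sym_fixed_comp r (x : r.-tuple {mpoly K[m]}) (p : {mpoly K[r]}) :
  (forall i, sym_fixed G A (tnth x i)) -> sym_fixed G A (p \mPo x).
Proof.
move=> hx g Gg; elim/mpoly_ind_alg: p => [c|p q hp hq|p q hp hq|i].
- by rewrite comp_mpolyC sym_actC.
- by rewrite comp_mpolyD sym_actD hp hq.
- by rewrite rmorphM /= sym_actM hp hq.
by rewrite comp_mpolyXU -tnth_nth hx.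
Qed.

Lemma gen_alg_comp r (x : r.-tuple {mpoly K[m]}) f :
  gen_alg x f -> exists p, f = p \mPo x.
Proof.
elim=> [c|y /tnthP[i ->]|p q _ [p' ->] _ [q' ->]|p q _ [p' ->] _ [q' ->]].
- by exists c%:MP; rewrite comp_mpolyC.
- by exists 'X_i; rewrite comp_mpolyXU -tnth_nth.
- by exists (p' + q'); rewrite comp_mpolyD.
by exists (p' * q'); rewrite rmorphM.
Qed.

Lemma wdeg_bound_seq (v : 'I_m -> nat) (l : seq {mpoly K[m]}) :
  exists N, forall f a, f \in l -> a \in msupp f -> (wdeg v a < N)%N.
Proof.
have /functional_choice[N NP] (f : {mpoly K[m]}) := wdeg_bound v f.
exists (\max_(f <- l) N f)%N => f a fl /NP h; apply: (leq_trans h).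
exact: leq_bigmax_seq.
Qed.

(** The bihomogeneous parts of the generators are again invariant and
    generate. Parts of degree zero for [w] are scalars, so generators of
    positive degree suffice and each bidegree contains finitely many
    monomials. *)
Theorem invariant_hilbert_series e : finitely_generated_invariants G A ->
  exists H : nat -> nat,
    (forall d, has_dim (fun f => [/\ sym_homog w d f, sym_homog s e f & sym_fixed G A f]) (H d)) /\
    rational_series (fun d => (H d)%:Z).
Proof.
move=> [l [lfix lgen]].
have [N NP] := wdeg_bound_seq w l; have [N' NP'] := wdeg_bound_seq s l.
pose parts (f : {mpoly K[m]}) := [seq (hpart w d (hpart s e f), (d, e)) | d <- iota 1 N, e <- iota 0 N'].
pose L : seq ({mpoly K[m]} * (nat * nat)) := flatten [seq parts f | f <- l].
have LP y : y \in L -> exists f, [/\ f \in l, (0 < y.2.1)%N &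
    y.1 = hpart w y.2.1 (hpart s y.2.2 f)].
  move=> /flatten_mapP[f fl /allpairsP[[d e'] /= [hd _ ->]]].
  by exists f; split=> //=; move: hd; rewrite mem_iota => /andP[].
pose x := [tuple (tnth (in_tuple L) i).1 | i < size L].
pose D i := (tnth (in_tuple L) i).2.1; pose E i := (tnth (in_tuple L) i).2.2.
have xP i := LP _ (mem_tnth i (in_tuple L)).
have xw i : sym_homog w (D i) (tnth x i).
  by rewrite tnth_mktuple; have [f [_ _ ->]] := xP i; apply: sym_homog_hpart.
have xs i : sym_homog s (E i) (tnth x i).
  rewrite tnth_mktuple; have [f [_ _ ->]] := xP i.
  by apply: sym_homog_mpart; apply: sym_homog_hpart.
have D0 i : (0 < D i)%N by have [f []] := xP i.
have xfix i : sym_fixed G A (tnth x i).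
  rewrite tnth_mktuple; have [f [fl _ ->]] := xP i.
  by do 2!apply: sym_fixed_hpart => //; apply: lfix.
have xgen f : sym_fixed G A f -> exists p, f = p \mPo x.
  move=> /lgen h; apply: gen_alg_comp; apply: gen_trans h => {}f fl.
  rewrite (sum_hpart (w := s) (fun a => NP' f a fl)); apply: gen_sum => e'.
  have hN a : a \in msupp (hpart s e' f) -> (wdeg w a < N.+1)%N.
    by move=> /msupp_mpart[_ /(NP _ _ fl)] /ltnW.
  rewrite (sum_hpart hN); apply: gen_sum => d.
  case: (posnP d) => [->|d0]; first by rewrite hpart0E //; apply: gen_const.
  apply: gen_mem; have /(tnthP (in_tuple L))[i iE] :
      (hpart w d (hpart s e' f), (d : nat, e' : nat)) \in L.
    apply/flatten_mapP; exists f => //; apply/allpairsP; exists (d : nat, e' : nat).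
    by rewrite /= !mem_iota d0 add1n ltn_ord add0n ltn_ord.
  by apply/tnthP; exists i; rewrite tnth_mktuple -iE.
exists (fun d => size (standard_list x D E d e)); split; last exact: rational_standard.
move=> d; apply: standard_dim => //; first exact: sym_fixed_subspace.
by move=> p; apply: sym_fixed_comp.
Qed.

End BigradedInvariants.

Record matrix_rep (K : fieldType) (n : nat) := MatrixRep {
  rep_dim : nat;
  rep_mx :> 'M[K]_n -> 'M[K]_rep_dim;
  rep_mxP : is_mxrep rep_mx
}.

Definition torus_char (K : fieldType) n (V : matrix_rep K n) (z : 'rV[K]_n) : K :=
  \tr (rep_mx V (diag_mx z)).

Section TensorSeries.
Variables (K : fieldType) (n m : nat) (G : 'M[K]_n -> Prop).
Hypothesis Gunit : forall g, G g -> g \in unitmx.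
Variables (A : 'M[K]_n -> 'M[K]_m) (w : 'I_m -> nat) (chi : 'I_m -> 'rV[K]_n -> K).
Hypothesis repA : is_mxrep A.
Hypothesis w0 : forall i, (0 < w i)%N.
Hypothesis resA : forall g, g \in unitmx -> respects w (A g).
Hypothesis torusA : forall z : 'rV[K]_n, (forall i, z 0 i != 0) ->
  A (diag_mx z) = diag_mx (\row_i chi i z).
Variable V : matrix_rep K n.

(** The trace of the torus on the homogeneous part of degree [d] of [S(W)]. *)
Definition sym_char d (z : 'rV[K]_n) : K :=
  \sum_(a <- monomials_of_weight w d) \prod_i chi i z ^+ a i.

Let v := rep_dim V.
Let B := rep_mx V.
Let AB g : 'M[K]_(m + v) := block_mx (A g) 0 0 (B g).
Let w2 (i : 'I_(m + v)) : nat := match split i with inl j => w j | inr _ => 1%N end.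
Let s2 (i : 'I_(m + v)) : nat := match split i with inl _ => 0%N | inr _ => 1%N end.

Let w2l i : w2 (lshift v i) = w i. Proof. by rewrite /w2 (unsplitK (inl _)). Qed.
Let w2r i : w2 (rshift m i) = 1%N. Proof. by rewrite /w2 (unsplitK (inr _)). Qed.
Let s2l i : s2 (lshift v i) = 0%N. Proof. by rewrite /s2 (unsplitK (inl _)). Qed.
Let s2r i : s2 (rshift m i) = 1%N. Proof. by rewrite /s2 (unsplitK (inr _)). Qed.

Let repAB : is_mxrep AB.
Proof. by apply: mxrep_block => //; apply: rep_mxP. Qed.

Let w20 i : (0 < w2 i)%N.
Proof. by case: (split_ordP i) => j ->; rewrite ?w2l ?w2r. Qed.

Let resw2 g : g \in unitmx -> respects w2 (AB g).
Proof.
move=> ug i j; case: (split_ordP i) => a ->; case: (split_ordP j) => b ->.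
- by rewrite !w2l block_mxEul; apply: resA.
- by rewrite block_mxEur mxE.
- by rewrite block_mxEdl mxE.
by rewrite !w2r eqxx.
Qed.

Let ress2 g : g \in unitmx -> respects s2 (AB g).
Proof.
move=> ug i j; case: (split_ordP i) => a ->; case: (split_ordP j) => b ->.
- by rewrite !s2l eqxx.
- by rewrite block_mxEur mxE.
- by rewrite block_mxEdl mxE.
by rewrite !s2r eqxx.
Qed.

Let pack (a : 'X_{1..m}) (j : 'I_v) : 'X_{1..(m + v)} :=
  [multinom match split i with inl i' => a i' | inr k => nat_of_bool (j == k) end | i < m + v].

Let packl a j i : pack a j (lshift v i) = a i.
Proof. by rewrite mnmE (unsplitK (inl _)). Qed.

Let packr a j k : pack a j (rshift m k) = (j == k).
Proof. by rewrite mnmE (unsplitK (inr _)). Qed.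

Let pack_inj a b j k : pack a j = pack b k -> a = b /\ j = k.
Proof.
move/mnmP => e; split; first by apply/mnmP => i; have := e (lshift v i); rewrite !packl.
by have := e (rshift m j); rewrite !packr eqxx; case: eqP.
Qed.

Let packs d : seq 'X_{1..(m + v)} :=
  [seq pack a j | a <- monomials_of_weight w d, j <- enum 'I_v].

Let mem_packs d b : (b \in packs d) = (wdeg w2 b == d.+1) && (wdeg s2 b == 1%N).
Proof.
have w2E (c : 'X_{1..(m + v)}) :
    wdeg w2 c = (wdeg w [multinom c (lshift v i) | i < m] + \sum_k c (rshift m k))%N.
  rewrite /wdeg big_split_ord /=; congr (_ + _)%N; apply: eq_bigr => i _.
    by rewrite mnmE w2l.
  by rewrite w2r muln1.
have s2E (c : 'X_{1..(m + v)}) : wdeg s2 c = (\sum_k c (rshift m k))%N.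
  rewrite /wdeg big_split_ord /= big1 => [|i _]; last by rewrite s2l muln0.
  by apply: eq_bigr => i _; rewrite s2r muln1.
apply/allpairsP/andP => [[[a j] /= [ha _ ->]]|[/eqP hw /eqP hs]].
  have sj : (\sum_k pack a j (rshift m k) = 1)%N.
    rewrite (bigD1 j) //= packr eqxx big1 // => k; rewrite packr eq_sym.
    by case: eqP.
  rewrite w2E s2E sj eqxx; split=> //.
  have -> : [multinom pack a j (lshift v i) | i < m] = a.
    by apply/mnmP => i; rewrite mnmE packl.
  by move: ha; rewrite mem_monomials_of_weight // addn1 eqSS.
rewrite w2E -s2E hs addn1 in hw; case: hw => hw.
have : mdeg [multinom b (rshift m k) | k < v] == 1%N.
  by rewrite mdegE -hs s2E; apply/eqP/eq_bigr => k _; rewrite mnmE.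
move=> /mdeg1P[j /eqP/mnmP ej].
exists ([multinom b (lshift v i) | i < m], j) => /=.
split; rewrite ?mem_enum ?mem_monomials_of_weight ?hw //.
apply/mnmP => i; case: (split_ordP i) => k ->; first by rewrite packl mnmE.
by rewrite packr; have := ej k; rewrite mnmE mnm1E.
Qed.

Let uniq_packs d : uniq (packs d).
Proof.
apply: allpairs_uniq; rewrite ?uniq_monomials_of_weight ?enum_uniq //.
by move=> [a j] [b k] _ _ /= /pack_inj[-> ->].
Qed.

Let torus_pack (z : 'rV[K]_n) a j : (forall i, z 0 i != 0) ->
  sym_act (AB (diag_mx z)) 'X_[pack a j] =
  (\prod_i chi i z ^+ a i) *: \sum_k B (diag_mx z) k j *: 'X_[pack a k].
Proof.
move=> z0; have XE k : 'X_[pack a k] =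
    (\prod_i 'X_(lshift v i) ^+ a i) * 'X_(rshift m k) :> {mpoly K[m + v]}.
  rewrite mpolyXE_id big_split_ord /=; congr (_ * _).
    by apply: eq_bigr => i _; rewrite packl.
  rewrite (bigD1 k) //= packr eqxx expr1 big1 ?mulr1 // => l.
  by rewrite packr eq_sym => /negPf ->; rewrite expr0.
rewrite XE sym_actM sym_act_prod.
have Xl i : sym_act (AB (diag_mx z)) 'X_(lshift v i) = chi i z *: 'X_(lshift v i).
  rewrite sym_actX big_split_ord /= [X in _ + X]big1 ?addr0 => [|k _]; last first.
    by rewrite block_mxEdl mxE scale0r.
  rewrite (bigD1 i) //= block_mxEul torusA // !mxE eqxx big1 ?addr0 // => k /negPf ki.
  by rewrite block_mxEul torusA // !mxE ki scale0r.
have -> : \prod_i sym_act (AB (diag_mx z)) ('X_(lshift v i) ^+ a i) =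
    (\prod_i chi i z ^+ a i) *: \prod_i 'X_(lshift v i) ^+ a i.
  rewrite -scaler_prod; apply: eq_bigr => i _.
  by rewrite sym_act_exp Xl exprZn.
rewrite sym_actX big_split_ord /= [X in X + _]big1 ?add0r => [|k _]; last first.
  by rewrite block_mxEur mxE scale0r.
rewrite -scalerAl mulr_sumr; congr (_ *: _); apply: eq_bigr => k _.
by rewrite block_mxEdr XE scalerAr.
Qed.

(** [T d] is the tensor product of [V] with the part of degree [d] of
    [S(W)]. It is realized as the part of bidegree [(d.+1, 1)] of [S(W +
    V)]: the first degree shifts by one because the elements of [V] are
    given weight one, to keep all weights positive, and the second degree
    counts the factors from [V]. *)
Lemma tensor_series :
  invariant_modules_fin_gen G \/ invariant_algebras_fin_gen G ->
  exists (T : nat -> matrix_rep K n) (H : nat -> nat),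
    [/\ forall d (z : 'rV[K]_n), (forall i, z 0 i != 0) ->
          torus_char (T d) z = torus_char V z * sym_char d z,
        forall d, has_dim (mx_fixed G (T d)) (H d)
      & rational_series (fun d => (H d)%:Z)].
Proof.
move=> condG; have fg : finitely_generated_invariants G AB.
  case: condG => condG.
    exact: (generators_of_modules Gunit repAB w20 resw2 condG).
  exact: (generators_of_algebras repAB w20 resw2 condG).
have [H [Hdim Hrat]] := invariant_hilbert_series Gunit w20 resw2 ress2 1 fg.
pose act g (f : {mpoly K[m + v]}) := sym_act (AB g) f.
pose U d (f : {mpoly K[m + v]}) := sym_homog w2 d.+1 f /\ sym_homog s2 1 f.
have ract : is_rational_rep act.
  apply: (@embedded_rational K n _ AB w2 repAB _ act id _ _ _ (fun d f => sym_homog w2 d f)) => //.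
  by move=> d f; exists (hpart w2 d f).
have inv d : is_invariant act (U d).
  by move=> g f ug [h1 h2]; split; apply: sym_homog_act => //; [apply: resw2|apply: ress2].
pose e d (k : 'I_(size (packs d))) : {mpoly K[m + v]} := 'X_[tnth (in_tuple (packs d)) k].
have be d : is_basis (U d) (e d).
  have [fr sp] := @monomial_basis K _ _ (uniq_packs d); split=> // f.
  rewrite -sp; split=> [[h1 h2] a af|h]; first by rewrite mem_packs [wdeg _ _]h1 // [wdeg _ _]h2 ?eqxx.
  by split=> a /h; rewrite mem_packs => /andP[/eqP h1 /eqP h2].
have /functional_choice[T TP] d : exists T : matrix_rep K n, (forall z : 'rV[K]_n, (forall i, z 0 i != 0) ->
      torus_char T z = torus_char V z * sym_char d z) /\
    has_dim (mx_fixed G T) (H d.+1).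
  have [rho [rrho erho]] := mxrep_of_subspace ract (inv d) (be d).
  exists (MatrixRep rrho); split=> [z z0|]; last first.
    apply: (mx_fixed_of_basis (act := act) _ (be d)).
    - by move=> g _; exact: sym_act_linear.
    - by move=> g /Gunit; apply: erho.
    have [b [fb sb]] := Hdim d.+1; exists b; split=> // f; rewrite -sb.
    by split=> [[[]]|[]].
  have uz : diag_mx z \in unitmx.
    by rewrite unitmxE unitfE det_diag; apply/prodf_neq0 => i _; apply: z0.
  have coef k : rho (diag_mx z) k k =
      (sym_act (AB (diag_mx z)) (e d k))@_(tnth (in_tuple (packs d)) k).
    have := erho _ uz k; rewrite /act => ->.
    rewrite raddf_sum /= (bigD1 k) //= mcoeffZ mcoeffX eqxx mulr1 big1 ?addr0 // => i ik.
    rewrite mcoeffZ mcoeffX; have -> : (tnth (in_tuple (packs d)) i == tnth (in_tuple (packs d)) k) = false.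
      by apply/negbTE; apply: contra ik; rewrite !(tnth_nth 0%MM) nth_uniq ?uniq_packs.
    by rewrite mulr0.
  rewrite /torus_char /= /mxtrace; under eq_bigr do rewrite coef /e.
  rewrite -(big_tuple _ _ (in_tuple (packs d)) xpredT
    (fun b => (sym_act (AB (diag_mx z)) 'X_[b])@_b)) /= /packs.
  rewrite big_allpairs_dep /sym_char mulr_sumr; apply: eq_bigr => a _.
  rewrite mulrC mulr_sumr big_enum /=; apply: eq_bigr => j _.
  rewrite torus_pack // mcoeffZ raddf_sum /= (bigD1 j) //= mcoeffZ mcoeffX eqxx mulr1.
  rewrite [X in _ + X]big1 ?addr0 // => k kj; rewrite mcoeffZ mcoeffX.
  by case: eqP => [/pack_inj[_ e']|]; rewrite ?mulr0 //; rewrite e' eqxx in kj.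
exists T, (fun d => H d.+1); split; [by move=> d; have [] := TP d | by move=> d; have [] := TP d |].
exact: (rational_behead Hrat).
Qed.

End TensorSeries.

(** * Virtual characters *)

Section SymmetricSeries.
Variables (K : fieldType).

Lemma weighted_series (cs : seq K) (ws : seq nat) d :
  size cs = size ws -> all (leq 1) ws ->
  fps_mul_poly (fun d => \sum_(u <- weighted ws d) \prod_(p <- zip cs u) p.1 ^+ p.2)
    (\prod_(p <- zip cs ws) (1 - p.1 *: 'X^(p.2))) d = (d == 0%N)%:R.
Proof.
elim: ws cs d => [|w ws IH] [|c cs] d //.
  by move=> _ _; rewrite big_nil fps_mul1 /weighted; case: d => [|d]; rewrite ?big_seq1 big_nil.
move=> [sz] ws0; have /andP[w0 ws0'] := ws0; rewrite /= big_cons -fps_mulA -(IH cs d sz ws0').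
apply: eq_fps_mul => i _; rewrite fps_mul_binomial [X in X - _]sum_weighted_cons //.
have -> : \sum_(a <- weighted ws i) \prod_(p <- zip (c :: cs) (0%N :: a)) p.1 ^+ p.2 =
    \sum_(a <- weighted ws i) \prod_(p <- zip cs a) p.1 ^+ p.2.
  by apply: eq_bigr => a _; rewrite /= big_cons expr0 mul1r.
case: ifP => _; last by rewrite addr0 subr0.
rewrite mulr_sumr; set X := \sum_(a <- weighted (w :: ws) _) _.
set Y := \sum_(a <- weighted (w :: ws) _) _.
suff -> : X = Y by rewrite addrK.
rewrite /X /Y !big_seq; apply: eq_bigr => -[|e a]; rewrite mem_weighted //= => _.
by rewrite !big_cons exprS mulrA.
Qed.

Variables (n m : nat) (w : 'I_m -> nat) (chi : 'I_m -> 'rV[K]_n -> K).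
Hypothesis w0 : forall i, (0 < w i)%N.

(** The inverse of the character series of [S(W)]. *)
Definition sym_denom (z : 'rV[K]_n) : {poly K} := \prod_i (1 - chi i z *: 'X^(w i)).

Lemma sym_char_series d z :
  fps_mul_poly (fun d => sym_char w chi d z) (sym_denom z) d = (d == 0%N)%:R.
Proof.
pose cs := [seq chi i z | i <- enum 'I_m]; pose ws := [seq w i | i <- enum 'I_m].
have sw : size ws = m by rewrite size_map size_enum_ord.
have sc : size cs = m by rewrite size_map size_enum_ord.
have ws0 : all (leq 1) ws by apply/allP => x /mapP[i _ ->].
rewrite -(@weighted_series cs ws) ?sw ?sc //.
have -> : sym_denom z = \prod_(p <- zip cs ws) (1 - p.1 *: 'X^(p.2)).
  by rewrite zip_map big_map big_enum.
apply: eq_fps_mul => i _; rewrite /sym_char big_map !big_seq; apply: eq_bigr => u.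
rewrite mem_weighted // sw => /andP[/eqP su _].
rewrite (big_nth (0, 0%N)) size_zip sc su minnn big_mkord; apply: eq_bigr => j _.
by rewrite nth_zip ?sc ?su //= mnmE (nth_map j) ?size_enum_ord // nth_ord_enum.
Qed.

Lemma sym_denom0 z : (sym_denom z)`_0 = 1.
Proof.
rewrite -horner_coef0 horner_prod big1 // => i _.
by rewrite !hornerE expr0n (gtn_eqF (w0 i)) mulr0 subr0.
Qed.

Lemma sym_char0 z : sym_char w chi 0 z = 1.
Proof.
have := sym_char_series 0 z; rewrite /fps_mul_poly big_ord1 subn0.
by rewrite sym_denom0 mulr1.
Qed.

Lemma sym_denom_rec j z : (0 < j)%N -> (sym_denom z)`_j =
  - \sum_(i < j) sym_char w chi i.+1 z * (sym_denom z)`_(j - i.+1).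
Proof.
move=> j0; have := sym_char_series j z.
rewrite /fps_mul_poly big_ord_recl subn0 sym_char0 mul1r gtn_eqF //.
by move/eqP; rewrite addr_eq0 => /eqP ->.
Qed.

End SymmetricSeries.

Section VirtualCharacters.
Variables (K : fieldType) (n : nat).
Implicit Types (V : matrix_rep K n) (phi psi : 'rV[K]_n -> K).

Definition rep_zero : matrix_rep K n := MatrixRep (mxrep_cst K n 0).
Definition rep_one : matrix_rep K n := MatrixRep (mxrep_cst K n 1).
Definition rep_add V V' : matrix_rep K n :=
  MatrixRep (mxrep_block (rep_mxP V) (rep_mxP V')).
Definition rep_mul V V' : matrix_rep K n :=
  MatrixRep (mxrep_tens (rep_mxP V) (rep_mxP V')).
Definition rep_sum (I : Type) (r : seq I) (F : I -> matrix_rep K n) : matrix_rep K n :=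
  foldr (fun i V => rep_add (F i) V) rep_zero r.

Lemma char_zero z : torus_char rep_zero z = 0.
Proof. by rewrite /torus_char /= mxtrace1. Qed.

Lemma char_one z : torus_char rep_one z = 1.
Proof. by rewrite /torus_char /= mxtrace1. Qed.

Lemma char_add V V' z : torus_char (rep_add V V') z = torus_char V z + torus_char V' z.
Proof. by rewrite /torus_char /= mxtrace_block. Qed.

Lemma char_mul V V' z : torus_char (rep_mul V V') z = torus_char V z * torus_char V' z.
Proof. exact: mxtrace_tens. Qed.

Lemma char_sum (I : Type) (r : seq I) (F : I -> matrix_rep K n) z :
  torus_char (rep_sum r F) z = \sum_(i <- r) torus_char (F i) z.
Proof.
elim: r => [|i r IH]; first by rewrite big_nil char_zero.
by rewrite big_cons /= char_add IH.
Qed.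

Lemma fixed_zero G : has_dim (mx_fixed G rep_zero) 0.
Proof.
exists (fun _ => 0); split=> [c _ []//|v]; split=> [_|_ g _].
  by exists (fun _ => 0); apply/colP => -[].
by rewrite mul1mx.
Qed.

Lemma fixed_sum G (I : Type) (r : seq I) (F : I -> matrix_rep K n) (H : I -> nat) :
  (forall i, has_dim (mx_fixed G (F i)) (H i)) ->
  has_dim (mx_fixed G (rep_sum r F)) (\sum_(i <- r) H i).
Proof.
move=> h; elim: r => [|i r IH]; first by rewrite big_nil; apply: fixed_zero.
by rewrite big_cons; apply: mx_fixed_block.
Qed.

Definition is_virtual phi : Prop := exists V V', forall z : 'rV[K]_n,
  (forall i, z 0 i != 0) -> phi z = torus_char V z - torus_char V' z.

Lemma virtual_ext phi psi : (forall z : 'rV[K]_n, (forall i, z 0 i != 0) -> phi z = psi z) ->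
  is_virtual phi -> is_virtual psi.
Proof. by move=> e [V [V' h]]; exists V, V' => z z0; rewrite -e // h. Qed.

Lemma virtual_char V : is_virtual (torus_char V).
Proof. by exists V, rep_zero => z _; rewrite char_zero subr0. Qed.

Lemma virtual_one : is_virtual (fun=> 1).
Proof. by exists rep_one, rep_zero => z _; rewrite char_one char_zero subr0. Qed.

Lemma virtual_zero : is_virtual (fun=> 0).
Proof. by exists rep_zero, rep_zero => z _; rewrite subrr. Qed.

Lemma virtual_add phi psi : is_virtual phi -> is_virtual psi ->
  is_virtual (fun z => phi z + psi z).
Proof.
move=> [V [V' h]] [U [U' h']]; exists (rep_add V U), (rep_add V' U') => z z0.
by rewrite h // h' // !char_add; ring.
Qed.

Lemma virtual_opp phi : is_virtual phi -> is_virtual (fun z => - phi z).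
Proof. by move=> [V [V' h]]; exists V', V => z z0; rewrite h // opprB. Qed.

Lemma virtual_mul phi psi : is_virtual phi -> is_virtual psi ->
  is_virtual (fun z => phi z * psi z).
Proof.
move=> [V [V' h]] [U [U' h']].
exists (rep_add (rep_mul V U) (rep_mul V' U')), (rep_add (rep_mul V U') (rep_mul V' U)).
by move=> z z0; rewrite h // h' // !char_add !char_mul; ring.
Qed.

Lemma virtual_sum (I : Type) (r : seq I) (F : I -> 'rV[K]_n -> K) :
  (forall i, is_virtual (F i)) -> is_virtual (fun z => \sum_(i <- r) F i z).
Proof.
move=> h; elim: r => [|i r IH].
  by apply: virtual_ext virtual_zero => z _; rewrite big_nil.
by apply: virtual_ext (virtual_add (h i) IH) => z _; rewrite big_cons.
Qed.

(** The coefficients are alternating sums of characters of exterior powers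
    of [W]; that they are virtual characters also follows from the recursion
    that expresses them through the symmetric powers. *)
Lemma virtual_sym_denom m (w : 'I_m -> nat) chi j : (forall i, 0 < w i)%N ->
  (forall d, is_virtual (sym_char w chi d)) ->
  is_virtual (fun z => (sym_denom w chi z)`_j).
Proof.
move=> w0 hs; elim/ltn_ind: j => j IH; case: (posnP j) => [->|j0].
  by apply: virtual_ext virtual_one => z _; rewrite sym_denom0.
apply: (@virtual_ext (fun z => - \sum_(i < j)
    sym_char w chi i.+1 z * (sym_denom w chi z)`_(j - i.+1))).
  by move=> z _; rewrite [RHS]sym_denom_rec.
apply/virtual_opp/virtual_sum => i; apply: virtual_mul; first exact: hs.
by apply: IH; rewrite ltn_subrL.
Qed.

End VirtualCharacters.

(** * Torus weights and evaluation of Laurent polynomials *)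

Section Weights.
Variables (K : fieldType) (n : nat).
Implicit Types (phi psi : 'rV[K]_n -> K).

(** Diagonality on the whole torus is included since it makes monomials in
    the basis vectors into weight vectors of the symmetric algebra. *)
Definition is_weight phi : Prop :=
  exists (V : matrix_rep K n) (c : 'I_(rep_dim V) -> 'rV[K]_n -> K) i,
    forall z : 'rV[K]_n, (forall i, z 0 i != 0) ->
      rep_mx V (diag_mx z) = diag_mx (\row_i c i z) /\ c i z = phi z.

Lemma weight_ext phi psi : (forall z : 'rV[K]_n, (forall i, z 0 i != 0) -> phi z = psi z) ->
  is_weight phi -> is_weight psi.
Proof.
move=> e [V [c [i h]]]; exists V, c, i => z z0.
by have [h1 h2] := h z z0; rewrite h1 h2 e.
Qed.

Lemma weight_one : is_weight (fun=> 1).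
Proof.
exists (rep_one K n), (fun _ _ => 1), ord0 => z _; split=> //.
by apply/matrixP => i j; rewrite !mxE !ord1.
Qed.

Lemma weight_mul phi psi : is_weight phi -> is_weight psi ->
  is_weight (fun z => phi z * psi z).
Proof.
move=> [V [c [i h]]] [U [e [j h']]].
pose ce x z := c (mxtens_unindex x).1 z * e (mxtens_unindex x).2 z.
have ceE a b z : ce (mxtens_index (a, b)) z = c a z * e b z.
  by rewrite /ce mxtens_indexK.
exists (rep_mul V U), ce, (mxtens_index (i, j)) => z z0.
have [h1 h2] := h z z0; have [h1' h2'] := h' z z0.
split; last by rewrite ceE h2 h2'.
rewrite /= h1 h1'; apply/matrixP => x y.
case: (mxtens_indexP x) => a b; case: (mxtens_indexP y) => a' b'.
rewrite tensmxE !mxE ceE (can_eq (@mxtens_indexK _ _)) xpair_eqE.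
by case: eqP => _; case: eqP => _; rewrite ?mulr0n ?mul0r ?mulr0 // !mulr1n.
Qed.

Lemma weight_coord i : is_weight (fun z => z 0 i).
Proof.
exists (MatrixRep (mxrep_standard K n)), (fun i z => z 0 i), i => z _; split=> //=.
by congr diag_mx; apply/rowP => j; rewrite mxE.
Qed.

Lemma weight_coordV i : is_weight (fun z => (z 0 i)^-1).
Proof.
exists (MatrixRep (mxrep_dual (mxrep_standard K n))), (fun i z => (z 0 i)^-1), i => z z0.
split=> //=; set y := \row_i _.
have zy : diag_mx z *m diag_mx y = 1%:M.
  rewrite mulmx_diag; apply/matrixP => a b; rewrite !mxE mulfV //.
have yz : diag_mx y *m diag_mx z = 1%:M.
  rewrite mulmx_diag; apply/matrixP => a b; rewrite !mxE mulVf //.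
have uz : diag_mx z \in unitmx by have [] := mulmx1_unit zy.
by rewrite -[invmx _]mul1mx -yz mulmxK // tr_diag_mx.
Qed.

(** Tensor products of the standard representation and its dual have all
    characters of the torus as weights. *)
Lemma weight_laurent (a : 'rV[int]_n) : is_weight (fun z => \prod_(i < n) z 0 i ^ a 0 i).
Proof.
have weight_exp phi k : is_weight phi -> is_weight (fun z => phi z ^+ k).
  move=> h; elim: k => [|k IH]; first exact: weight_one.
  by apply: weight_ext (weight_mul h IH) => z _; rewrite exprS.
have weight_prod (I : Type) (r : seq I) (F : I -> 'rV[K]_n -> K) :
    (forall i, is_weight (F i)) -> is_weight (fun z => \prod_(i <- r) F i z).
  move=> h; elim: r => [|i r IH].
    by apply: weight_ext weight_one => z _; rewrite big_nil.
  by apply: weight_ext (weight_mul (h i) IH) => z _; rewrite big_cons.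
apply: weight_prod => i; case: (a 0 i) => k; first exact/weight_exp/weight_coord.
apply: (@weight_ext (fun z => (z 0 i)^-1 ^+ k.+1)) => [z _|]; first by rewrite exprVn.
exact/weight_exp/weight_coordV.
Qed.

Lemma size_prod_bound (I : Type) (r : seq I) (F : I -> {poly K}) B :
  (forall i, size (F i) <= B)%N -> (size (\prod_(i <- r) F i)%R <= (B * size r).+1)%N.
Proof.
move=> h; elim: r => [|i r IH]; first by rewrite big_nil size_poly1.
rewrite big_cons (leq_trans (size_polyMleq _ _)) //=.
by rewrite -subn1 leq_subLR mulnS (leq_trans (leq_add (h i) IH)) // addnS add1n ltnW.
Qed.

(** Each factor asks for one weight, and the other weights of the
    representation that provides it only contribute to the cofactor [D']. *)
Lemma torus_algebra (s : seq ('rV[int]_n * nat)) : (forall ak, ak \in s -> 0 < ak.2)%N ->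
  exists m (A : 'M[K]_n -> 'M[K]_m) (w : 'I_m -> nat) (chi : 'I_m -> 'rV[K]_n -> K) N,
    [/\ is_mxrep A, forall i, (0 < w i)%N,
        forall g, g \in unitmx -> respects w (A g),
        forall z : 'rV[K]_n, (forall i, z 0 i != 0) -> A (diag_mx z) = diag_mx (\row_i chi i z)
      & forall z : 'rV[K]_n, (forall i, z 0 i != 0) -> exists D' : {poly K}, (size D' <= N)%N /\
          sym_denom w chi z =
            \prod_(ak <- s) (1 - (\prod_(i < n) z 0 i ^ ak.1 0 i) *: 'X^(ak.2)) * D'].
Proof.
elim: s => [|[a k] s IH] s0.
  exists 0%N, (fun=> 1%:M), (fun=> 1%N), (fun _ _ => 1), 1%N; split=> //.
  - exact: mxrep_cst.
  - by move=> z _; apply/matrixP => -[].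
  by move=> z _; exists 1; rewrite size_poly1 big_nil mulr1 /sym_denom big_ord0.
have [|m [A [w [chi [N [rA w0 resA tA hD]]]]]] := IH.
  by move=> ak h; apply: s0; rewrite inE h orbT.
have k0 : (0 < k)%N by apply: (s0 (a, k)); rewrite mem_head.
have [V [c [i0 hV]]] := weight_laurent a; set v := rep_dim V in c i0 hV.
pose w' (i : 'I_(v + m)) := match split i with inl _ => k | inr j => w j end.
pose chi' (i : 'I_(v + m)) := match split i with inl j => c j | inr j => chi j end.
have w'l i : w' (lshift m i) = k by rewrite /w' (unsplitK (inl _)).
have w'r i : w' (rshift v i) = w i by rewrite /w' (unsplitK (inr _)).
have chi'l i : chi' (lshift m i) = c i by rewrite /chi' (unsplitK (inl _)).
have chi'r i : chi' (rshift v i) = chi i by rewrite /chi' (unsplitK (inr _)).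
exists (v + m)%N, (fun g => block_mx (rep_mx V g) 0 0 (A g)), w', chi'.
exists (((k.+1) * size (index_enum 'I_v)).+1 + N)%N; split.
- by apply: mxrep_block => //; apply: rep_mxP.
- by move=> i; case: (split_ordP i) => j ->; rewrite ?w'l ?w'r.
- move=> g ug i j; case: (split_ordP i) => x ->; case: (split_ordP j) => y ->.
  + by rewrite !w'l eqxx.
  + by rewrite block_mxEur mxE.
  + by rewrite block_mxEdl mxE.
  by rewrite !w'r block_mxEdr; apply: resA.
- move=> z z0; have [-> _] := hV z z0; rewrite tA //; apply/matrixP => i j.
  case: (split_ordP i) => x ->; case: (split_ordP j) => y ->.
  + by rewrite block_mxEul !mxE chi'l (inj_eq (@lshift_inj _ _)).
  + by rewrite block_mxEur !mxE eq_lrshift.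
  + by rewrite block_mxEdl !mxE eq_rlshift.
  by rewrite block_mxEdr !mxE chi'r (inj_eq (@rshift_inj _ _)).
move=> z z0; have [D' [sD' eD']] := hD z z0; have [_ cz] := hV z z0.
exists ((\prod_(i < v | i != i0) (1 - c i z *: 'X^k)) * D'); split.
  apply: (leq_trans (size_polyMleq _ _)); rewrite -subn1 leq_subLR.
  apply: leq_trans (leq_addl _ _); apply: leq_add => //.
  rewrite -big_filter; apply: (@leq_trans (k.+1 * size [seq i <- index_enum 'I_v | i != i0]).+1).
    apply: size_prod_bound => i; rewrite (leq_trans (size_polyD _ _)) // geq_max size_poly1 /=.
    by rewrite size_polyN (leq_trans (size_scale_leq _ _)) // size_polyXn.
  by rewrite ltnS leq_mul2l size_filter count_size orbT.
rewrite /sym_denom big_split_ord /= big_cons /= (bigD1 i0) //= chi'l w'l cz.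
rewrite -!mulrA; congr (_ * _); rewrite [RHS]mulrCA; congr (_ * _).
  by apply: eq_bigr => i _; rewrite chi'l w'l.
by rewrite -eD'; apply: eq_bigr => i _; rewrite chi'r w'r.
Qed.

End Weights.

Section Evaluation.
Variables (K : fieldType) (n : nat) (z : 'rV[K]_n).
Hypothesis z0 : forall i, z 0 i != 0.
Local Notation frac := {fraction {mpoly int[n]}}.

Let ev (p : {mpoly int[n]}) : K := mmap intr (z 0) p.

(** A relation and not a function, since Laurent polynomials only form a
    subring of the fraction field. *)
Definition laurent_value (x : frac) (y : K) : Prop := exists p (a : 'X_{1..n}),
  x = tofrac p / tofrac 'X_[a] /\ y = ev p / mmap1 (z 0) a.

Let evX a : ev 'X_[a] = mmap1 (z 0) a. Proof. exact: mmapX. Qed.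

Let mmap1_neq0 (a : 'X_{1..n}) : mmap1 (z 0) a != 0.
Proof. by apply/prodf_neq0 => i _; rewrite expf_neq0. Qed.

Let tofracX_neq0 (a : 'X_{1..n}) : tofrac 'X_[a] != 0 :> frac.
Proof.
rewrite tofrac_eq0; apply/eqP => /(congr1 (mcoeff a)).
by rewrite mcoeffX eqxx mcoeff0.
Qed.

(** Together with the compatibility with sums, this makes the value unique. *)
Lemma value_zero y : laurent_value 0 y -> y = 0.
Proof.
move=> [p [a [/esym/eqP e ->]]]; move: e; rewrite mulf_eq0 invr_eq0.
by rewrite (negPf (tofracX_neq0 a)) orbF tofrac_eq0 => /eqP ->; rewrite /ev mmap0 mul0r.
Qed.

Lemma value_const c : laurent_value (tofrac c%:MP) c%:~R.
Proof.
by exists c%:MP, 0%MM; rewrite mpolyX0 tofrac1 divr1 /ev mmapC mmap11 divr1.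
Qed.

Lemma value_add x x' y y' : laurent_value x y -> laurent_value x' y' ->
  laurent_value (x + x') (y + y').
Proof.
move=> [p [a [-> ->]]] [q [b [-> ->]]].
exists (p * 'X_[b] + q * 'X_[a]), (a + b)%MM; split.
  by rewrite addf_div ?tofracX_neq0 // mpolyXD tofracD !tofracM.
by rewrite addf_div ?mmap1_neq0 // -!evX mpolyXD /ev mmapD !rmorphM.
Qed.

Lemma value_mul x x' y y' : laurent_value x y -> laurent_value x' y' ->
  laurent_value (x * x') (y * y').
Proof.
move=> [p [a [-> ->]]] [q [b [-> ->]]]; exists (p * q), (a + b)%MM; split.
  by rewrite mulf_div mpolyXD !tofracM.
by rewrite mulf_div /ev rmorphM /= -!evX mpolyXD /ev rmorphM.
Qed.

Lemma value_opp x y : laurent_value x y -> laurent_value (- x) (- y).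
Proof.
move=> [p [a [-> ->]]]; exists (- p), a.
by rewrite tofracN /ev mmapN !mulNr.
Qed.

Lemma value_0 : laurent_value 0 0.
Proof. by have := value_const 0; rewrite mpolyC0 tofrac0. Qed.

Lemma value_1 : laurent_value 1 1.
Proof. by have := value_const 1; rewrite mpolyC1 tofrac1. Qed.

Lemma value_sum (I : Type) (r : seq I) (F : I -> frac) (F' : I -> K) :
  (forall i, laurent_value (F i) (F' i)) ->
  laurent_value (\sum_(i <- r) F i) (\sum_(i <- r) F' i).
Proof.
move=> h; elim: r => [|i r IH]; first by rewrite !big_nil; exact: value_0.
by rewrite !big_cons; apply: value_add.
Qed.

Lemma value_monomial a :
  laurent_value (laurent_monomial a) (\prod_(i < n) z 0 i ^ a 0 i).
Proof.
rewrite /laurent_monomial.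
elim: (index_enum _) => [|i r IH]; first by rewrite !big_nil; exact: value_1.
rewrite !big_cons; apply: value_mul => //.
have mmapU k : mmap1 (z 0) (U_(i) *+ k)%MM = z 0 i ^+ k.
  rewrite /mmap1 (bigD1 i) //= mulmnE mnm1E eqxx mul1n big1 ?mulr1 // => j /negPf.
  by rewrite mulmnE mnm1E eq_sym => ->.
case: (a 0 i) => k.
  exists 'X_[U_(i) *+ k], 0%MM; split.
    by rewrite mpolyX0 tofrac1 divr1 -mpolyXn rmorphXn.
  by rewrite mmap11 divr1 evX mmapU.
exists 1, (U_(i) *+ k.+1)%MM; split.
  by rewrite tofrac1 mul1r -mpolyXn rmorphXn.
by rewrite /ev -mpolyC1 mmapC mul1r mmapU.
Qed.

Lemma value_mul_poly (p q : {poly frac}) (p' q' : {poly K}) :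
  (forall d, laurent_value p`_d p'`_d) -> (forall d, laurent_value q`_d q'`_d) ->
  forall d, laurent_value (p * q)`_d (p' * q')`_d.
Proof.
by move=> hp hq d; rewrite !coefM; apply: value_sum => i; apply: value_mul.
Qed.

Lemma value_denominator (s : seq ('rV[int]_n * nat)) d :
  laurent_value (\prod_(ak <- s) (1 - laurent_monomial ak.1 *: 'X^(ak.2)))`_d
    (\prod_(ak <- s) (1 - (\prod_(i < n) z 0 i ^ ak.1 0 i) *: 'X^(ak.2)))`_d.
Proof.
have bool_value (b : bool) : laurent_value b%:R b%:R.
  by case: b; [exact: value_1 | exact: value_0].
elim: s d => [|[a k] s IH] d.
  by rewrite !big_nil !coef1; apply: bool_value.
rewrite !big_cons; apply: value_mul_poly => {}d; last exact: IH.
rewrite !coefB !coef1 !coefZ !coefXn; apply: value_add; first exact: bool_value.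
by apply/value_opp/value_mul; [exact: value_monomial | exact: bool_value].
Qed.

End Evaluation.

(** * The theorem *)

(** If [E] is the inverse of [sigma], then [f] is [f E] times [sigma]. *)
Lemma series_of_denominator (K : comNzRingType) (f sigma : nat -> K) (E : {poly K}) d :
  (forall j, fps_mul_poly sigma E j = (j == 0%N)%:R) ->
  f d = \sum_(j < d.+1) fps_mul_poly f E j * sigma (d - j)%N.
Proof.
move=> sE; pose F := \poly_(i < d.+1) f i; pose S := \poly_(i < d.+1) sigma i.
have : (F * (S * E))`_d = f d.
  rewrite coefM (bigD1 ord_max) //= subnn -(fps_mul_trunc _ _ (ltn0Sn d)) sE mulr1.
  rewrite coef_poly ltnSn big1 ?addr0 // => j jd.
  rewrite -(fps_mul_trunc _ _ (N := d.+1)) ?ltnS ?leq_subr // sE.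
  suff -> : (d - j == 0)%N = false by rewrite mulr0.
  by apply/negbTE; rewrite subn_eq0 -ltnNge ltn_neqAle -ltnS ltn_ord andbT.
rewrite (mulrC S) mulrA coefM => <-; apply: eq_bigr => j _.
rewrite -(fps_mul_trunc _ _ (N := d.+1)) ?ltn_ord // coef_poly.
by rewrite ltnS leq_subr.
Qed.

(** Factors with exponent zero are nonzero constants, so that they can be
    cancelled. *)
Lemma nice_rational_positive n (f : nat -> {fraction {mpoly int[n]}}) :
  nice_rational f -> exists (s : seq ('rV[int]_n * nat)) B,
    (forall ak, ak \in s -> 0 < ak.2)%N /\
    forall d, (B <= d)%N ->
      fps_mul_poly f (\prod_(ak <- s) (1 - laurent_monomial ak.1 *: 'X^(ak.2))) d = 0.
Proof.
move=> [_ [P [s [_ D0 fD]]]].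
exists [seq ak <- s | (0 < ak.2)%N], (size P); split.
  by move=> ak; rewrite mem_filter => /andP[].
move=> d Pd; pose F (ak : 'rV[int]_n * nat) : {poly {fraction {mpoly int[n]}}} :=
  1 - laurent_monomial ak.1 *: 'X^(ak.2).
pose c := \prod_(ak <- s | ~~ (0 < ak.2)%N) (1 - laurent_monomial ak.1).
have eD : \prod_(ak <- s) F ak = (\prod_(ak <- [seq ak <- s | (0 < ak.2)%N]) F ak) * c%:P.
  rewrite big_filter (bigID (fun ak : 'rV[int]_n * nat => 0 < ak.2)%N) /=; congr (_ * _).
  rewrite rmorph_prod; apply: eq_bigr => ak; rewrite -eqn0Ngt => /eqP e.
  by rewrite /F e expr0 /= polyCB polyC1 alg_polyC.
have c0 : c != 0.
  by apply: contra D0 => /eqP e; rewrite [X in X == 0]eD e polyC0 mulr0.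
have := fD d; rewrite [X in fps_mul_poly f X d]eD nth_default // => h.
move/eqP: h; rewrite fps_mul_constr mulf_eq0 (negPf c0) orbF.
by move/eqP.
Qed.

Lemma rational_statement (f : nat -> int) : rational_series f ->
  exists (m : nat) (e : 'I_m -> nat) (P : {poly int}),
    [/\ (0 < m)%N, forall j, (0 < e j)%N
      & forall d, fps_mul_poly f (\prod_(j < m) (1 - 'X^(e j))) d = P`_d].
Proof.
(* The additional factor makes the number of factors positive. *)
move=> [es [P [es0 fP]]]; exists (size es).+1, (tnth (in_tuple (1%N :: es))), (P * (1 - 'X)).
have es0' : all (leq 1) (1%N :: es) by rewrite /= es0.
split=> // [j|d]; first by have := allP es0' _ (mem_tnth j (in_tuple (1%N :: es))).
rewrite -(big_tuple _ _ (in_tuple (1%N :: es)) xpredT (fun e => 1 - 'X^e : {poly int})) /=.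
rewrite big_cons mulrC -fps_mulA -fps_mul_coefs expr1.
exact: eq_fps_mul.
Qed.

Section Main.
Variables (K : fieldType) (charK : [pchar K] =i pred0) (n : nat) (G : 'M[K]_n -> Prop).
Hypothesis Gunit : forall g, G g -> g \in unitmx.
Hypothesis condG : invariant_modules_fin_gen G \/ invariant_algebras_fin_gen G.

(** The character series times the denominator of [S(W)] is a polynomial
    whose coefficients are virtual characters. Solving for the character
    series compares [Z], up to finitely many modules [V' (x) S(W)], with
    finitely many modules [V (x) S(W)]; equal characters have invariants of
    equal dimension. *)
Lemma hilbert_series_of_characters (Z : nat -> matrix_rep K n) (h : nat -> nat)
    m (A : 'M[K]_n -> 'M[K]_m) (w : 'I_m -> nat) (chi : 'I_m -> 'rV[K]_n -> K) B :
  is_mxrep A -> (forall i, 0 < w i)%N ->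
  (forall g, g \in unitmx -> respects w (A g)) ->
  (forall z : 'rV[K]_n, (forall i, z 0 i != 0) -> A (diag_mx z) = diag_mx (\row_i chi i z)) ->
  (forall z : 'rV[K]_n, (forall i, z 0 i != 0) -> forall d, (B <= d)%N ->
     fps_mul_poly (fun d => torus_char (Z d) z) (sym_denom w chi z) d = 0) ->
  (forall d, has_dim (mx_fixed G (Z d)) (h d)) ->
  rational_series (fun d => (h d)%:Z).
Proof.
move=> rA w0 resA tA fB hZ.
have tensor V := tensor_series Gunit rA w0 resA tA V condG.
have vsigma d : is_virtual (sym_char w chi d).
  have [T [H [TE _ _]]] := tensor (rep_one K n).
  by apply: virtual_ext (virtual_char (T d)) => z z0; rewrite TE // char_one mul1r.
have vP j : is_virtual (fun z => fps_mul_poly (fun d => torus_char (Z d) z) (sym_denom w chi z) j).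
  apply: virtual_sum => i; apply: virtual_mul; first exact: virtual_char.
  exact: virtual_sym_denom.
have /functional_choice[V /functional_choice[V' VE]] := vP.
have /functional_choice[T /functional_choice[H TH]] j := tensor (V j).
have /functional_choice[T' /functional_choice[H' TH']] j := tensor (V' j).
pose pick (X : nat -> nat -> matrix_rep K n) d (j : 'I_B) :=
  if (j <= d)%N then X j (d - j)%N else rep_zero K n.
pose pickn (X : nat -> nat -> nat) d (j : 'I_B) := if (j <= d)%N then X j (d - j)%N else 0%N.
have dimT d : has_dim (mx_fixed G (rep_sum (index_enum 'I_B) (pick T d)))
    (\sum_(j < B) pickn H d j).
  apply: fixed_sum => j; rewrite /pick /pickn; case: ifP => _; last exact: fixed_zero.
  by have [_ h' _] := TH j.
have dimT' d : has_dim (mx_fixed G (rep_sum (index_enum 'I_B) (pick T' d)))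
    (\sum_(j < B) pickn H' d j).
  apply: fixed_sum => j; rewrite /pick /pickn; case: ifP => _; last exact: fixed_zero.
  by have [_ h' _] := TH' j.
have hE d : (h d + \sum_(j < B) pickn H' d j = \sum_(j < B) pickn H d j)%N.
  have hd := mx_fixed_block (hZ d) (dimT' d).
  apply: (has_dim_unique _ (dimT d)).
  apply: (fixed_dim_of_character charK Gunit _ _ _ hd).
  - exact: (rep_mxP (rep_add (Z d) (rep_sum (index_enum 'I_B) (pick T' d)))).
  - exact: rep_mxP.
  move=> z z0; rewrite -[LHS]/(torus_char (rep_add (Z d) (rep_sum (index_enum 'I_B) (pick T' d))) z).
  rewrite -[RHS]/(torus_char (rep_sum (index_enum 'I_B) (pick T d)) z) char_add !char_sum.
  pose F j := fps_mul_poly (fun d => torus_char (Z d) z) (sym_denom w chi z) j *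
    sym_char w chi (d - j) z.
  have -> : torus_char (Z d) z = \sum_(j < B) if (j <= d)%N then F j else 0.
    rewrite (series_of_denominator (fun d => torus_char (Z d) z) d
      (fun j => sym_char_series chi w0 j z)).
    pose M := maxn B d.+1.
    transitivity (\sum_(j < M) if (j < B)%N then if (j <= d)%N then F j else 0 else 0).
      rewrite (big_ord_widen M F) ?leq_maxr // [LHS]big_mkcond.
      apply: eq_bigr => j _; rewrite ltnS; case: (ltnP j B) => // Bj; case: ifP => // _.
      by rewrite /F fB // mul0r.
    rewrite [RHS](big_ord_widen M (fun j => if (j <= d)%N then F j else 0)) ?leq_maxl //.
    by rewrite [RHS]big_mkcond.
  rewrite -big_split; apply: eq_bigr => j _ /=; rewrite /pick; case: ifP => _; last first.
    by rewrite char_zero addr0.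
  have [TE _ _] := TH j; have [TE' _ _] := TH' j.
  by rewrite TE // TE' // /F VE // mulrBl subrK.
have rat (X : nat -> nat -> nat) : (forall j, rational_series (fun d => (X j d)%:Z)) ->
    rational_series (fun d => \sum_(j < B) (pickn X d j)%:Z).
  move=> hX; apply: rational_sum => j.
  by apply: rational_ext (rational_shift j (hX j)) => d; rewrite /pickn; case: ifP.
have r1 := rat H (fun j => let: And3 _ _ r := TH j in r).
have r2 := rat H' (fun j => let: And3 _ _ r := TH' j in r).
apply: rational_ext (rational_add r1 (rational_opp r2)) => d.
have sumZ (F : 'I_B -> nat) : \sum_(j < B) (F j)%:Z = (\sum_(j < B) F j)%N%:Z.
  by rewrite -[RHS]natz natr_sum; apply: eq_bigr => j _; rewrite natz.
by rewrite !sumZ -hE PoszD addrK.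
Qed.

End Main.

Theorem theorem3p4 (K : fieldType) (charK : [pchar K] =i pred0) (n : nat)
    (G : 'M[K]_n -> Prop) (subgroupG : is_subgroup G)
    (condG : invariant_modules_fin_gen G \/ invariant_algebras_fin_gen G)
    (Z : lmodType K) (act : 'M[K]_n -> Z -> Z) (Zd : nat -> Z -> Prop)
    (repZ : is_graded_rep act Zd)
    (ch : nat -> {fraction {mpoly int[n]}})
    (chP : forall d, is_formal_char act (Zd d) (ch d))
    (ch_nice : nice_rational ch)
    (h : nat -> nat)
    (hP : forall d, has_dim (fun v => Zd d v /\ fixed G act v) (h d)) :
  exists (m : nat) (e : 'I_m -> nat) (P : {poly int}),
    [/\ (0 < m)%N,
        forall j, (0 < e j)%N
      & forall d, fps_mul_poly (fun k => (h k)%:Z)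
                    (\prod_(j < m) (1 - 'X^(e j))) d = P`_d].
Proof.
have Gunit := subgroup_unit subgroupG.
have ract := graded_rep_rational repZ.
have [s [B [s0 fB]]] := nice_rational_positive ch_nice.
have [m [A [w [chi [N [rA w0 resA tA hD]]]]]] := torus_algebra K s0.
have /functional_choice[V VP] d : exists V : matrix_rep K n,
    (forall z : 'rV[K]_n, (forall i, z 0 i != 0) -> laurent_value z (ch d) (torus_char V z)) /\
    has_dim (mx_fixed G V) (h d).
  have [k [e be]] := graded_rep_finite repZ d.
  have [rho [rrho erho]] := mxrep_of_subspace ract (graded_rep_invariant repZ (d := d)) be.
  exists (MatrixRep rrho); split=> [z z0|].
    have [p [a [-> tr]]] := chP d; exists p, a; split=> //.
    have uz : diag_mx z \in unitmx.
      by rewrite unitmxE unitfE det_diag; apply/prodf_neq0 => i _; apply: z0.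
    by rewrite (has_trace_unique (rep_linear ract uz) be (erho _ uz) (tr z z0)).
  apply: (mx_fixed_of_basis (act := act) _ be) (hP d) => g /Gunit ug.
    exact: rep_linear ract _ ug.
  exact: erho.
apply/rational_statement/(hilbert_series_of_characters charK Gunit condG (Z := V)
  (B := (B + N)%N) rA w0 resA tA) => [z z0 d Bd|d]; last by have [] := VP d.
have [D' [sD' ->]] := hD z z0.
rewrite -fps_mulA; apply: big1 => i _.
case: (leqP B i) => [Bi|iB]; last first.
  rewrite [X in _ * X]nth_default ?mulr0 // (leq_trans sD') //.
  by clear -iB Bd; lia.
suff -> : fps_mul_poly (fun d => torus_char (V d) z)
    (\prod_(ak <- s) (1 - (\prod_(i < n) z 0 i ^ ak.1 0 i) *: 'X^(ak.2))) i = 0.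
  by rewrite mul0r.
apply: (@value_zero _ _ z); rewrite -(fB i Bi); apply: value_sum => // j.
apply: value_mul; first by have [hv _] := VP j; apply: hv.
exact: value_denominator.
Qed.
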